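(* If ZF + $cf(\omega_1)=\omega_1$ + $\neg UD(\omega_1)$ is consistent, then so is ZFC + ''there is an inaccessible cardinal''.
   Context: A function $f$ is a uniform denumeration on $\omega_1$ iff $\mathrm{dom}(f)=\omega_1$ and $f(\alpha)$ is a function from $\omega$ onto $\alpha$ for each $1\le\alpha<\omega_1$. $UD(\omega_1)$ is the assertion that there exists a uniform denumeration on $\omega_1$. *)

(* Defs.v *)
From mathcomp Require Import all_boot.
From Stdlib Require Import List.
Set Implicit Arguments.
Unset Strict Implicit.
Unset Printing Implicit Defensive.

(** * Classical first-order logic with equality in the language of set theory

    Variables are de Bruijn indices; they are the only terms, so substitution
    is renaming.  The remaining connectives have their classical encodings. *)

Inductive form : Type :=
  | fBot : form
  | fMem : nat -> nat -> form
  | fEq  : nat -> nat -> form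
  | fImp : form -> form -> form
  | fAll : form -> form.

Declare Scope fol_scope.
Delimit Scope fol_scope with fol.
Bind Scope fol_scope with form.
Local Open Scope fol_scope.

Definition fNot (A : form) : form := fImp A fBot.
Definition fAnd (A B : form) : form := fNot (fImp A (fNot B)).
Definition fOr (A B : form) : form := fImp (fNot A) B.
Definition fIff (A B : form) : form := fAnd (fImp A B) (fImp B A).
Definition fEx (A : form) : form := fNot (fAll (fNot A)).

Notation "x ∈ y" := (fMem x y) (at level 70, no associativity) : fol_scope.
Notation "x ≐ y" := (fEq x y) (at level 70, no associativity) : fol_scope.
Notation "¬ A" := (fNot A) (at level 75, right associativity) : fol_scope.
Notation "A ∧ B" := (fAnd A B) (at level 80, right associativity) : fol_scope.
Notation "A ∨ B" := (fOr A B) (at level 85, right associativity) : fol_scope.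
Notation "A ⇒ B" := (fImp A B) (at level 90, right associativity) : fol_scope.
Notation "A ⇔ B" := (fIff A B) (at level 95, no associativity) : fol_scope.

(** In [fAllIn x A] and [fExIn x A] the bound [x] lives outside the binder,
    while the bound variable is index [0] in [A]. *)
Definition fAllIn (x : nat) (A : form) : form := fAll (0 ∈ x.+1 ⇒ A).
Definition fExIn (x : nat) (A : form) : form := fEx (0 ∈ x.+1 ∧ A).

Definition up (r : nat -> nat) (n : nat) : nat :=
  if n is m.+1 then (r m).+1 else 0.

Fixpoint ren (r : nat -> nat) (A : form) : form :=
  match A with
  | fBot => fBot
  | fMem x y => fMem (r x) (r y)
  | fEq x y => fEq (r x) (r y)
  | fImp B C => fImp (ren r B) (ren r C)
  | fAll B => fAll (ren (up r) B)
  end.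

(** [A] with its variable [0] instantiated by [y], the others shifted down. *)
Definition inst (y : nat) (A : form) : form :=
  ren (fun n => if n is m.+1 then m else y) A.

(** The least [k] such that all free variables of [A] are below [k]. *)
Fixpoint bound (A : form) : nat :=
  match A with
  | fBot => 0
  | fMem x y | fEq x y => maxn x.+1 y.+1
  | fImp B C => maxn (bound B) (bound C)
  | fAll B => (bound B).-1
  end.

Definition closure (A : form) : form := iter (bound A) fAll A.

Inductive prv : list form -> form -> Prop :=
  | prv_hyp G A : In A G -> prv G A
  | prv_impI G A B : prv (A :: G) B -> prv G (A ⇒ B)
  | prv_impE G A B : prv G (A ⇒ B) -> prv G A -> prv G B
  | prv_dneg G A : prv G (¬ ¬ A) -> prv G A
  | prv_allI G A : prv (List.map (ren S) G) A -> prv G (fAll A)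
  | prv_allE G A y : prv G (fAll A) -> prv G (inst y A)
  | prv_refl G x : prv G (x ≐ x)
  | prv_subst G A x y : prv G (x ≐ y) -> prv G (inst x A) -> prv G (inst y A).

Definition theory : Type := form -> Prop.

Definition proves (T : theory) (A : form) : Prop :=
  exists G : list form, (forall B, In B G -> T B) /\ prv G A.

Definition consistent (T : theory) : Prop := ~ proves T fBot.

Definition adjoin (T : theory) (A : form) : theory := fun B => T B \/ B = A.

(** * Basic set-theoretic formulas

    The arguments are indices in the context where the formula is used; they
    are shifted by one under each binder. *)

Definition is_empty (x : nat) : form := fAll (¬ 0 ∈ x.+1).

Definition is_subset (x y : nat) : form := fAllIn x (0 ∈ y.+1).

(** [y = x ∪ {x}] *)
Definition is_succ (y x : nat) : form :=
  fAll (0 ∈ y.+1 ⇔ (0 ∈ x.+1 ∨ 0 ≐ x.+1)).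

(** [p] is the power set of [x] *)
Definition is_power (p x : nat) : form := fAll (0 ∈ p.+1 ⇔ is_subset 0 x.+1).

(** [p = {x, y}] *)
Definition is_upair (p x y : nat) : form :=
  fAll (0 ∈ p.+1 ⇔ (0 ≐ x.+1 ∨ 0 ≐ y.+1)).

(** Kuratowski pair: [p = {{x}, {x, y}}] *)
Definition is_opair (p x y : nat) : form :=
  fAll (0 ∈ p.+1 ⇔ (is_upair 0 x.+1 x.+1 ∨ is_upair 0 x.+1 y.+1)).

(** [(x, y) ∈ f] *)
Definition is_value (f x y : nat) : form := fEx (is_opair 0 x.+1 y.+1 ∧ 0 ∈ f.+1).

Definition is_function (f : nat) : form :=
  fAllIn f (fEx (fEx (is_opair 2 1 0))) ∧
  fAll (fAll (fAll (is_value f.+3 2 1 ∧ is_value f.+3 2 0 ⇒ 1 ≐ 0))).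

Definition is_dom (f a : nat) : form := fAll (0 ∈ a.+1 ⇔ fEx (is_value f.+2 1 0)).

(** [f : a → b] *)
Definition is_map (f a b : nat) : form :=
  is_function f ∧ is_dom f a ∧ fAll (fAll (is_value f.+2 1 0 ⇒ 0 ∈ b.+2)).

Definition is_injective (f : nat) : form :=
  fAll (fAll (fAll (is_value f.+3 2 0 ∧ is_value f.+3 1 0 ⇒ 2 ≐ 1))).

Definition is_onto (f b : nat) : form := fAllIn b (fEx (is_value f.+2 0 1)).

Definition equipotent (a b : nat) : form :=
  fEx (is_map 0 a.+1 b.+1 ∧ is_injective 0 ∧ is_onto 0 b.+1).

Definition is_transitive (x : nat) : form := fAllIn x (is_subset 0 x.+1).

(** [∈] is a strict linear order on [x], and every nonempty subset of [x] has
    an [∈]-least element. *)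
Definition well_ordered_by_mem (x : nat) : form :=
  fAllIn x (¬ 0 ∈ 0) ∧
  fAllIn x (fAllIn x.+1 (fAllIn x.+2 (2 ∈ 1 ⇒ 1 ∈ 0 ⇒ 2 ∈ 0))) ∧
  fAllIn x (fAllIn x.+1 (1 ∈ 0 ∨ 1 ≐ 0 ∨ 0 ∈ 1)) ∧
  fAll (is_subset 0 x.+1 ∧ ¬ is_empty 0 ⇒ fExIn 0 (fAllIn 1 (1 ≐ 0 ∨ 1 ∈ 0))).

Definition is_ordinal (x : nat) : form := is_transitive x ∧ well_ordered_by_mem x.

(** Nonzero limit ordinals. *)
Definition is_limit (x : nat) : form :=
  is_ordinal x ∧ ¬ is_empty x ∧ ¬ fEx (is_succ x.+1 0).

Definition is_omega (w : nat) : form := is_limit w ∧ fAllIn w (¬ is_limit 0).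

(** Finite or denumerable. *)
Definition is_countable (x : nat) : form :=
  fEx (is_omega 0 ∧ fEx (is_map 0 x.+2 1 ∧ is_injective 0)).

(** The least uncountable ordinal. *)
Definition is_omega1 (w : nat) : form :=
  is_ordinal w ∧ ¬ is_countable w ∧ fAllIn w (is_countable 0).

(** [f : b → a], and every [x ∈ a] is below or equal to some value of [f]. *)
Definition is_cofinal (f b a : nat) : form :=
  is_map f b a ∧
  fAllIn a (fExIn b.+1 (fEx (is_value f.+3 1 0 ∧ (2 ≐ 0 ∨ 2 ∈ 0)))).

(** [b = cf(a)]: the least ordinal with a cofinal map into [a]. *)
Definition is_cf (b a : nat) : form :=
  is_ordinal b ∧ fEx (is_cofinal 0 b.+1 a.+1) ∧
  fAllIn b (¬ fEx (is_cofinal 0 1 a.+2)).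

(** Initial ordinals. *)
Definition is_cardinal (k : nat) : form :=
  is_ordinal k ∧ fAllIn k (¬ equipotent 0 k.+1).

(** Uncountable regular strong limit cardinals; the last conjunct says that
    [2^l < k] for every cardinal [l < k]. *)
Definition is_inaccessible (k : nat) : form :=
  is_cardinal k ∧ fExIn k (is_omega 0) ∧ is_cf k k ∧
  fAllIn k (is_cardinal 0 ⇒
    fExIn k.+1 (is_cardinal 0 ∧ fEx (is_power 0 2 ∧ equipotent 1 0))).

Definition ax_extensionality : form :=
  fAll (fAll (fAll (0 ∈ 2 ⇔ 0 ∈ 1) ⇒ 1 ≐ 0)).

Definition ax_foundation : form :=
  fAll (¬ is_empty 0 ⇒ fExIn 0 (¬ fExIn 1 (0 ∈ 1))).

Definition ax_pairing : form := fAll (fAll (fEx (is_upair 0 2 1))).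

Definition ax_union : form :=
  fAll (fEx (fAll (0 ∈ 1 ⇔ fEx (1 ∈ 0 ∧ 0 ∈ 3)))).

Definition ax_power : form := fAll (fEx (is_power 0 1)).

Definition ax_infinity : form :=
  fEx (fExIn 0 (is_empty 0) ∧ fAllIn 0 (fExIn 1 (is_succ 0 1))).

(** [∀a ∃b ∀x (x ∈ b ⇔ x ∈ a ∧ A(x))], where in [A] the index [0] is [x] and
    the indices from [1] on are parameters, renamed to avoid [a] and [b]. *)
Definition ax_separation (A : form) : form :=
  closure (fAll (fEx (fAll (0 ∈ 1 ⇔
    (0 ∈ 2 ∧ ren (fun n => if n is m.+1 then m.+3 else 0) A))))).

(** [∀x ∀y ∀z (A(x,y) ∧ A(x,z) ⇒ y = z) ⇒
     ∀a ∃b ∀y (y ∈ b ⇔ ∃x (x ∈ a ∧ A(x,y)))],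
    where in [A] the index [1] is [x], the index [0] is [y], and the indices
    from [2] on are parameters. *)
Definition ax_replacement (A : form) : form :=
  closure (fAll (fAll (fAll (ren S A ∧ ren (up S) A ⇒ 1 ≐ 0))) ⇒
    fAll (fEx (fAll (0 ∈ 1 ⇔
      fEx (0 ∈ 3 ∧
        ren (fun n => match n with 0 => 1 | 1 => 0 | m.+2 => m.+4 end) A))))).

(** Every family of nonempty sets has a choice function. *)
Definition ax_choice : form :=
  fAll (fAllIn 0 (¬ is_empty 0) ⇒
    fEx (is_function 0 ∧ is_dom 0 1 ∧
      fAllIn 1 (fEx (is_value 2 1 0 ∧ 0 ∈ 1)))).

Inductive ZF : theory :=
  | ZF_extensionality : ZF ax_extensionality
  | ZF_foundation : ZF ax_foundation
  | ZF_pairing : ZF ax_pairing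
  | ZF_union : ZF ax_union
  | ZF_power : ZF ax_power
  | ZF_infinity : ZF ax_infinity
  | ZF_separation A : ZF (ax_separation A)
  | ZF_replacement A : ZF (ax_replacement A).

Definition ZFC : theory := adjoin ZF ax_choice.

(** [cf(ω₁) = ω₁] *)
Definition omega1_regular : form := fEx (is_omega1 0 ∧ is_cf 0 0).

(** [dom(f) = w], and [f(a)] maps [ω] onto [a] whenever [1 ≤ a < w]. *)
Definition is_uniform_denumeration (f w : nat) : form :=
  is_function f ∧ is_dom f w ∧
  fAllIn w (fEx (0 ∈ 1) ⇒
    fEx (is_value f.+2 1 0 ∧
      fEx (is_omega 0 ∧ is_map 1 0 2 ∧ is_onto 1 2))).

(** [UD(ω₁)] *)
Definition UD_omega1 : form :=
  fEx (is_omega1 0 ∧ fEx (is_uniform_denumeration 0 1)).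

Definition exists_inaccessible : form := fEx (is_inaccessible 0).

(* Main.v *)
(** Let k be the first uncountable ordinal of a model M of ZF + cf(ω₁) = ω₁ +
    ¬UD(ω₁), which exists by completeness.  The constructible universe L of M
    satisfies ZFC, and k is regular in L.  If l < k and L contained a map from l
    onto every nonzero ordinal below k, then the least such maps in the canonical
    well-ordering of L, composed with one enumeration of l in M, would form a
    uniform denumeration.  Hence k is a limit cardinal of L.  Condensation in L
    places the constructible subsets of l below every ordinal b such that l does
    not map onto b in L, so k is a strong limit in L.

    L is generated without internal formulas: ordinals are names, and by Gödel
    pairing a name encodes a level, one of eight operations, and two names.  An
    ordinal also encodes the environment of its iterated projections, so that
    the operations suffice for separation by an induction on external formulas,
    and condensation is an induction along an order isomorphism that commutes
    with pairing. *)

From mathcomp Require Import all_boot.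
From Stdlib Require Import List Classical ClassicalEpsilon FunctionalExtensionality PropExtensionality ProofIrrelevance.
Require Import Defs.
Set Implicit Arguments.
Unset Strict Implicit.
Unset Printing Implicit Defensive.

(** * Semantics and completeness of first-order logic *)

(** Separation and replacement hold only for formulas, while the arguments are written with Rocq
    predicates and functions on the model. Each such object therefore carries a certificate of
    definability, [Df] or [DfT], found by proof search. This is also why facts about L are
    relativised to the ambient model before any induction on them.

    One structure [zf] serves for the ambient model and for L: the theory of names is developed once
    and then applied inside L, where absoluteness turns it into V = L.

    Of the eight operations, 1 and 2 give the connectives and the quantifier, 3 to 5 the atomic
    formulas at the indices 0 and 1, 6 and 7 the remaining indices, and 8 fixes the parameters.
    Gödel's order of pairs fits because a code is never below its components, so that recursion on
    names descends, and because it depends on the order of the ordinals alone, which makes it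
    absolute and compatible with collapses.

    In ZF alone ω₁ may be singular, so its regularity has to come from the hypothesis. *)

Definition scons (M : Type) (x : M) (e : nat -> M) (n : nat) : M :=
  if n is m.+1 then e m else x.
Notation "x .: e" := (scons x e) (at level 55, right associativity).

Fixpoint sat (M : Type) (E : M -> M -> Prop) (e : nat -> M) (A : form) : Prop :=
  match A with
  | fBot => False
  | fMem x y => E (e x) (e y)
  | fEq x y => e x = e y
  | fImp B C => sat E e B -> sat E e C
  | fAll B => forall x, sat E (x .: e) B
  end.

Lemma scons_up (M : Type) (x : M) e r :
  (fun n => (x .: e) (up r n)) = x .: (fun n => e (r n)).
Proof. by apply: functional_extensionality; case. Qed.

Section Sat.
Variables (M : Type) (E : M -> M -> Prop).
Implicit Types (e : nat -> M) (A B : form).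

Lemma sat_ren e r A : sat E e (ren r A) <-> sat E (fun n => e (r n)) A.
Proof.
elim: A e r => [|x y|x y|A IHA B IHB|A IHA] e r //=.
  by have := IHA e r; have := IHB e r; tauto.
by split=> H x; have := H x; rewrite IHA scons_up.
Qed.

Lemma sat_inst e y A : sat E e (inst y A) <-> sat E (e y .: e) A.
Proof.
rewrite sat_ren; suff -> : (fun n => e (if n is m.+1 then m else y)) = e y .: e by [].
by apply: functional_extensionality; case.
Qed.

Lemma sat_not e A : sat E e (fNot A) <-> ~ sat E e A.
Proof. by []. Qed.

Lemma sat_and e A B : sat E e (fAnd A B) <-> sat E e A /\ sat E e B.
Proof. by rewrite /=; tauto. Qed.

Lemma sat_or e A B : sat E e (fOr A B) <-> sat E e A \/ sat E e B.
Proof. by rewrite /=; tauto. Qed.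

Lemma sat_iff e A B : sat E e (fIff A B) <-> (sat E e A <-> sat E e B).
Proof. by rewrite /=; tauto. Qed.

Lemma sat_ex e A : sat E e (fEx A) <-> exists x, sat E (x .: e) A.
Proof.
split=> /= [H|[x Hx] H]; last exact: (H x).
by apply: NNPP => H'; apply: H => x Hx; apply: H'; exists x.
Qed.

Lemma sat_allIn e x A :
  sat E e (fAllIn x A) <-> forall y, E y (e x) -> sat E (y .: e) A.
Proof. by []. Qed.

Lemma sat_exIn e x A :
  sat E e (fExIn x A) <-> exists y, E y (e x) /\ sat E (y .: e) A.
Proof. by rewrite sat_ex; split=> -[y]; rewrite ?sat_and => H; exists y; rewrite ?sat_and. Qed.

Lemma sat_iter_all n A :
  (forall e, sat E e (iter n fAll A)) <-> (forall e, sat E e A).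
Proof.
split=> H e; last by elim: n e => [|n IHn] e //= x; apply: IHn.
(* Start from the tail of [e]: the [n] quantifiers, outermost first, put back [e (n-1)], ...,
   [e 0]. *)
have {}H := H (fun k => e (n + k)).
have: forall e', (forall k, e (n + k) = e' k) -> sat E e' (iter n fAll A) -> sat E e A.
  elim: n {H} => [|n IHn] e' He' /= Hs.
    by rewrite (_ : e = e') //; apply: functional_extensionality => k; rewrite -He'.
  by apply: (IHn (e n .: e')); [case=> [|k]; rewrite ?addn0 // addnS -addSn He' | apply: Hs].
by apply; [|exact: H].
Qed.

Lemma soundness G A : prv G A ->
  forall e, (forall B, In B G -> sat E e B) -> sat E e A.
Proof.
elim=> {G A} [G A H|G A B _ IH|G A B _ IH1 _ IH2|G A _ IH|G A _ IH|G A y _ IH|G x|G A x y _ IH1 _ IH2] e He.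
- exact: He.
- by move=> HA; apply: IH => C [<- //|]; apply: He.
- exact: (IH1 e He (IH2 e He)).
- by apply: NNPP; apply: (IH e He).
- by move=> x; apply: IH => B /in_map_iff[C [<- HC]]; apply/sat_ren; apply: He.
- by apply/sat_inst; apply: (IH e He).
- by [].
- by apply/sat_inst; rewrite -[e y](IH1 e He); apply/sat_inst; apply: IH2.
Qed.

End Sat.

Lemma model_consistent (M : Type) (E : M -> M -> Prop) (T : theory) (x0 : M) :
  (forall A, T A -> forall e, sat E e A) -> consistent T.
Proof.
move=> HT [G [HG Hp]].
by apply: (soundness (E := E) Hp (e := fun=> x0)) => B HB; apply/HT/HG.
Qed.

Lemma ren_ext r s A : r =1 s -> ren r A = ren s A.
Proof. by move/functional_extensionality=> ->. Qed.

Lemma up_comp r s n : up r (up s n) = up (fun k => r (s k)) n.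
Proof. by case: n. Qed.

Lemma ren_comp r s A : ren r (ren s A) = ren (fun n => r (s n)) A.
Proof.
elim: A r s => [|x y|x y|A IHA B IHB|A IHA] r s //=; first by rewrite IHA IHB.
by rewrite IHA (ren_ext _ (up_comp r s)).
Qed.

Lemma ren_bound r s A : (forall n, n < bound A -> r n = s n) -> ren r A = ren s A.
Proof.
elim: A r s => [|x y|x y|A IHA B IHB|A IHA] r s //= H.
- by rewrite !H // leq_max leqnn ?orbT.
- by rewrite !H // leq_max leqnn ?orbT.
- by rewrite (IHA r s) ?(IHB r s) // => n Hn; apply: H; rewrite leq_max Hn ?orbT.
rewrite (IHA (up r) (up s)) // => -[|n] //= Hn; rewrite H //.
by move: Hn; case: (bound A).
Qed.

Lemma ren_id A : ren id A = A.
Proof.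
elim: A => [|x y|x y|A IHA B IHB|A IHA] //=; first by rewrite IHA IHB.
by rewrite -{2}IHA (@ren_ext (up id) id) //; case.
Qed.

Lemma ren_closed r A : bound A = 0 -> ren r A = A.
Proof. by move=> HA; rewrite -{2}(ren_id A); apply: ren_bound; rewrite HA. Qed.

Lemma bound_iter_all n A : bound (iter n fAll A) = bound A - n.
Proof. by elim: n => [|n IHn] /=; rewrite ?subn0 // IHn subnS. Qed.

Lemma bound_closure A : bound (closure A) = 0.
Proof. by rewrite bound_iter_all subnn. Qed.

Lemma prv_weaken G G' A : prv G A -> (forall B, In B G -> In B G') -> prv G' A.
Proof.
move=> H; elim: H G' => {G A}.
- by move=> G A HA G' HG; apply/prv_hyp/HG.
- move=> G A B _ IH G' HG; apply/prv_impI/IH => C /= [->|HC]; [by left|right; exact: HG].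
- by move=> G A B _ IH1 _ IH2 G' HG; apply: (prv_impE (IH1 _ HG)); apply: IH2.
- by move=> G A _ IH G' HG; apply/prv_dneg/IH.
- move=> G A _ IH G' HG; apply/prv_allI/IH => B /in_map_iff[C [<- HC]].
  by apply/in_map_iff; exists C; split=> //; apply: HG.
- by move=> G A y _ IH G' HG; apply/prv_allE/IH.
- by move=> *; apply: prv_refl.
- by move=> G A x y _ IH1 _ IH2 G' HG; apply: (prv_subst (IH1 _ HG)); apply: IH2.
Qed.

Lemma ren_inst r y A : ren r (inst y A) = inst (r y) (ren (up r) A).
Proof. by rewrite /inst !ren_comp; apply: ren_ext; case. Qed.

Lemma prv_ren G A : prv G A -> forall r, prv (List.map (ren r) G) (ren r A).
Proof.
elim=> {G A}.
- by move=> G A HA r; apply/prv_hyp/List.in_map.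
- by move=> G A B _ IH r; apply/prv_impI/IH.
- by move=> G A B _ IH1 _ IH2 r; apply: (prv_impE (IH1 r)); apply: IH2.
- by move=> G A _ IH r; apply/prv_dneg/IH.
- move=> G A _ IH r; apply: prv_allI; have := IH (up r).
  by rewrite !List.map_map (List.map_ext _ (fun B => ren S (ren r B))) // => B; rewrite !ren_comp.
- by move=> G A y _ IH r; rewrite ren_inst; apply/prv_allE/IH.
- by move=> *; apply: prv_refl.
- move=> G A x y _ IH1 _ IH2 r; rewrite ren_inst; apply: (prv_subst (IH1 r)).
  by rewrite -ren_inst; apply: IH2.
Qed.

(** A variable beyond everything free in [G] and [fAll A] acts as an eigenvariable: sending it to 0
    and shifting all others turns [inst y A] back into [A] and agrees with [ren S] on [G]. *)
Lemma prv_generalize G A y :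
  (forall B, In B G -> bound B <= y) -> bound A <= y.+1 ->
  prv G (inst y A) -> prv G (fAll A).
Proof.
move=> HG HA H; apply: prv_allI.
have := prv_ren H (fun n => if n == y then 0 else n.+1).
rewrite ren_inst (_ : inst _ _ = A).
  rewrite (List.map_ext_in _ (ren S)) // => B HB; apply: ren_bound => n Hn.
  by rewrite ltn_eqF // (leq_trans Hn (HG _ HB)).
rewrite /inst ren_comp -{2}(ren_id A) eqxx; apply: ren_bound => -[|n] //= Hn.
by rewrite ltn_eqF //= -ltnS (leq_trans Hn).
Qed.

(** An embedding into a type already known to be countable, which supplies the enumeration of
    formulas for the Henkin construction. *)
Fixpoint form_tree (A : form) : GenTree.tree nat :=
  match A with
  | fBot => GenTree.Node 0 [::]
  | fMem x y => GenTree.Node 1 [:: GenTree.Leaf x; GenTree.Leaf y]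
  | fEq x y => GenTree.Node 2 [:: GenTree.Leaf x; GenTree.Leaf y]
  | fImp B C => GenTree.Node 3 [:: form_tree B; form_tree C]
  | fAll B => GenTree.Node 4 [:: form_tree B]
  end.

Lemma form_tree_inj : injective form_tree.
Proof.
elim=> [|x y|x y|A IHA B IHB|A IHA] [|x' y'|x' y'|A' B'|A'] //=.
- by case=> -> ->.
- by case=> -> ->.
- by case=> /IHA -> /IHB ->.
- by case=> /IHA ->.
Qed.

(** * Henkin's construction of a term model *)

Section Completeness.
Variable T : theory.
Hypothesis T_closed : forall A, T A -> bound A = 0.
Hypothesis T_consistent : consistent T.

(** The theory may be infinite, so the finite list of formulas added to it is kept apart; fresh
    variables need to avoid only that list, because the axioms are closed. *)
Definition derives (G : list form) (A : form) : Prop :=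
  exists H, (forall B, In B H -> T B \/ In B G) /\ prv H A.

Lemma derives_prv G H A : (forall B, In B H -> derives G B) -> prv H A -> derives G A.
Proof.
move=> HH HA.
suff [K [HK1 HK2]] : exists K, (forall B, In B K -> T B \/ In B G) /\ forall B, In B H -> prv K B.
  exists K; split=> //; elim: H A {HH} HA HK2 => [|B H IH] A HA HK2.
    by apply: (prv_weaken HA).
  apply: (prv_impE (A := B)); last by apply: HK2; left.
  by apply: IH; [apply: prv_impI | move=> C HC; apply: HK2; right].
elim: H HH {HA} => [|B H IH] HH; first by exists [::].
have [K [HK1 HK2]] := IH (fun C HC => HH C (or_intror HC)).
have [K' [HK1' HK2']] := HH B (or_introl erefl).
exists (K ++ K'); split=> [C /in_app_iff[]|C /= [<-|HC]]; auto.
  by apply: (prv_weaken HK2') => D HD; apply/in_app_iff; right.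
by apply: (prv_weaken (HK2 _ HC)) => D HD; apply/in_app_iff; left.
Qed.

Lemma derives_hyp G A : In A G -> derives G A.
Proof.
by move=> HA; exists [:: A]; split=> [B [<-|[]]|]; [right | apply: prv_hyp; left].
Qed.

Lemma derives_theory G A : T A -> derives G A.
Proof.
by move=> HA; exists [:: A]; split=> [B [<-|[]]|]; [left | apply: prv_hyp; left].
Qed.

Lemma derives_mono G G' A : (forall B, In B G -> In B G') -> derives G A -> derives G' A.
Proof.
move=> HG [H [HH HA]]; exists H; split=> // B HB.
by case: (HH B HB); [left | right; apply: HG].
Qed.

Lemma derives_impI G A B : derives (A :: G) B -> derives G (fImp A B).
Proof.
case=> H [HH HB].
have [K [HK1 HK2]] : exists K, (forall C, In C K -> T C \/ In C G) /\
    forall C, In C H -> In C (A :: K).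
  elim: H HH {HB} => [|C H IH] HH; first by exists [::].
  have [K [HK1 HK2]] := IH (fun D HD => HH D (or_intror HD)).
  have [HC|[<-|HC]] := HH C (or_introl erefl).
  - exists (C :: K); split=> D /= [<-|HD]; auto.
    by case: (HK2 D HD); auto.
  - by exists K; split=> // D /= [<-|HD]; [left | apply: HK2].
  - exists (C :: K); split=> D /= [<-|HD]; auto.
    by case: (HK2 D HD); auto.
by exists K; split=> //; apply/prv_impI/(prv_weaken HB).
Qed.

Lemma derives_impE G A B : derives G (fImp A B) -> derives G A -> derives G B.
Proof.
move=> H1 H2; apply: (derives_prv (H := [:: fImp A B; A])).
  by move=> C [<-|[<-|[]]].
by apply: (prv_impE (A := A)); apply: prv_hyp; [left | right; left].
Qed.

Lemma derives_dneg G A : derives G (fNot (fNot A)) -> derives G A.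
Proof.
move=> H1; apply: (derives_prv (H := [:: fNot (fNot A)])); first by move=> C [<-|[]].
by apply/prv_dneg/prv_hyp; left.
Qed.

Definition fresh (G : list form) : nat := foldr maxn 0 (List.map bound G).

Lemma fresh_le G A : In A G -> bound A <= fresh G.
Proof.
elim: G => //= B G IH [->|/IH HA]; first exact: leq_maxl.
exact: leq_trans HA (leq_maxr _ _).
Qed.

Lemma derives_generalize G A y : fresh G <= y -> bound A <= y.+1 ->
  derives G (inst y A) -> derives G (fAll A).
Proof.
move=> HG HA [H [HH Hp]]; exists H; split=> //.
apply: (prv_generalize _ HA Hp) => B HB.
by case: (HH B HB) => [HB'|/fresh_le HB']; [rewrite (T_closed HB') | apply: leq_trans HG].
Qed.

Definition lconsistent (G : list form) : Prop := ~ derives G fBot.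

(** Variables serve as Henkin constants: a rejected universal formula receives a counterexample at a
    variable fresh for it and for the current list, so the language is never extended. *)
Definition henkin_witness (G : list form) (A : form) : list form :=
  if A is fAll B then [:: fNot (inst (fresh (A :: G)) B)] else [::].

Definition extend (G : list form) (A : form) : list form :=
  if excluded_middle_informative (lconsistent (A :: G)) then A :: G
  else henkin_witness G A ++ fNot A :: G.

(** If [A] cannot be added, then [G] derives its negation. If [A] is [fAll B] and the counterexample
    led to a contradiction, the instance of [B] at the fresh variable would be derivable, hence
    [fAll B] by generalization, against that negation. *)
Lemma extend_consistent G A : lconsistent G -> lconsistent (extend G A).
Proof.
move=> HG; rewrite /extend; case: excluded_middle_informative => [//|HA'] /=; have HA := NNPP _ HA'; clear HA'.
have HnA : derives G (fNot A) by apply: derives_impI.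
have HGn : lconsistent (fNot A :: G).
  by move=> H; apply: HG; apply: derives_impE (derives_impI H) HnA.
case: A HA HnA HGn => [|x y|x y|B C|B] HA HnA HGn //= H; apply: HGn.
set y := fresh _ in H.
apply: (derives_impE (A := fAll B)); first by apply: derives_hyp; left.
apply: (derives_generalize (y := y)); rewrite /y.
- by rewrite /fresh /= maxn0.
- by rewrite /fresh /=; case: (bound B) => [|b] //=; rewrite ltnS leq_maxl.
exact/derives_dneg/derives_impI.
Qed.

Fixpoint stage (n : nat) : list form :=
  if n is m.+1 then
    if excluded_middle_informative (exists A, pickle (form_tree A) = m) is left H
    then extend (stage m) (proj1_sig (constructive_indefinite_description _ H))
    else stage m
  else [::].

Lemma stage_consistent n : lconsistent (stage n).
Proof.
elim: n => [|n IH] /=.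
  case=> H [HH Hp]; apply: T_consistent; exists H; split=> // B HB.
  by case: (HH B HB).
by case: excluded_middle_informative => [H|//]; apply: extend_consistent.
Qed.

Lemma stageS n A : In A (stage n) -> In A (stage n.+1).
Proof.
move=> HA /=; case: excluded_middle_informative => [H|//]; rewrite /extend.
case: excluded_middle_informative => [?|?] /=; first by right.
by apply/in_app_iff; right; right.
Qed.

Lemma stage_mono m n A : m <= n -> In A (stage m) -> In A (stage n).
Proof.
move=> /subnK <-; elim: (n - m) => [|k IH] // /IH H.
by rewrite addSn; apply: stageS.
Qed.

Definition Omega (A : form) : Prop := exists n, In A (stage n).

Lemma stage_decides A : exists G, lconsistent G /\ (forall B, In B (extend G A) -> Omega B).
Proof.
set m := pickle (form_tree A); exists (stage m); split; first exact: stage_consistent.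
move=> B HB; exists m.+1 => /=.
case: excluded_middle_informative => [H|[]]; last by exists A.
case: constructive_indefinite_description => A' /= HA'.
by rewrite (form_tree_inj (pcan_inj pickleK HA')).
Qed.

Lemma Omega_not A : Omega A \/ Omega (fNot A).
Proof.
have [G [HG Hex]] := stage_decides A; move: Hex; rewrite /extend.
case: excluded_middle_informative => [?|?] /= H; [left | right]; apply: H; first by left.
by apply/in_app_iff; right; left.
Qed.

Lemma Omega_derives A : Omega A <-> exists n, derives (stage n) A.
Proof.
split=> -[n Hn]; first by exists n; apply: derives_hyp.
have [//|[m Hm]] := Omega_not A.
case: (@stage_consistent (maxn n m)); apply: (derives_impE (A := A)).
  by apply: derives_hyp; apply: stage_mono Hm; apply: leq_maxr.
by apply: derives_mono Hn => B; apply: stage_mono; apply: leq_maxl.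
Qed.

Lemma Omega_theory A : T A -> Omega A.
Proof. by move=> HA; apply/Omega_derives; exists 0; apply: derives_theory. Qed.

Lemma Omega_prv G A : (forall B, In B G -> Omega B) -> prv G A -> Omega A.
Proof.
move=> HG HA; apply/Omega_derives.
have [n Hn] : exists n, forall B, In B G -> In B (stage n).
  elim: G HG {HA} => [|B G IH] HG; first by exists 0.
  have [n Hn] := IH (fun C HC => HG C (or_intror HC)).
  have [m Hm] := HG B (or_introl erefl).
  exists (maxn n m) => C /= [<-|HC]; first exact: stage_mono (leq_maxr _ _) Hm.
  exact: stage_mono (leq_maxl _ _) (Hn _ HC).
by exists n; apply: (derives_prv _ HA) => B /Hn; apply: derives_hyp.
Qed.

Lemma Omega_bot : ~ Omega fBot.
Proof. by case=> n /derives_hyp; apply: stage_consistent. Qed.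

Lemma Omega_impE A B : Omega (fImp A B) -> Omega A -> Omega B.
Proof.
move=> H1 H2; apply: (@Omega_prv [:: fImp A B; A]); first by move=> C [<-|[<-|[]]].
by apply: (prv_impE (A := A)); apply: prv_hyp; [left | right; left].
Qed.

Lemma Omega_imp A B : Omega (fImp A B) <-> (Omega A -> Omega B).
Proof.
split; first exact: Omega_impE.
move=> H; have [/H HB|HA] := Omega_not A.
  apply: (@Omega_prv [:: B]); first by move=> C [<-|[]].
  by apply/prv_impI/prv_hyp; right; left.
apply: (@Omega_prv [:: fNot A]); first by move=> C [<-|[]].
apply/prv_impI/prv_dneg/prv_impI; apply: (prv_impE (A := A)); apply: prv_hyp.
  by right; right; left.
by right; left.
Qed.

Lemma Omega_all A : Omega (fAll A) <-> forall y, Omega (inst y A).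
Proof.
split=> [H y|H].
  apply: (@Omega_prv [:: fAll A]); first by move=> C [<-|[]].
  by apply/prv_allE/prv_hyp; left.
have [G [HG]] := stage_decides (fAll A); rewrite /extend.
case: excluded_middle_informative => [?|?] /= HO; first by apply: HO; left.
by case: Omega_bot; apply: (Omega_impE _ (H (fresh (fAll A :: G)))); apply: HO; left.
Qed.

Lemma Omega_subst A x y : Omega (fEq x y) -> Omega (inst x A) -> Omega (inst y A).
Proof.
move=> H1 H2; apply: (@Omega_prv [:: fEq x y; inst x A]).
  by move=> C [<-|[<-|[]]].
by apply: (@prv_subst _ A x y); apply: prv_hyp; [left | right; left].
Qed.

Lemma Omega_refl x : Omega (fEq x x).
Proof. by apply: (@Omega_prv [::]) => //; apply: prv_refl. Qed.

Lemma Omega_sym x y : Omega (fEq x y) -> Omega (fEq y x).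
Proof.
by move=> H; have := @Omega_subst (fEq 0 x.+1) x y H; apply; apply: Omega_refl.
Qed.

Lemma Omega_trans x y z : Omega (fEq x y) -> Omega (fEq y z) -> Omega (fEq x z).
Proof. by move=> H1 H2; apply: (@Omega_subst (fEq x.+1 0) y z H2). Qed.

(** Canonical representatives replace equivalence classes, so that equality in the term model is
    Rocq equality. Provably equal variables determine the same predicate, and [epsilon] then picks
    the same value. *)
Definition rep (x : nat) : nat :=
  epsilon (inhabits 0) (fun y => Omega (fEq x y)).

Lemma Omega_rep x : Omega (fEq x (rep x)).
Proof.
by apply: (epsilon_spec (inhabits 0) (fun y => Omega (fEq x y))); exists x; apply: Omega_refl.
Qed.

Lemma rep_eq x y : Omega (fEq x y) -> rep x = rep y.
Proof.
move=> H; congr epsilon; apply: functional_extensionality => z.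
apply: propositional_extensionality; split; apply: Omega_trans => //.
exact: Omega_sym.
Qed.

Definition term_model : Type := {x : nat | rep x = x}.

Definition term_mem (a b : term_model) : Prop := Omega (fMem (sval a) (sval b)).

Definition term_class (x : nat) : term_model :=
  exist _ (rep x) (esym (rep_eq (Omega_rep x))).

Lemma term_model_inj (a b : term_model) : sval a = sval b -> a = b.
Proof.
case: a b => [x Hx] [y Hy] /= Hxy; rewrite -{}Hxy in Hy *.
by rewrite (proof_irrelevance _ Hx Hy).
Qed.

(** The truth lemma. As variables are the only terms, an environment acts on a formula as a
    renaming. *)
Lemma term_sat A (e : nat -> term_model) :
  sat term_mem e A <-> Omega (ren (fun n => sval (e n)) A).
Proof.
elim: A e => [|x y|x y|A IHA B IHB|A IHA] e //=.
- by split=> // /Omega_bot.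
- split=> [->|H]; first exact: Omega_refl.
  by apply: term_model_inj; rewrite -(svalP (e x)) -(svalP (e y)); apply: rep_eq.
- by rewrite Omega_imp IHA IHB.
have inst_scons d : inst (sval d) (ren (up (fun n => sval (e n))) A)
    = ren (fun n => sval ((d .: e) n)) A.
  by rewrite /inst ren_comp; apply: ren_ext; case.
rewrite Omega_all; split=> H y; last by apply/IHA; rewrite -inst_scons; apply: H.
(* The model contains only representatives, whereas [Omega_all] asks for every variable [y];
   substitution of equals passes from [rep y] to [y]. *)
apply: (Omega_subst (Omega_sym (Omega_rep y))).
by have /IHA := H (term_class y); rewrite -inst_scons.
Qed.

Lemma completeness : exists (M : Type) (E : M -> M -> Prop),
  inhabited M /\ forall A, T A -> forall e, sat E e A.
Proof.
exists term_model, term_mem; split; first exact: (inhabits (term_class 0)).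
by move=> A HA e; apply/term_sat; rewrite ren_closed ?T_closed //; apply: Omega_theory.
Qed.

End Completeness.

(** * Models of ZF and definable classes *)

(** A sealed definition does not unfold during conversion, whose cost would
    otherwise be exponential on nested set-theoretic terms. *)
#[local] Set Primitive Projections.
Record seal (A : Type) (f : A) := Seal { unseal : A; seal_eq : unseal = f }.
#[local] Unset Primitive Projections.

Declare Scope zf_scope.

(** The finitely many single axioms are stated directly in Rocq. The two schemata remain indexed by
    formulas, since a version for all Rocq predicates would be second-order and fail in the term
    model. *)
Record zf : Type := ZFModel {
  car :> Type;
  mem : car -> car -> Prop;
  zf_ext x y : (forall z, mem z x <-> mem z y) -> x = y;
  zf_foundation x y : mem y x -> exists z, mem z x /\ forall w, mem w z -> ~ mem w x;
  zf_pairing x y : exists z, forall w, mem w z <-> w = x \/ w = y;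
  zf_union x : exists u, forall z, mem z u <-> exists y, mem z y /\ mem y x;
  zf_power x : exists p, forall z, mem z p <-> forall w, mem w z -> mem w x;
  zf_infinity : exists w, (exists z, mem z w /\ forall u, ~ mem u z) /\
    forall x, mem x w -> exists y, mem y w /\ forall u, mem u y <-> mem u x \/ u = x;
  zf_separation A e a : exists b, forall x, mem x b <-> mem x a /\ sat mem (x .: e) A;
  zf_replacement A e :
    (forall x y z, sat mem (y .: x .: e) A -> sat mem (z .: x .: e) A -> y = z) ->
    forall a, exists b, forall y, mem y b <-> exists x, mem x a /\ sat mem (y .: x .: e) A
}.

Delimit Scope zf_scope with zf.
Notation "x ∈ y" := (mem x y) (at level 70, no associativity) : zf_scope.
Notation "x ∉ y" := (~ mem x y) (at level 70, no associativity) : zf_scope.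
Local Open Scope zf_scope.

(** Definability with parameters: even variables are the arguments, odd
    variables hold the parameters. *)
Definition mix (M : Type) (e r : nat -> M) (n : nat) : M :=
  if odd n then r n./2 else e n./2.

Section Definability.
Variable M : zf.
Implicit Types (e : nat -> M).

(** The certificate that lets a Rocq predicate be used in separation, replacement and induction. Its
    closure properties follow the syntax of predicates, so [df] can prove it mechanically. *)
Definition Df (P : (nat -> M) -> Prop) : Prop :=
  exists A r, forall e, sat (@mem M) (mix e r) A <-> P e.

Definition DfT (t : (nat -> M) -> M) : Prop :=
  Df (fun e => e 0 = t (fun n => e n.+1)).

Lemma Df_iff P Q : (forall e, P e <-> Q e) -> Df Q -> Df P.
Proof. by move=> H [A [r HA]]; exists A, r => e; rewrite HA H. Qed.

Lemma Df_const (P : Prop) : Df (fun=> P).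
Proof.
have [a] : inhabited M by have [w _] := zf_infinity M; exists.
have [H|H] := classic P; last by exists fBot, (fun=> a) => e /=; tauto.
by exists (fImp fBot fBot), (fun=> a) => e /=; tauto.
Qed.

Lemma Df_imp P Q : Df P -> Df Q -> Df (fun e => P e -> Q e).
Proof.
case=> A [r HA] [B [s HB]].
(* The two parameter lists are interleaved: the k-th parameter of [A] sits at variable 4k+1, that of
   [B] at 4k+3. *)
exists (fImp (ren (fun n => if odd n then (n./2).*2.*2.+1 else n) A)
             (ren (fun n => if odd n then (n./2).*2.*2.+3 else n) B)), (mix r s) => e /=.
rewrite !sat_ren -HA -HB.
have -> : (fun n => mix e (mix r s) (if odd n then (n./2).*2.*2.+1 else n)) = mix e r.
  apply: functional_extensionality => n; rewrite /mix; case: (boolP (odd n)) => Hn; last by rewrite /= (negbTE Hn).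
  by rewrite /= odd_double /= uphalf_double odd_double half_double.
have -> // : (fun n => mix e (mix r s) (if odd n then (n./2).*2.*2.+3 else n)) = mix e s.
apply: functional_extensionality => n; rewrite /mix; case: (boolP (odd n)) => Hn; last by rewrite /= (negbTE Hn).
by rewrite /= odd_double /= uphalf_double /= odd_double /= uphalf_double.
Qed.

Lemma Df_all (Q : M -> (nat -> M) -> Prop) :
  Df (fun e => Q (e 0) (fun n => e n.+1)) -> Df (fun e => forall x, Q x e).
Proof.
case=> A [r HA].
(* Under the binder a parameter moves up by one place. An old argument has its variable raised by
   two in [mix (x .: e) r] but by only one under the binder, hence the predecessor. *)
exists (fAll (ren (fun n => if odd n then n.+1 else n.-1) A)), r => e /=.
have Heq x : (fun n => (x .: mix e r) (if odd n then n.+1 else n.-1)) = mix (x .: e) r.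
  apply: functional_extensionality => n; rewrite /mix; case: (boolP (odd n)) => Hn /=.
    by rewrite /mix Hn.
  by case: n Hn => [|[|n]] //= Hn; rewrite negbK in Hn; rewrite /mix (negbTE Hn).
by split=> H x; have := H x; rewrite sat_ren Heq HA.
Qed.

Lemma Df_ren P (r : nat -> nat) : Df P -> Df (fun e => P (fun n => e (r n))).
Proof.
case=> A [s HA].
exists (ren (fun n => if odd n then n else (r n./2).*2) A), s => e; rewrite sat_ren -HA.
have -> // : (fun n => mix e s (if odd n then n else (r n./2).*2)) = mix (fun n => e (r n)) s.
apply: functional_extensionality => n; rewrite /mix; case: (boolP (odd n)) => Hn; first by rewrite /= Hn.
by rewrite odd_double half_double.
Qed.

Lemma Df_mem_var i j : Df (fun e => e i ∈ e j).
Proof.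
have [a] : inhabited M by have [w _] := zf_infinity M; exists.
by exists (fMem i.*2 j.*2), (fun=> a) => e; rewrite /= /mix !odd_double !half_double.
Qed.

Lemma Df_eq_var i j : Df (fun e => e i = e j).
Proof.
have [a] : inhabited M by have [w _] := zf_infinity M; exists.
by exists (fEq i.*2 j.*2), (fun=> a) => e; rewrite /= /mix !odd_double !half_double.
Qed.

Lemma Df_not P : Df P -> Df (fun e => ~ P e).
Proof. by move=> HP; apply: Df_imp HP (Df_const False). Qed.

Lemma Df_and P Q : Df P -> Df Q -> Df (fun e => P e /\ Q e).
Proof.
move=> HP HQ; apply: (@Df_iff _ (fun e => ~ (P e -> ~ Q e))); first by move=> e; tauto.
exact/Df_not/Df_imp/Df_not.
Qed.

Lemma Df_or P Q : Df P -> Df Q -> Df (fun e => P e \/ Q e).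
Proof.
move=> HP HQ; apply: (@Df_iff _ (fun e => ~ P e -> Q e)); first by move=> e; tauto.
exact: Df_imp (Df_not HP) HQ.
Qed.

Lemma Df_equiv P Q : Df P -> Df Q -> Df (fun e => P e <-> Q e).
Proof. by move=> HP HQ; apply: Df_and; apply: Df_imp. Qed.

Lemma Df_ex (Q : M -> (nat -> M) -> Prop) :
  Df (fun e => Q (e 0) (fun n => e n.+1)) -> Df (fun e => exists x, Q x e).
Proof.
move=> HQ; apply: (@Df_iff _ (fun e => ~ forall x, ~ Q x e)).
  move=> e; split=> [[x Hx] H|H]; first exact: (H x).
  by apply: NNPP => H'; apply: H => x Hx; apply: H'; exists x.
by apply/Df_not/Df_all/Df_not.
Qed.

Lemma DfT_var i : DfT (fun e => e i).
Proof. exact: Df_eq_var. Qed.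

Lemma DfT_const c : DfT (fun=> c).
Proof. by exists (fEq 0 1), (fun=> c). Qed.

Lemma DfT_ren t (r : nat -> nat) : DfT t -> DfT (fun e => t (fun n => e (r n))).
Proof. by move=> /(@Df_ren _ (fun n => if n is m.+1 then (r m).+1 else 0)). Qed.

Lemma Df_sub (Q : M -> (nat -> M) -> Prop) t : DfT t ->
  Df (fun e => Q (e 0) (fun n => e n.+1)) -> Df (fun e => Q (t e) e).
Proof.
move=> Ht HQ; apply: (@Df_iff _ (fun e => exists x, x = t e /\ Q x e)).
  by move=> e; split=> [H|[x [-> //]]]; exists (t e).
by apply: Df_ex; apply: Df_and.
Qed.

Lemma Df_sub2 (Q : M -> M -> (nat -> M) -> Prop) t u : DfT t -> DfT u ->
  Df (fun e => Q (e 0) (e 1) (fun n => e n.+2)) -> Df (fun e => Q (t e) (u e) e).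
Proof.
move=> Ht Hu HQ; apply: (Df_sub (Q := fun x e => Q x (u e) e)) Ht _.
apply: (Df_sub (Q := fun x e => Q (e 0) x (fun n => e n.+1)) (t := fun e => u (fun n => e n.+1))).
  exact: DfT_ren.
exact: (@Df_ren _ (fun n => if n is k.+2 then n else 1 - n)) HQ.
Qed.

Lemma Df_mem t u : DfT t -> DfT u -> Df (fun e => t e ∈ u e).
Proof.
by move=> Ht Hu; apply: (Df_sub2 (Q := fun x y _ => x ∈ y)) => //; apply: Df_mem_var.
Qed.

Lemma Df_eq t u : DfT t -> DfT u -> Df (fun e => t e = u e).
Proof.
by move=> Ht Hu; apply: (Df_sub2 (Q := fun x y _ => x = y)) => //; apply: Df_eq_var.
Qed.

Lemma Df_sub1 (Q : M -> Prop) t : Df (fun e => Q (e 0)) -> DfT t -> Df (fun e => Q (t e)).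
Proof. by move=> HQ Ht; apply: (Df_sub (Q := fun x _ => Q x)). Qed.

Lemma Df_sub2' (Q : M -> M -> Prop) t u :
  Df (fun e => Q (e 0) (e 1)) -> DfT t -> DfT u -> Df (fun e => Q (t e) (u e)).
Proof. by move=> HQ Ht Hu; apply: (Df_sub2 (Q := fun x y _ => Q x y)). Qed.

Lemma zf_inhabited : inhabited M.
Proof. by have [w _] := zf_infinity M. Qed.

Lemma separation (P : M -> Prop) (a : M) : Df (fun e => P (e 0)) ->
  exists b, forall x, x ∈ b <-> x ∈ a /\ P x.
Proof.
case=> A [r HA].
have [b Hb] := zf_separation (ren (fun n => if odd n then n./2.+1 else 0) A) r a.
exists b => x; rewrite Hb sat_ren -(HA (fun=> x)).
suff -> : (fun n => (x .: r) (if odd n then n./2.+1 else 0)) = mix (fun=> x) r by [].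
by apply: functional_extensionality => n; rewrite /mix; case: (odd n).
Qed.

Lemma replacement (f : M -> M) (a : M) : DfT (fun e => f (e 0)) ->
  exists b, forall y, y ∈ b <-> exists x, x ∈ a /\ y = f x.
Proof.
case=> A [r HA].
set rr := fun n => if odd n then n./2.+2 else if n == 2 then 1 else 0.
have E x y : sat (@mem M) (y .: x .: r) (ren rr A) <-> y = f x.
  rewrite sat_ren -(HA (fun n => if n is 1 then x else y)).
  suff -> : (fun n => (y .: x .: r) (rr n)) = mix (fun n => if n is 1 then x else y) r by [].
  apply: functional_extensionality => n; rewrite /mix /rr; case: (boolP (odd n)) => //= Hn.
  by case: n Hn => [|[|[|[|n]]]].
have [|b Hb] := @zf_replacement M (ren rr A) r _ a.
  by move=> x y z /E -> /E ->.
by exists b => y; rewrite Hb; split=> -[x [Hx /E Hy]]; exists x.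
Qed.

Definition iota_prop (P : M -> Prop) (y : M) : Prop := P y /\ forall z, P z -> z = y.

(** Without a unique solution the description denotes the empty set. This fixed default makes the
    graph of [iota] definable, although [iota] is obtained from [epsilon]. *)
Definition iota_or (P : M -> Prop) (y : M) : Prop :=
  iota_prop P y \/ (~ (exists z, iota_prop P z) /\ forall z, z ∉ y).

Lemma zf_empty : exists x : M, forall z, z ∉ x.
Proof. by have [w [[z [_ Hz]] _]] := zf_infinity M; exists z. Qed.

Fact iota_seal : seal (fun (P : M -> Prop) => epsilon zf_inhabited (iota_or P)).
Proof. by eexists. Qed.
Definition iota := unseal iota_seal.

Lemma iota_orP P : iota_or P (iota P).
Proof.
rewrite /iota seal_eq; apply: epsilon_spec; have [[y Hy]|H] := classic (exists z, iota_prop P z).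
  by exists y; left.
by have [x Hx] := zf_empty; exists x; right.
Qed.

Lemma iotaP P y : P y -> (forall z, P z -> z = y) -> iota P = y.
Proof.
move=> Hy Hu; have [[H1 H2]|[[]]] := iota_orP P; first by rewrite (H2 _ Hy).
by exists y.
Qed.

Lemma iota_ex P y : P y -> (forall z w, P z -> P w -> z = w) -> P (iota P).
Proof. by move=> Hy H; rewrite (@iotaP P y) // => z Hz; apply: H. Qed.

Lemma DfT_iota (P : M -> (nat -> M) -> Prop) :
  Df (fun e => P (e 0) (fun n => e n.+1)) -> DfT (fun e => iota (fun y => P y e)).
Proof.
move=> HP; apply: (@Df_iff _ (fun e => iota_or (fun y => P y (fun n => e n.+1)) (e 0))).
  move=> e; split=> [->|]; first exact: iota_orP.
  have [[H1 H2]|[H1 H2]] := iota_orP (fun y => P y (fun n => e n.+1)).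
    by case=> [[H3 _]|[[]]]; [exact: H2 | exists (iota (fun y => P y (fun n => e n.+1)))].
  case=> [H3|[_ H3]]; first by case: H1; exists (e 0).
  by apply: zf_ext => z; split=> [/H3|/H2].
have HP1 (r : nat -> nat) : Df (fun e => P (e 0) (fun n => e (r n.+1))).
  exact: (@Df_ren _ (fun n => if n is m.+1 then r n else 0) HP).
have HP2 (r : nat -> nat) i : Df (fun e => P (e i) (fun n => e (r n.+1))).
  exact: (@Df_ren _ (fun n => if n is m.+1 then r n else i) HP).
have Heq i j : Df (fun e : nat -> M => e i = e j) by exact: Df_eq_var.
have Hio i (r : nat -> nat) : Df (fun e => iota_prop (fun y => P y (fun n => e (r n))) (e i)).
  apply: Df_and; first exact: (HP2 (fun n => r n.-1)).
  by apply: Df_all; apply: Df_imp => //; apply: (HP1 (fun n => (r n.-1).+1)).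
apply: Df_or; first exact: Hio.
apply: Df_and; last by apply: Df_all; apply/Df_not/Df_mem_var.
by apply/Df_not/Df_ex; apply: (Hio 0 (fun n => n.+2)).
Qed.

Lemma Dff1 (f : M -> M) : DfT (fun e => f (e 0)) -> forall t, DfT t -> DfT (fun e => f (t e)).
Proof.
move=> Hf t Ht; apply: (Df_sub (Q := fun x e => e 0 = f x) (t := fun e => t (fun n => e n.+1))).
  exact: DfT_ren.
exact: (@Df_ren _ (fun n => 1 - n)) Hf.
Qed.

Lemma Dff2 (f : M -> M -> M) : DfT (fun e => f (e 0) (e 1)) ->
  forall t u, DfT t -> DfT u -> DfT (fun e => f (t e) (u e)).
Proof.
move=> Hf t u Ht Hu; apply: (Df_sub2 (Q := fun x y e => e 0 = f x y)
  (t := fun e => t (fun n => e n.+1)) (u := fun e => u (fun n => e n.+1))).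
- exact: DfT_ren.
- exact: DfT_ren.
exact: (@Df_ren _ (fun n => match n with 0 => 2 | 1 => 0 | _ => 1 end)) Hf.
Qed.

End Definability.

Create HintDb df.
#[export] Hint Resolve Df_mem Df_eq Df_const Df_imp Df_not Df_and Df_or Df_equiv Df_all Df_ex
  DfT_var DfT_const DfT_iota : df.
Ltac df := cbv beta; auto 60 with df.

(** * Elementary set operations *)

Section Sets.
Variable M : zf.
Implicit Types (x y z a b c f p : M) (P : M -> Prop) (g : M -> M).

Definition sub x y := forall z, z ∈ x -> z ∈ y.

Lemma sub_anti x y : sub x y -> sub y x -> x = y.
Proof. by move=> H1 H2; apply: zf_ext => z; split; [apply: H1 | apply: H2]. Qed.

Lemma Df_sub_rel t u : DfT t -> DfT u -> Df (fun e => sub (t e) (u e)).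
Proof. by apply: Df_sub2'; rewrite /sub; df. Qed.

Fact compr_seal : seal (fun P => iota (fun b => forall x, x ∈ b <-> P x)).
Proof. by eexists. Qed.
Definition compr := unseal compr_seal.

Lemma in_compr P b : (forall x, x ∈ b <-> P x) -> forall x, x ∈ compr P <-> P x.
Proof.
move=> Hb; rewrite /compr seal_eq.
apply: (iota_ex (P := fun b => forall x, x ∈ b <-> P x) Hb) => z w Hz Hw.
by apply: zf_ext => x; rewrite Hz Hw.
Qed.

Lemma DfT_compr (P : M -> (nat -> M) -> Prop) :
  Df (fun e => P (e 0) (fun n => e n.+1)) -> DfT (fun e => compr (fun y => P y e)).
Proof.
move=> HP; rewrite /compr seal_eq; apply: DfT_iota; apply: Df_all; apply: Df_equiv; first by df.
exact: (@Df_ren _ _ (fun n => if n is m.+1 then n.+1 else 0) HP).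
Qed.

Fact empty_seal : seal (compr (fun=> False)).
Proof. by eexists. Qed.
Definition empty := unseal empty_seal.
Fact upair_seal : seal (fun x y => compr (fun z => z = x \/ z = y)).
Proof. by eexists. Qed.
Definition upair := unseal upair_seal.
Fact union_seal : seal (fun x => compr (fun z => exists y, z ∈ y /\ y ∈ x)).
Proof. by eexists. Qed.
Definition union := unseal union_seal.
Fact power_seal : seal (fun x => compr (fun z => sub z x)).
Proof. by eexists. Qed.
Definition power := unseal power_seal.
Fact sep_seal : seal (fun a P => compr (fun x => x ∈ a /\ P x)).
Proof. by eexists. Qed.
Definition sep := unseal sep_seal.
Fact repl_seal : seal (fun a (f : M -> M) => compr (fun y => exists x, x ∈ a /\ y = f x)).
Proof. by eexists. Qed.
Definition repl := unseal repl_seal.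

Lemma in_empty z : z ∉ empty.
Proof.
by have [x Hx] := zf_empty M; rewrite /empty seal_eq (@in_compr (fun=> False) x) // => w; split=> // /Hx.
Qed.

Lemma in_upair x y z : z ∈ upair x y <-> z = x \/ z = y.
Proof. by have [b Hb] := zf_pairing x y; rewrite /upair seal_eq; apply: (in_compr Hb). Qed.

Lemma in_union x z : z ∈ union x <-> exists y, z ∈ y /\ y ∈ x.
Proof. by have [b Hb] := zf_union x; rewrite /union seal_eq; apply: (in_compr Hb). Qed.

Lemma in_power x z : z ∈ power x <-> sub z x.
Proof. by have [b Hb] := zf_power x; rewrite /power seal_eq; apply: (in_compr Hb). Qed.

Lemma in_sep a P x : Df (fun e => P (e 0)) -> x ∈ sep a P <-> x ∈ a /\ P x.
Proof. by move=> /(separation a)[b Hb]; rewrite /sep seal_eq; apply: (in_compr Hb). Qed.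

Lemma in_repl a (g : M -> M) y : DfT (fun e => g (e 0)) ->
  y ∈ repl a g <-> exists x, x ∈ a /\ y = g x.
Proof. by move=> /(replacement a)[b Hb]; rewrite /repl seal_eq; apply: (in_compr Hb). Qed.

Lemma DfT_upair t u : DfT t -> DfT u -> DfT (fun e => upair (t e) (u e)).
Proof. by apply: Dff2; rewrite /upair seal_eq; apply: DfT_compr; df. Qed.

Lemma DfT_union t : DfT t -> DfT (fun e => union (t e)).
Proof. by apply: Dff1; rewrite /union seal_eq; apply: DfT_compr; df. Qed.

Lemma DfT_sep t (P : M -> (nat -> M) -> Prop) : DfT t ->
  Df (fun e => P (e 0) (fun n => e n.+1)) -> DfT (fun e => sep (t e) (fun x => P x e)).
Proof.
move=> Ht HP; rewrite /sep seal_eq; apply: DfT_compr; apply: Df_and => //; apply: Df_mem; first by df.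
exact: (DfT_ren S Ht).
Qed.

Lemma DfT_repl t (f : M -> (nat -> M) -> M) : DfT t ->
  DfT (fun e => f (e 0) (fun n => e n.+1)) -> DfT (fun e => repl (t e) (fun x => f x e)).
Proof.
move=> Ht Hf; rewrite /repl seal_eq; apply: DfT_compr; apply: Df_ex; apply: Df_and.
  by apply: Df_mem; [df | exact: (DfT_ren (fun n => n.+2) Ht)].
apply: Df_eq; first by df.
exact: (DfT_ren (fun n => if n is m.+1 then n.+1 else 0) Hf).
Qed.

#[local] Hint Resolve DfT_upair DfT_union DfT_sep DfT_repl Df_sub_rel : df.

Fact sing_seal : seal (fun x => upair x x).
Proof. by eexists. Qed.
Definition sing := unseal sing_seal.
Fact cup_seal : seal (fun a b => union (upair a b)).
Proof. by eexists. Qed.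
Definition cup := unseal cup_seal.
Fact succ_seal : seal (fun x => cup x (sing x)).
Proof. by eexists. Qed.
Definition succ := unseal succ_seal.
Fact op_seal : seal (fun a b => upair (sing a) (upair a b)).
Proof. by eexists. Qed.
Definition op := unseal op_seal.
Fact fst_seal : seal (fun p => union (sep (union p) (fun a => exists b, p = op a b))).
Proof. by eexists. Qed.
Definition fst := unseal fst_seal.
Fact snd_seal : seal (fun p => union (sep (union p) (fun b => exists a, p = op a b))).
Proof. by eexists. Qed.
Definition snd := unseal snd_seal.
Fact app_seal : seal (fun f x => union (sep (union (union f)) (fun y => op x y ∈ f))).
Proof. by eexists. Qed.
Definition app := unseal app_seal.
Fact lam_seal : seal (fun a (g : M -> M) => repl a (fun x => op x (g x))).
Proof. by eexists. Qed.
Definition lam := unseal lam_seal.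

Lemma in_sing x z : z ∈ sing x <-> z = x.
Proof. by rewrite /sing seal_eq in_upair; tauto. Qed.

Lemma in_cup a b z : z ∈ cup a b <-> z ∈ a \/ z ∈ b.
Proof.
rewrite /cup seal_eq in_union; split=> [[y [Hz /in_upair[<-|<-]]]|[H|H]]; auto.
  by exists a; rewrite in_upair; auto.
by exists b; rewrite in_upair; auto.
Qed.

Lemma in_succ x z : z ∈ succ x <-> z ∈ x \/ z = x.
Proof. by rewrite /succ seal_eq in_cup in_sing. Qed.

Lemma in_op a b z : z ∈ op a b <-> z = sing a \/ z = upair a b.
Proof. by rewrite /op seal_eq in_upair. Qed.

Lemma sing_inj x y : sing x = sing y -> x = y.
Proof. by move=> H; apply/in_sing; rewrite -H in_sing. Qed.

Lemma op_inj a b c d : op a b = op c d -> a = c /\ b = d.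
Proof.
move=> H.
have Hac : a = c.
  have : sing a ∈ op c d by rewrite -H; apply/in_op; left.
  case/in_op=> [/sing_inj //|Hs].
  have : c ∈ sing a by rewrite Hs; apply/in_upair; left.
  by move/in_sing.
split=> //; subst c.
have H1 : upair a b ∈ op a d by rewrite -H; apply/in_op; right.
have H2 : upair a d ∈ op a b by rewrite H; apply/in_op; right.
have Hb : b ∈ upair a b by apply/in_upair; right.
have Hd : d ∈ upair a d by apply/in_upair; right.
case/in_op: H1 => H1; last first.
  by move: Hd; rewrite -H1 => /in_upair[Hda|//]; move: Hb; rewrite H1 -Hda => /in_upair[].
move: Hb; rewrite H1 in_sing => ->.
case/in_op: H2 => H2; first by move: Hd; rewrite H2 in_sing.
by move: Hd; rewrite H2 H1 in_sing.
Qed.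

Lemma union_op a b z : z ∈ union (op a b) <-> z = a \/ z = b.
Proof.
rewrite in_union; split=> [[y [Hz /in_op[Hy|Hy]]]|H].
- by move: Hz; rewrite Hy in_sing; auto.
- by move: Hz; rewrite Hy in_upair.
by exists (upair a b); rewrite in_op in_upair; auto.
Qed.

Lemma union_sing x : union (sing x) = x.
Proof.
apply: zf_ext => z; rewrite in_union; split=> [[y [Hz /in_sing <-]] //|H].
by exists x; rewrite in_sing.
Qed.

Lemma DfT_sing t : DfT t -> DfT (fun e => sing (t e)).
Proof. by apply: Dff1; rewrite /sing seal_eq; df. Qed.
Lemma DfT_cup t u : DfT t -> DfT u -> DfT (fun e => cup (t e) (u e)).
Proof. by apply: Dff2; rewrite /cup seal_eq; df. Qed.
#[local] Hint Resolve DfT_sing DfT_cup : df.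
Lemma DfT_succ t : DfT t -> DfT (fun e => succ (t e)).
Proof. by apply: Dff1; rewrite /succ seal_eq; df. Qed.
Lemma DfT_op t u : DfT t -> DfT u -> DfT (fun e => op (t e) (u e)).
Proof. by apply: Dff2; rewrite /op seal_eq; df. Qed.
#[local] Hint Resolve DfT_succ DfT_op : df.
Lemma DfT_fst t : DfT t -> DfT (fun e => fst (t e)).
Proof. by apply: Dff1; rewrite /fst seal_eq; df. Qed.
Lemma DfT_snd t : DfT t -> DfT (fun e => snd (t e)).
Proof. by apply: Dff1; rewrite /snd seal_eq; df. Qed.
Lemma DfT_app t u : DfT t -> DfT u -> DfT (fun e => app (t e) (u e)).
Proof. by apply: Dff2; rewrite /app seal_eq; df. Qed.
Lemma DfT_lam t (f : M -> (nat -> M) -> M) : DfT t ->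
  DfT (fun e => f (e 0) (fun n => e n.+1)) -> DfT (fun e => lam (t e) (fun x => f x e)).
Proof. by move=> Ht Hf; rewrite /lam seal_eq; df. Qed.
#[local] Hint Resolve DfT_fst DfT_snd DfT_app DfT_lam : df.

Lemma fst_op a b : fst (op a b) = a.
Proof.
rewrite /fst seal_eq -[RHS]union_sing; congr union; apply: zf_ext => z.
rewrite in_sing in_sep; last by df.
rewrite union_op; split=> [[_ [d /op_inj[]]] //|->]; split; first by left.
by exists b.
Qed.

Lemma snd_op a b : snd (op a b) = b.
Proof.
rewrite /snd seal_eq -[RHS]union_sing; congr union; apply: zf_ext => z.
rewrite in_sing in_sep; last by df.
rewrite union_op; split=> [[_ [d /op_inj[]]] //|->]; split; first by right.
by exists a.
Qed.

Lemma app_unique f x y : op x y ∈ f -> (forall z, op x z ∈ f -> z = y) -> app f x = y.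
Proof.
move=> Hf Hu; rewrite /app seal_eq -[RHS]union_sing; congr union; apply: zf_ext => z.
rewrite in_sing in_sep; last by df.
split=> [[_ /Hu] //|->]; split=> //; apply/in_union; exists (upair x y).
split; first by apply/in_upair; right.
by apply/in_union; exists (op x y); split=> //; apply/in_op; right.
Qed.

Lemma in_lam a g p : DfT (fun e => g (e 0)) ->
  p ∈ lam a g <-> exists x, x ∈ a /\ p = op x (g x).
Proof. by move=> Hg; rewrite /lam seal_eq; apply: in_repl; have := Dff1 Hg; df. Qed.

Lemma op_lam a g x y : DfT (fun e => g (e 0)) -> op x y ∈ lam a g <-> x ∈ a /\ y = g x.
Proof.
move=> Hg; rewrite in_lam //; split=> [[z [Hz /op_inj[-> ->]]] //|[Hx ->]].
by exists x.
Qed.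

Lemma app_lam a g x : DfT (fun e => g (e 0)) -> x ∈ a -> app (lam a g) x = g x.
Proof. by move=> Hg Hx; apply: app_unique => [|z]; rewrite op_lam // => -[]. Qed.

End Sets.

#[export] Hint Resolve Df_sub_rel DfT_upair DfT_union DfT_sep DfT_repl
  DfT_sing DfT_cup DfT_succ DfT_op DfT_fst DfT_snd DfT_app DfT_lam : df.

(** * Ordinals and recursion *)

Section Ordinals.
Variable M : zf.
Implicit Types (x y z a b c d f p : M) (P : M -> Prop).

Definition trans x := forall y, y ∈ x -> sub y x.
(** By foundation this is equivalent to being transitive and well-ordered by membership, and it
    mentions no order; [sat_is_ordinal] relates it to the formula. *)
Definition Ord a := trans a /\ forall x, x ∈ a -> trans x.

Lemma Df_trans t : DfT t -> Df (fun e => trans (t e)).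
Proof. by apply: Df_sub1; rewrite /trans; df. Qed.
#[local] Hint Resolve Df_trans : df.
Lemma Df_Ord t : DfT t -> Df (fun e => Ord (t e)).
Proof. by apply: Df_sub1; rewrite /Ord; df. Qed.
#[local] Hint Resolve Df_Ord : df.

Lemma mem_irr x : x ∉ x.
Proof.
have [|z [/in_sing -> H]] := @zf_foundation M (sing x) x; first exact/in_sing.
by move=> Hx; apply: (H x Hx); apply/in_sing.
Qed.

Lemma mem_asym x y : x ∈ y -> y ∉ x.
Proof.
move=> Hxy Hyx.
have [|z [/in_upair Hz H]] := @zf_foundation M (upair x y) x; first by apply/in_upair; left.
by case: Hz H => -> H; [apply: (H y) | apply: (H x)] => //; apply/in_upair; auto.
Qed.

Lemma Ord_mem a b : Ord a -> b ∈ a -> Ord b.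
Proof. by move=> [H1 H2] Hb; split; [apply: H2 | move=> x Hx; apply: H2; apply: H1 Hx]. Qed.

Lemma Ord_trans a b c : Ord c -> a ∈ b -> b ∈ c -> a ∈ c.
Proof. by move=> [H _] Ha Hb; apply: (H b). Qed.

Lemma Ord_min P a : Df (fun e => P (e 0)) -> Ord a -> P a ->
  exists b, Ord b /\ P b /\ forall c, c ∈ b -> ~ P c.
Proof.
move=> HP Ha HPa; have Hs x := in_sep (succ a) x HP.
have [|z [/Hs[Hz HPz] Hmin]] := @zf_foundation M (sep (succ a) P) a.
  by apply/Hs; rewrite in_succ; auto.
have Hza : sub z a by case/in_succ: Hz => [/(proj1 Ha) //|->].
exists z; split; first by case/in_succ: Hz => [/(Ord_mem Ha)//|->].
split=> // c Hc HPc; apply: (Hmin c Hc); apply/Hs; split=> //.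
by apply/in_succ; left; apply: Hza.
Qed.

Lemma Ord_ind P : Df (fun e => P (e 0)) ->
  (forall a, Ord a -> (forall b, b ∈ a -> P b) -> P a) -> forall a, Ord a -> P a.
Proof.
move=> HP IH a Ha; apply: NNPP => HPa.
have [|b [Hb [HnP Hmin]]] := @Ord_min (fun x => ~ P x) a _ Ha HPa; first by df.
by apply/HnP/IH => // c /Hmin; apply: NNPP.
Qed.

(** Induction on both ordinals: if neither is a member of the other, comparability of the members
    shows that the two have the same elements. *)
Lemma Ord_tri a b : Ord a -> Ord b -> a ∈ b \/ a = b \/ b ∈ a.
Proof.
pose C a b := a ∈ b \/ a = b \/ b ∈ a.
suff H : forall a, Ord a -> forall b, Ord b -> C a b by move=> Ha Hb; apply: H.
apply: Ord_ind; first by rewrite /C; df.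
move=> {}a Ha IHa; apply: Ord_ind; first by rewrite /C; df.
move=> {}b Hb IHb; apply: NNPP => HC; apply: (HC); right; left.
apply: zf_ext => x; split=> Hx.
  have [//|[Hxb|Hxb]] := IHa _ Hx _ Hb; case: HC; right; right; first by rewrite -Hxb.
  exact: (Ord_trans Ha Hxb).
have [Hxa|[Hxa|//]] := IHb _ Hx; case: HC; left; last by rewrite Hxa.
exact: (Ord_trans Hb Hxa).
Qed.

Lemma Ord_total a b : Ord a -> Ord b -> a ∈ b \/ sub b a.
Proof.
move=> Ha Hb; have [H|[->|H]] := Ord_tri Ha Hb; [by left | by right | right].
exact: (proj1 Ha).
Qed.

Lemma Ord_sub a b : Ord a -> Ord b -> sub a b -> a ∈ b \/ a = b.
Proof.
move=> Ha Hb Hs; have [H|[H|H]] := Ord_tri Ha Hb; auto.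
by case: (mem_irr (x := b)); apply: Hs.
Qed.

Lemma sub_mem_trans a b c : Ord a -> Ord c -> sub a b -> b ∈ c -> a ∈ c.
Proof.
move=> Ha Hc Hs Hb; have [H|->//] := Ord_sub Ha (Ord_mem Hc Hb) Hs.
exact: Ord_trans H Hb.
Qed.

Lemma mem_sub a b : Ord b -> a ∈ b -> sub a b.
Proof. by move=> [H _] /H. Qed.

Lemma mem_not_sub a b : a ∈ b -> ~ sub b a.
Proof. by move=> H /(_ _ H); apply: mem_irr. Qed.

Lemma Ord_empty : Ord (empty M).
Proof. by split=> x /in_empty. Qed.

Lemma Ord_succ a : Ord a -> Ord (succ a).
Proof.
move=> Ha; split=> x /in_succ[Hx|->].
- by move=> z Hz; apply/in_succ; left; apply: (proj1 Ha) Hx _ Hz.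
- by move=> z Hz; apply/in_succ; left.
- exact: (proj2 Ha).
- exact: (proj1 Ha).
Qed.

Lemma Ord_union s : (forall x, x ∈ s -> Ord x) -> Ord (union s).
Proof.
move=> Hs; split=> x /in_union[y [Hx Hy]]; last exact: (proj2 (Hs _ Hy)).
by move=> z Hz; apply/in_union; exists y; split=> //; apply: (proj1 (Hs _ Hy)) Hx _ Hz.
Qed.

Lemma Ord_cup a b : Ord a -> Ord b -> Ord (cup a b).
Proof. by move=> Ha Hb; rewrite /cup seal_eq; apply: Ord_union => x /in_upair[] ->. Qed.

Lemma cup_max a b : Ord a -> Ord b -> cup a b = a \/ cup a b = b.
Proof.
move=> Ha Hb; have [H|H] := Ord_total Ha Hb; [right | left]; apply: zf_ext => z;
  rewrite in_cup; split; auto; case=> //; last exact: H.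
exact: (mem_sub Hb H).
Qed.

Lemma succ_sub a b : Ord b -> a ∈ b -> sub (succ a) b.
Proof. by move=> Hb Ha z /in_succ[Hz|-> //]; apply: Ord_trans Hz Ha. Qed.

Lemma mem_succ a : a ∈ succ a.
Proof. by apply/in_succ; right. Qed.

Fact least_seal : seal (fun P => iota (fun a => Ord a /\ P a /\ forall b, b ∈ a -> ~ P b)).
Proof. by eexists. Qed.
Definition least := unseal least_seal.

Lemma DfT_least (P : M -> (nat -> M) -> Prop) :
  Df (fun e => P (e 0) (fun n => e n.+1)) -> DfT (fun e => least (fun x => P x e)).
Proof.
move=> HP; rewrite /least seal_eq; apply: DfT_iota; apply: Df_and; first by df.
apply: Df_and => //; apply: Df_all; apply: Df_imp; first by df.
apply: Df_not; exact: (@Df_ren _ _ (fun n => if n is m.+1 then n.+1 else 0) HP).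
Qed.

Lemma leastP P : Df (fun e => P (e 0)) -> (exists a, Ord a /\ P a) ->
  Ord (least P) /\ P (least P) /\ forall b, Ord b -> P b -> sub (least P) b.
Proof.
move=> HP [a [Ha HPa]]; have [b Hb] := Ord_min HP Ha HPa.
have -> : least P = b.
  rewrite /least seal_eq; apply: iotaP => // z [Hz [HPz Hmz]]; case: Hb => Hb [HPb Hmb].
  by have [/Hmb[]|[//|/Hmz[]]] := Ord_tri Hz Hb.
case: Hb => Hb [HPb Hmb]; do !split=> //.
move=> c Hc HPc; have [H|] := Ord_total Hc Hb; last by [].
by case: (Hmb _ H).
Qed.

Lemma least_min P b : Df (fun e => P (e 0)) -> Ord b -> P b -> b ∉ least P.
Proof.
move=> HP Hb HPb H; have [|_ [_ Hm]] := leastP HP; first by exists b.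
exact: (mem_not_sub H (Hm _ Hb HPb)).
Qed.

(** The form in which replacement is mostly used. The guard [Ord (g x)] discards values of [g] that
    are not ordinals, so [g] may be any definable total function. *)
Lemma Ord_bound (g : M -> M) s : DfT (fun e => g (e 0)) ->
  exists d, Ord d /\ forall x, x ∈ s -> Ord (g x) -> g x ∈ d.
Proof.
move=> Hg; have HO : Df (fun e : nat -> M => Ord (e 0)) by df.
exists (succ (union (sep (repl s g) Ord))).
have Hd : Ord (union (sep (repl s g) Ord)).
  by apply: Ord_union => x; rewrite in_sep // => -[].
split=> [|x Hx Ho]; first exact: Ord_succ.
apply/in_succ/Ord_sub => // z Hz; apply/in_union; exists (g x); split=> //.
by rewrite in_sep // in_repl //; split=> //; exists x.
Qed.

Lemma Ord_not_in s : exists a, Ord a /\ a ∉ s.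
Proof.
have [|d [Hd H]] := @Ord_bound (fun x => x) s; first by df.
by exists d; split=> // Hs; case: (mem_irr (H _ Hs Hd)).
Qed.

Lemma lam_ext a (g h : M -> M) : DfT (fun e => g (e 0)) -> DfT (fun e => h (e 0)) ->
  (forall x, x ∈ a -> g x = h x) -> lam a g = lam a h.
Proof.
move=> Hg Hh H; apply: zf_ext => z; rewrite !in_lam //.
by split=> -[x [Hx ->]]; exists x; rewrite H.
Qed.

(** * Transfinite recursion *)

Section Recursion.
Variable G : M -> M -> M.
Hypothesis HG : forall t u, DfT t -> DfT u -> DfT (fun e => G (t e) (u e)).

(** The first conjunct forces [f] to be exactly a graph with domain [a], so that attempts of the
    same length are equal as sets. *)
Definition attempt a f :=
  f = lam a (app f) /\ forall b, b ∈ a -> app f b = G b (lam b (app f)).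

Fact rec_seal : seal (fun a => iota (fun y => Ord a /\ exists f, attempt a f /\ y = G a f)).
Proof. by eexists. Qed.
Definition rec := unseal rec_seal.

Lemma Df_attempt t u : DfT t -> DfT u -> Df (fun e => attempt (t e) (u e)).
Proof. by apply: Df_sub2'; rewrite /attempt; df. Qed.
#[local] Hint Resolve Df_attempt : df.

Lemma DfT_rec t : DfT t -> DfT (fun e => rec (t e)).
Proof. by apply: Dff1; rewrite /rec seal_eq; df. Qed.

Lemma attempt_agree b : Ord b -> forall a a' f f', attempt a f -> attempt a' f' ->
  Ord a -> Ord a' -> b ∈ a -> b ∈ a' -> app f b = app f' b.
Proof.
move: b; apply: (@Ord_ind (fun b => forall a a' f f', attempt a f -> attempt a' f' ->
  Ord a -> Ord a' -> b ∈ a -> b ∈ a' -> app f b = app f' b)); first by df.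
move=> b Hb IH a a' f f' Hf Hf' Ha Ha' Hba Hba'.
rewrite (proj2 Hf) // (proj2 Hf') //; congr G; apply: lam_ext; [by df | by df |] => x Hx.
by apply: (IH _ Hx a a') => //; first [exact: Ord_trans Hx Hba | exact: Ord_trans Hx Hba'].
Qed.

Lemma attempt_uniq a f f' : Ord a -> attempt a f -> attempt a f' -> f = f'.
Proof.
move=> Ha Hf Hf'; rewrite (proj1 Hf) (proj1 Hf'); apply: lam_ext; [by df | by df |] => x Hx.
by apply: (attempt_agree (Ord_mem Ha Hx) Hf Hf').
Qed.

Lemma rec_attempt a f : Ord a -> attempt a f -> rec a = G a f.
Proof.
move=> Ha Hf; rewrite /rec seal_eq; apply: iotaP; first by split=> //; exists f.
by move=> z [_ [f' [Hf' ->]]]; rewrite (attempt_uniq Ha Hf Hf').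
Qed.

Lemma attempt_exists a : Ord a -> attempt a (lam a rec).
Proof.
have Hr : DfT (fun e => rec (e 0)) by apply: DfT_rec; df.
move: a; apply: Ord_ind; first by have := DfT_rec; df.
move=> a Ha IH.
have E b : b ∈ a -> app (lam a rec) b = rec b by move=> Hb; rewrite app_lam.
split=> [|b Hb]; first by apply: lam_ext => [||x /E]; df.
rewrite E // (rec_attempt (Ord_mem Ha Hb) (IH _ Hb)); congr G.
apply: lam_ext => //; first by df.
by move=> x Hx; rewrite E //; apply: Ord_trans Hx Hb.
Qed.

Lemma recE a : Ord a -> rec a = G a (lam a rec).
Proof. by move=> Ha; apply: rec_attempt => //; apply: attempt_exists. Qed.

(** Fixes the value off the ordinals, so that names which are not ordinals denote no new sets; see
    [F_default]. *)
Lemma rec_default a : ~ Ord a -> forall z, z ∉ rec a.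
Proof.
move=> Ha z; rewrite /rec seal_eq; set P := fun _ => _.
by have [[[Ho _] _]|[_ H]] := iota_orP P; [case: Ha | exact: H].
Qed.

End Recursion.

Definition is_lim a := Ord a /\ (exists x, x ∈ a) /\ ~ exists b, a = succ b.

Fact omega_seal : seal (least is_lim).
Proof. by eexists. Qed.
Definition omega := unseal omega_seal.

Lemma Df_is_lim t : DfT t -> Df (fun e => is_lim (t e)).
Proof. by apply: Df_sub1; rewrite /is_lim; df. Qed.

(** A limit exists because the least ordinal outside an inductive set is one: it is not empty, and
    it is not the successor of a member of that set. *)
Lemma omega_least : Ord omega /\ is_lim omega /\ forall b, Ord b -> is_lim b -> sub omega b.
Proof.
rewrite /omega seal_eq; apply: leastP; first by apply: Df_is_lim; df.
have [w [[z [Hz Hz0]] Hw]] := zf_infinity M.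
have [a [Ha Haw]] := Ord_not_in w.
have HP : Df (fun e => ~ e 0 ∈ w) by df.
have [b [Hb [Hbw Hm]]] := @Ord_min (fun x => x ∉ w) a HP Ha Haw.
exists b; do !split=> //; try exact: (proj1 Hb); try exact: (proj2 Hb).
  apply: NNPP => H; apply: Hbw; suff <- : z = b by [].
  by apply: zf_ext => u; split=> [/Hz0 //|Hu]; case: H; exists u.
case=> c Hc; have Hcb : c ∈ b by rewrite Hc; apply: mem_succ.
have Hcw : c ∈ w by apply: NNPP => /(Hm _ Hcb).
have [y [Hy Hys]] := Hw _ Hcw; apply: Hbw; suff <- : y = b by [].
by apply: zf_ext => u; rewrite Hys Hc in_succ.
Qed.

Lemma Ord_omega : Ord omega.
Proof. by case: omega_least. Qed.

Lemma omega_lim b : b ∈ omega -> ~ is_lim b.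
Proof.
by move=> Hb Hl; case: omega_least => H [_ /(_ b (Ord_mem H Hb) Hl) /(mem_not_sub Hb)].
Qed.

Lemma empty_omega : empty M ∈ omega.
Proof.
case: omega_least => H [[_ [[x Hx] _]] _].
by case: (Ord_total Ord_empty H) => // /(_ _ Hx) /in_empty.
Qed.

Lemma lim_succ a b : is_lim a -> b ∈ a -> succ b ∈ a.
Proof.
move=> [Ha [_ Hl]] Hb; have Hsb := Ord_succ (Ord_mem Ha Hb).
by case: (Ord_sub Hsb Ha (succ_sub Ha Hb)) => // Heq; case: Hl; exists b.
Qed.

Lemma succ_omega n : n ∈ omega -> succ n ∈ omega.
Proof. by apply: lim_succ; case: omega_least => _ []. Qed.

Fixpoint num (k : nat) : M := if k is k'.+1 then succ (num k') else empty M.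

Lemma num_omega k : num k ∈ omega.
Proof. by elim: k => [|k IH] /=; [apply: empty_omega | apply: succ_omega]. Qed.

Lemma Ord_num k : Ord (num k).
Proof. exact: (Ord_mem Ord_omega (num_omega k)). Qed.

Lemma num_lt j k : j < k -> num j ∈ num k.
Proof.
elim: k => // k IH; rewrite ltnS leq_eqVlt => /orP[/eqP -> /=|/IH H]; first exact: mem_succ.
by apply/in_succ; left.
Qed.

Lemma num_inj j k : num j = num k -> j = k.
Proof.
move=> H; case: (ltngtP j k) => // /num_lt; rewrite H => /mem_irr //.
Qed.

End Ordinals.

#[export] Hint Resolve Df_trans Df_Ord DfT_least Df_is_lim : df.
#[export] Hint Resolve Ord_empty Ord_succ Ord_cup Ord_omega Ord_num : core.
Arguments Ord_empty {M}.
Arguments Ord_omega {M}.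
Arguments empty_omega {M}.
Arguments Ord_num {M} k.
Arguments num_omega {M} k.

(** * Gödel pairing *)

Section Pairing.
Variable M : zf.
Implicit Types (x y z a b c d f q : M) (P : M -> Prop).

(** Gödel's well-ordering of the pairs of ordinals. *)
Definition lt2 a b c d :=
  cup a b ∈ cup c d \/ (cup a b = cup c d /\ (a ∈ c \/ (a = c /\ b ∈ d))).

Lemma Df_lt2 t u v w : DfT t -> DfT u -> DfT v -> DfT w ->
  Df (fun e => lt2 (t e) (u e) (v e) (w e)).
Proof. by move=> *; rewrite /lt2; df. Qed.
#[local] Hint Resolve Df_lt2 : df.

Lemma lt2_irr a b : ~ lt2 a b a b.
Proof. by case=> [/mem_irr //|[_ [/mem_irr //|[_ /mem_irr]]]]. Qed.

Lemma lt2_total a b c d : Ord a -> Ord b -> Ord c -> Ord d ->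
  lt2 a b c d \/ (a = c /\ b = d) \/ lt2 c d a b.
Proof.
move=> Ha Hb Hc Hd; rewrite /lt2.
have [H|[H|H]] := Ord_tri (Ord_cup Ha Hb) (Ord_cup Hc Hd); auto.
have [H1|[H1|H1]] := Ord_tri Ha Hc; [by auto| |by auto 7].
by have [H2|[H2|H2]] := Ord_tri Hb Hd; [left | right; left | right; right]; auto 7.
Qed.

Lemma lt2_trans a b c d x y : Ord x -> Ord y -> Ord d ->
  lt2 a b c d -> lt2 c d x y -> lt2 a b x y.
Proof.
move=> Hx Hy Hd; rewrite /lt2; have Hxy := Ord_cup Hx Hy.
case=> [H1|[H1 H1']] [H2|[H2 H2']].
- by left; apply: Ord_trans H1 H2.
- by left; rewrite -H2.
- by left; rewrite H1.
right; split; first by rewrite H1.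
case: H1' H2' => [H3|[-> H3]] [H4|[H5 H4]]; auto.
- by left; apply: Ord_trans H3 H4.
- by left; rewrite -H5.
- by right; split=> //; apply: Ord_trans H3 H4.
Qed.

Lemma lt2_max a b c d : Ord a -> Ord b -> Ord c -> Ord d ->
  lt2 a b c d -> a ∈ succ (cup c d) /\ b ∈ succ (cup c d).
Proof.
move=> Ha Hb Hc Hd H; have Hcd := Ord_cup Hc Hd.
have Hs : sub (cup a b) (cup c d) by case: H => [|[-> _] //]; apply: mem_sub.
split; apply: (sub_mem_trans _ _ _ (mem_succ (cup c d))); auto => z Hz;
  by apply: Hs; apply/in_cup; auto.
Qed.

Lemma lt2_cup a b c : a ∈ c -> b ∈ c -> Ord a -> Ord b -> cup a b ∈ c.
Proof. by move=> H1 H2 Ha Hb; case: (cup_max Ha Hb) => ->. Qed.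

Lemma lt2_l a a' b : Ord a' -> Ord b -> a ∈ a' -> lt2 a b a' b.
Proof.
move=> Ha' Hb H; have Ha := Ord_mem Ha' H.
have [H1|H1] : cup a b ∈ cup a' b \/ cup a b = cup a' b; last by right; auto.
  apply: Ord_sub; auto => z /in_cup[Hz|Hz]; apply/in_cup; auto.
  by left; apply: Ord_trans Hz H.
by left.
Qed.

Lemma lt2_r a b b' : Ord a -> Ord b' -> b ∈ b' -> lt2 a b a b'.
Proof.
move=> Ha Hb' H; have Hb := Ord_mem Hb' H.
have [H1|H1] : cup a b ∈ cup a b' \/ cup a b = cup a b'; last by right; auto.
  apply: Ord_sub; auto => z /in_cup[Hz|Hz]; apply/in_cup; auto.
  by right; apply: Ord_trans Hz H.
by left.
Qed.

(** Pairs of ordinals are not yet coded by ordinals, so minimality is reached in three steps: least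
    maximum, then least first component, then least second component. *)
Lemma lt2_min (R : M -> M -> Prop) a b :
  (forall t u, DfT t -> DfT u -> Df (fun e => R (t e) (u e))) ->
  Ord a -> Ord b -> R a b ->
  exists c d, Ord c /\ Ord d /\ R c d /\ forall x y, Ord x -> Ord y -> R x y -> ~ lt2 x y c d.
Proof.
move=> HR Ha Hb Hab.
pose P1 m := exists a b, Ord a /\ Ord b /\ R a b /\ cup a b = m.
have [||m [Hm [[a1 [b1 [Ha1 [Hb1 [Hab1 Hm1]]]]] Hmin]]] := @Ord_min M P1 (cup a b) _ (Ord_cup Ha Hb).
- by rewrite /P1; df.
- by exists a, b.
pose P2 a := exists b, Ord b /\ R a b /\ cup a b = m.
have [||c [Hc [[b2 [Hb2 [Hcb2 Hm2]]] Hmin2]]] := @Ord_min M P2 a1 _ Ha1.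
- by rewrite /P2; df.
- by exists b1.
pose P3 b := R c b /\ cup c b = m.
have [||d [Hd [[Hcd Hm3] Hmin3]]] := @Ord_min M P3 b2 _ Hb2.
- by rewrite /P3; df.
- by [].
exists c, d; do !split=> //; move=> x y Hx Hy Hxy [H|[H1 [H2|[H2 H3]]]].
- by rewrite Hm3 in H; apply: (Hmin _ H); exists x, y.
- by apply: (Hmin2 _ H2); exists y; rewrite H1.
- by apply: (Hmin3 _ H3); rewrite /P3 -H2 H1.
Qed.

Definition unused a f q := forall b, b ∈ a -> app f b <> q.

Fact least_unused_seal : seal (fun a f => iota (fun q => exists c d, q = op c d /\ Ord c /\ Ord d /\
  unused a f q /\ forall x y, Ord x -> Ord y -> unused a f (op x y) -> ~ lt2 x y c d)).
Proof. by eexists. Qed.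
Definition least_unused := unseal least_unused_seal.

Lemma Df_unused t u v : DfT t -> DfT u -> DfT v -> Df (fun e => unused (t e) (u e) (v e)).
Proof.
move=> Ht Hu Hv; apply: (Df_sub2 (Q := fun x y e => unused x y (v e))) => //.
apply: (Df_sub (Q := fun z e => unused (e 0) (e 1) z) (t := fun e => v (fun n => e n.+2))).
  exact: DfT_ren.
by rewrite /unused; df.
Qed.
#[local] Hint Resolve Df_unused : df.

Lemma DfT_least_unused t u : DfT t -> DfT u -> DfT (fun e => least_unused (t e) (u e)).
Proof. by apply: Dff2; rewrite /least_unused seal_eq; df. Qed.

(** [dec] enumerates the pairs of ordinals in increasing order, and [pr] is its
    inverse. *)
Fact dec_seal : seal (fun a => rec least_unused a).
Proof. by eexists. Qed.
Definition dec := unseal dec_seal.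
Fact D1_seal : seal (fun a => fst (dec a)).
Proof. by eexists. Qed.
Definition D1 := unseal D1_seal.
Fact D2_seal : seal (fun a => snd (dec a)).
Proof. by eexists. Qed.
Definition D2 := unseal D2_seal.
Fact pr_seal : seal (fun a b => least (fun c => dec c = op a b)).
Proof. by eexists. Qed.
Definition pr := unseal pr_seal.

Lemma D1E a : D1 a = fst (dec a). Proof. by rewrite /D1 seal_eq. Qed.
Lemma D2E a : D2 a = snd (dec a). Proof. by rewrite /D2 seal_eq. Qed.

Lemma DfT_dec t : DfT t -> DfT (fun e => dec (t e)).
Proof. by rewrite /dec seal_eq; apply/DfT_rec/DfT_least_unused. Qed.
#[local] Hint Resolve DfT_dec : df.
Lemma DfT_D1 t : DfT t -> DfT (fun e => D1 (t e)).
Proof. by apply: Dff1; rewrite /D1 seal_eq; df. Qed.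
Lemma DfT_D2 t : DfT t -> DfT (fun e => D2 (t e)).
Proof. by apply: Dff1; rewrite /D2 seal_eq; df. Qed.
Lemma DfT_pr t u : DfT t -> DfT u -> DfT (fun e => pr (t e) (u e)).
Proof. by apply: Dff2; rewrite /pr seal_eq; df. Qed.
#[local] Hint Resolve DfT_D1 DfT_D2 DfT_pr : df.

Lemma decE a : Ord a -> dec a = least_unused a (lam a dec).
Proof.
move=> Ha; have -> : dec = rec least_unused by rewrite /dec seal_eq.
by rewrite recE //; apply: DfT_least_unused.
Qed.

Lemma dec_spec a : Ord a ->
  dec a = op (D1 a) (D2 a) /\ Ord (D1 a) /\ Ord (D2 a) /\
  (forall b, b ∈ a -> dec b <> dec a) /\
  forall x y, Ord x -> Ord y -> (forall b, b ∈ a -> dec b <> op x y) -> ~ lt2 x y (D1 a) (D2 a).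
Proof.
move=> Ha; set f := lam a dec.
have Hd : DfT (fun e => dec (e 0)) by df.
have Hf q : unused a f q <-> forall b, b ∈ a -> dec b <> q.
  by split=> H b Hb; have := H b Hb; rewrite /f app_lam.
have [d [Hd1 Hd2]] : exists d, Ord d /\ forall x, x ∈ a -> Ord (D1 x) -> D1 x ∈ d.
  by apply: Ord_bound; df.
have [||||c0 [d0 [Hc0 [Hd0 [H0 Hmin]]]]] := @lt2_min (fun x y => unused a f (op x y)) d (empty M).
- by move=> *; df.
- exact: Hd1.
- by [].
- apply/Hf => b Hb Hdb; case: (mem_irr (x := d)); rewrite -{1}(fst_op d (empty M)) -Hdb -D1E.
  by apply: Hd2 => //; rewrite D1E Hdb fst_op.
have E : dec a = op c0 d0.
  rewrite decE // -/f /least_unused seal_eq; apply: iotaP; first by exists c0, d0.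
  move=> q [c1 [d1 [-> [Hc1 [Hd1' [H1 Hmin1]]]]]].
  by have [/Hmin1|[[-> ->] //|/Hmin]] := lt2_total Hc0 Hd0 Hc1 Hd1'; case.
have E1 : D1 a = c0 by rewrite D1E E fst_op.
have E2 : D2 a = d0 by rewrite D2E E snd_op.
rewrite E1 E2 E; do !split=> //; first exact/Hf.
by move=> x y Hx Hy /Hf; apply: Hmin.
Qed.

Lemma Ord_D1 a : Ord a -> Ord (D1 a). Proof. by move=> /dec_spec[_ []]. Qed.
Lemma Ord_D2 a : Ord a -> Ord (D2 a). Proof. by move=> /dec_spec[_ [_ []]]. Qed.
#[local] Hint Resolve Ord_D1 Ord_D2 : core.

Lemma dec_inj a b : Ord a -> Ord b -> dec a = dec b -> a = b.
Proof.
move=> Ha Hb H; have [H1|[//|H1]] := Ord_tri Ha Hb.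
  by case: (dec_spec Hb) => _ [_ [_ [/(_ _ H1) []]]].
by case: (dec_spec Ha) => _ [_ [_ [/(_ _ H1) []]]].
Qed.

Lemma dec_mono a b : Ord b -> a ∈ b -> lt2 (D1 a) (D2 a) (D1 b) (D2 b).
Proof.
move=> Hb H; have Ha := Ord_mem Hb H.
have [Ea [Ha1 [Ha2 [_ Hmin]]]] := dec_spec Ha; have [Eb [Hb1 [Hb2 [Hu _]]]] := dec_spec Hb.
have [//|[[E1 E2]|]] := lt2_total Ha1 Ha2 Hb1 Hb2.
  by case: (Hu _ H); rewrite Ea Eb E1 E2.
move=> H1; case: (Hmin _ _ Hb1 Hb2 _ H1) => c Hc; rewrite -Eb; apply: Hu.
exact: Ord_trans Hc H.
Qed.

(** If (a, b) were never reached, every [dec d] would precede it and so lie in the fixed set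
    [power (power m)]. An injection of all ordinals into a set contradicts replacement. *)
Lemma dec_surj a b : Ord a -> Ord b -> exists c, Ord c /\ dec c = op a b.
Proof.
move=> Ha Hb; apply: NNPP => Hno.
set m := succ (cup a b).
have [d [Hd Hbd]] : exists d, Ord d /\ forall q, q ∈ power (power m) ->
    Ord (least (fun c => dec c = q)) -> least (fun c => dec c = q) ∈ d.
  by apply: Ord_bound; df.
have [Ed [Hd1 [Hd2 [_ Hmin]]]] := dec_spec Hd.
have Hlt : lt2 (D1 d) (D2 d) a b.
  have [//|[[E1 E2]|H]] := lt2_total Hd1 Hd2 Ha Hb.
    by case: Hno; exists d; rewrite Ed E1 E2.
  case: (Hmin _ _ Ha Hb _ H) => c Hc E; apply: Hno; exists c; split=> //.
  exact: Ord_mem Hc.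
have [Hm1 Hm2] := lt2_max Hd1 Hd2 Ha Hb Hlt.
have [||Hl1 [Hl2 _]] := @leastP M (fun c => dec c = dec d); first by df.
  by exists d.
have El := dec_inj Hl1 Hd Hl2.
case: (mem_irr (x := d)); rewrite -{1}El; apply: Hbd => //.
apply/in_power => z; rewrite Ed => /in_op Hz; apply/in_power => w.
by case: Hz => [-> /in_sing|-> /in_upair[]] ->.
Qed.

Lemma pr_spec a b : Ord a -> Ord b -> Ord (pr a b) /\ dec (pr a b) = op a b.
Proof.
move=> Ha Hb; rewrite /pr seal_eq.
have [||H1 [H2 _]] := @leastP M (fun c => dec c = op a b); first by df.
  exact: dec_surj.
by [].
Qed.

Lemma Ord_pr a b : Ord a -> Ord b -> Ord (pr a b).
Proof. by move=> Ha Hb; case: (pr_spec Ha Hb). Qed.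
#[local] Hint Resolve Ord_pr : core.

Lemma D1_pr a b : Ord a -> Ord b -> D1 (pr a b) = a.
Proof. by move=> Ha Hb; rewrite D1E (proj2 (pr_spec Ha Hb)) fst_op. Qed.

Lemma D2_pr a b : Ord a -> Ord b -> D2 (pr a b) = b.
Proof. by move=> Ha Hb; rewrite D2E (proj2 (pr_spec Ha Hb)) snd_op. Qed.

Lemma pr_D a : Ord a -> pr (D1 a) (D2 a) = a.
Proof.
move=> Ha; have [E [H1 [H2 _]]] := dec_spec Ha.
by apply: dec_inj => //; [apply: Ord_pr | rewrite (proj2 (pr_spec H1 H2))].
Qed.

Lemma pr_lt a b c d : Ord a -> Ord b -> Ord c -> Ord d ->
  lt2 a b c d <-> pr a b ∈ pr c d.
Proof.
move=> Ha Hb Hc Hd; split=> H; last first.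
  by have := dec_mono (Ord_pr Hc Hd) H; rewrite !D1_pr // !D2_pr.
have [//|[E|H1]] := Ord_tri (Ord_pr Ha Hb) (Ord_pr Hc Hd).
  have E1 : a = c by rewrite -(D1_pr Ha Hb) E D1_pr.
  have E2 : b = d by rewrite -(D2_pr Ha Hb) E D2_pr.
  by move: H; rewrite E1 E2 => H; case: (lt2_irr H).
have := dec_mono (Ord_pr Ha Hb) H1; rewrite !D1_pr // !D2_pr // => H2.
by case: (@lt2_irr a b); apply: lt2_trans H H2.
Qed.

Lemma increasing_ge (g : M -> M) : DfT (fun e => g (e 0)) ->
  (forall a, Ord a -> Ord (g a)) -> (forall a b, Ord b -> a ∈ b -> g a ∈ g b) ->
  forall a, Ord a -> sub a (g a).
Proof.
move=> Hg HO Hinc; have Hg' := Dff1 Hg; apply: Ord_ind; first by df.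
move=> a Ha IH x Hx; apply: (sub_mem_trans _ (HO _ Ha) (IH _ Hx)).
  exact: Ord_mem Hx.
exact: Hinc.
Qed.

Lemma pr_ge_r0 b : Ord b -> sub b (pr (empty M) b).
Proof.
move: b; apply: increasing_ge => [|a Ha|a b Hb Hab]; first by df.
  exact: Ord_pr.
by apply/pr_lt; auto; [exact: Ord_mem Hab | exact: lt2_r].
Qed.

Lemma pr_ge_r a b : Ord a -> Ord b -> sub b (pr a b).
Proof.
move=> Ha Hb x /(pr_ge_r0 Hb) Hx.
have [E|[z Hz]] : a = empty M \/ exists z, z ∈ a.
  apply: NNPP => H; apply: (H); left; apply: zf_ext => z; split=> [Hz|/in_empty //].
  by case: H; right; exists z.
- by rewrite E.
apply: Ord_trans Hx _; auto; apply/pr_lt; auto; apply: lt2_l => //.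
by case: (Ord_total Ord_empty Ha) => // /(_ _ Hz) /in_empty.
Qed.

(** Strictness is what makes the arguments of a name with nonzero operation smaller than the name
    itself. *)
Lemma pr_gt_r a b : Ord a -> Ord b -> a <> empty M -> b ∈ pr a b.
Proof.
move=> Ha Hb Hne; apply: (sub_mem_trans Hb (Ord_pr Ha Hb) (pr_ge_r0 Hb)).
apply/pr_lt; auto; apply: lt2_l => //.
have [//|[E|/in_empty //]] := Ord_tri Ord_empty Ha.
by case: Hne.
Qed.

Lemma pr_ge_l a b : Ord a -> Ord b -> sub a (pr a b).
Proof.
move=> Ha Hb x Hx.
have H0 : sub a (pr a (empty M)).
  move: a Ha {Hx}; apply: increasing_ge => [|a Ha|a c Hc Hac]; first by df.
    exact: Ord_pr.
  by apply/pr_lt; auto; [exact: Ord_mem Hac | exact: lt2_l].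
have [E|[z Hz]] : b = empty M \/ exists z, z ∈ b.
  apply: NNPP => H; apply: (H); left; apply: zf_ext => z; split=> [Hz|/in_empty //].
  by case: H; right; exists z.
- by rewrite E; apply: H0.
apply: Ord_trans (H0 _ Hx) _; auto; apply/pr_lt; auto; apply: lt2_r => //.
by case: (Ord_total Ord_empty Hb) => // /(_ _ Hz) /in_empty.
Qed.

Lemma D1_le a : Ord a -> sub (D1 a) a.
Proof. by move=> Ha; rewrite -{2}(pr_D Ha); apply: pr_ge_l; auto. Qed.

Lemma D2_le a : Ord a -> sub (D2 a) a.
Proof. by move=> Ha; rewrite -{2}(pr_D Ha); apply: pr_ge_r; auto. Qed.

Lemma D1_in a d : Ord d -> a ∈ d -> D1 a ∈ d.
Proof. by move=> Hd Ha; have Ho := Ord_mem Hd Ha; apply: sub_mem_trans (D1_le Ho) Ha; auto. Qed.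

Lemma D2_in a d : Ord d -> a ∈ d -> D2 a ∈ d.
Proof. by move=> Hd Ha; have Ho := Ord_mem Hd Ha; apply: sub_mem_trans (D2_le Ho) Ha; auto. Qed.

Lemma cup_empty a : cup (empty M) a = a.
Proof. by apply: zf_ext => z; rewrite in_cup; split=> [[/in_empty|]|] //; auto. Qed.

(** Pairs are ordered first by their maximum, so the code of (0, a) bounds those of all pairs below
    [a]. *)
Lemma pr_lt_diag x y a : Ord a -> x ∈ a -> y ∈ a -> pr x y ∈ pr (empty M) a.
Proof.
move=> Ha Hx Hy; have Hox := Ord_mem Ha Hx; have Hoy := Ord_mem Ha Hy.
by apply/pr_lt => //; left; rewrite cup_empty; apply: lt2_cup.
Qed.

Definition pr_closed d := forall x y, x ∈ d -> y ∈ d -> pr x y ∈ d.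

Section Closing.
Variable a : M.
Hypothesis Ha : Ord a.

(** Iterates the passage from an ordinal c to the successor of [pr (empty M) c], which lies above
    the codes of all pairs from c. The ω-th iterate is closed under pairing. *)
Definition closing_step x f := cup a (union (repl x (fun y => succ (pr (empty M) (app f y))))).
Fact closing_seal : seal (fun x => rec closing_step x).
Proof. by eexists. Qed.
Definition closing := unseal closing_seal.

Lemma DfT_closing t : DfT t -> DfT (fun e => closing (t e)).
Proof.
rewrite /closing seal_eq; apply: DfT_rec => u v Hu Hv; apply: (Dff2 (f := closing_step)) => //.
by rewrite /closing_step; df.
Qed.
#[local] Hint Resolve DfT_closing : df.

Lemma closingE x : Ord x -> closing x = closing_step x (lam x closing).
Proof.
move=> Hx; have -> : closing = rec closing_step by rewrite /closing seal_eq.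
rewrite recE // => u v Hu Hv; apply: (Dff2 (f := closing_step)) => //.
by rewrite /closing_step; df.
Qed.

Lemma in_closing x z : Ord x ->
  z ∈ closing x <-> z ∈ a \/ exists y, y ∈ x /\ z ∈ succ (pr (empty M) (closing y)).
Proof.
move=> Hx; have Hc : DfT (fun e => closing (e 0)) by df.
rewrite {1}closingE // /closing_step in_cup in_union; split=> -[|[y [Hy]]]; auto.
  rewrite in_repl; last by df.
  by case=> w [Hw E]; right; exists w; split=> //; rewrite E app_lam in Hy.
move=> Hz; right; exists (succ (pr (empty M) (closing y))); split=> //.
by rewrite in_repl; [exists y; split=> //; rewrite app_lam | df].
Qed.

Lemma Ord_closing x : Ord x -> Ord (closing x).
Proof.
move: x; apply: Ord_ind; first by df.
move=> x Hx IH; split=> z /(in_closing _ Hx)[Hz|[y [Hy Hz]]].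
- by move=> w Hw; apply/in_closing => //; left; apply: Ord_trans Hw Hz.
- move=> w Hw; apply/in_closing => //; right; exists y; split=> //.
  by apply: Ord_trans Hw Hz; apply/Ord_succ/Ord_pr => //; apply: IH.
- exact: (proj2 Ha).
- by apply: (proj2 _ z Hz); apply/Ord_succ/Ord_pr => //; apply: IH.
Qed.

Lemma pr_closed_closing : pr_closed (closing (omega M)).
Proof.
have Ho := @Ord_omega M; have Hc := Ord_closing Ho.
move=> x y Hx Hy; have Hox := Ord_mem Hc Hx; have Hoy := Ord_mem Hc Hy.
have Hz := lt2_cup Hx Hy Hox Hoy; have Hoz := Ord_cup Hox Hoy.
have [n [Hn Hzn]] : exists n, n ∈ omega M /\ cup x y ∈ closing n.
  case/(in_closing _ Ho): Hz => [Hz|[n [Hn Hz]]].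
    by exists (empty M); split; [apply: empty_omega | apply/in_closing; auto].
  exists (succ n); split; first exact: succ_omega.
  apply/in_closing; first exact/Ord_succ/(Ord_mem Ho).
  by right; exists n; split=> //; apply: mem_succ.
have Hcn : Ord (closing n) by apply: Ord_closing; apply: Ord_mem Hn.
have Hxn : x ∈ closing n by apply: sub_mem_trans Hzn => // w Hw; apply/in_cup; auto.
have Hyn : y ∈ closing n by apply: sub_mem_trans Hzn => // w Hw; apply/in_cup; auto.
apply/in_closing => //; right; exists n; split=> //.
by apply/in_succ; left; apply: pr_lt_diag.
Qed.

Lemma closing_ge x : Ord x -> sub a (closing x).
Proof. by move=> Hx z Hz; apply/in_closing; auto. Qed.

End Closing.

Lemma pr_closed_above a : Ord a -> exists d, Ord d /\ a ∈ d /\ pr_closed d.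
Proof.
move=> Ha; have Hs := Ord_succ Ha; have Ho := @Ord_omega M.
exists (closing (succ a) (omega M)).
split; first exact: Ord_closing.
split; last exact: pr_closed_closing.
by apply: closing_ge => //; apply: mem_succ.
Qed.

End Pairing.
#[export] Hint Resolve Df_lt2 DfT_dec DfT_D1 DfT_D2 DfT_pr : df.
#[export] Hint Resolve Ord_D1 Ord_D2 Ord_pr : core.

(** * The constructible universe *)

Section Constructible.
Variable M : zf.
Implicit Types (x y z a b c d f i q : M) (P Q : M -> Prop).
Local Notation N k := (num M k).

(** The eight operations generating the constructible sets, acting on the
    ordinals [x] below the level of a name.  An ordinal [x] is read as the
    environment [k ↦ F (D1 (D2^k x))]. *)
Definition name_op (S F : M -> M) i b c x : Prop :=
  (i = N 1 /\ ~ (x ∈ S b /\ x ∈ S c)) \/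
  (i = N 2 /\ exists y, Ord y /\ pr y x ∈ S b) \/
  (i = N 3 /\ F (D1 x) ∈ F (D1 (D2 x))) \/
  (i = N 4 /\ F (D1 (D2 x)) ∈ F (D1 x)) \/
  (i = N 5 /\ F (D1 x) = F (D1 (D2 x))) \/
  (i = N 6 /\ D2 x ∈ S b) \/
  (i = N 7 /\ pr (D1 x) (D2 (D2 x)) ∈ S b) \/
  (i = N 8 /\ pr x c ∈ S b).

(** Operation 0 yields nothing, and for it the arguments may fail to be smaller than the name.
    Agreement at the arguments is therefore demanded only when [i] is nonzero. *)
Lemma name_op_ext S F S' F' i b c x :
  (i <> empty M -> S b = S' b /\ S c = S' c) ->
  F (D1 x) = F' (D1 x) -> F (D1 (D2 x)) = F' (D1 (D2 x)) ->
  name_op S F i b c x <-> name_op S' F' i b c x.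
Proof.
move=> HS H1 H2; have [E|/HS[E1 E2]] := classic (i = empty M); last by rewrite /name_op H1 H2 E1 E2.
have Hn k : i = N k.+1 -> False by rewrite E => /(@num_inj M 0 k.+1).
rewrite /name_op; split; move=> H; exfalso.
  by case: H => [[/Hn]|[[/Hn]|[[/Hn]|[[/Hn]|[[/Hn]|[[/Hn]|[[/Hn]|[/Hn]]]]]]]].
by case: H => [[/Hn]|[[/Hn]|[[/Hn]|[[/Hn]|[[/Hn]|[[/Hn]|[[/Hn]|[/Hn]]]]]]]].
Qed.

Definition lv a := D1 a.
Definition opn a := D1 (D2 a).
Definition arg1 a := D1 (D2 (D2 a)).
Definition arg2 a := D2 (D2 (D2 a)).

(** [S_ a] is a set of ordinals and [F_ a] is the set of their values. Both come from one recursion,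
    since the atomic operations compare values while the others act on the ordinals themselves. *)
Definition step_S a f := sep (lv a) (fun x =>
  name_op (fun u => fst (app f u)) (fun u => snd (app f u)) (opn a) (arg1 a) (arg2 a) x).
Definition step a f := op (step_S a f) (repl (step_S a f) (fun x => snd (app f x))).
Fact val_seal : seal (fun a => rec step a).
Proof. by eexists. Qed.
Definition val := unseal val_seal.
Fact S_seal : seal (fun a => fst (val a)).
Proof. by eexists. Qed.
Definition S_ := unseal S_seal.
Fact F_seal : seal (fun a => snd (val a)).
Proof. by eexists. Qed.
Definition F_ := unseal F_seal.

Lemma DfT_step_S t u : DfT t -> DfT u -> DfT (fun e => step_S (t e) (u e)).
Proof. by apply: Dff2; rewrite /step_S /name_op /lv /opn /arg1 /arg2; df. Qed.
#[local] Hint Resolve DfT_step_S : df.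
Lemma DfT_step t u : DfT t -> DfT u -> DfT (fun e => step (t e) (u e)).
Proof. by apply: Dff2; rewrite /step; df. Qed.
Lemma DfT_val t : DfT t -> DfT (fun e => val (t e)).
Proof. by rewrite /val seal_eq; apply/DfT_rec/DfT_step. Qed.
#[local] Hint Resolve DfT_val : df.
Lemma DfT_S t : DfT t -> DfT (fun e => S_ (t e)).
Proof. by apply: Dff1; rewrite /S_ seal_eq; df. Qed.
Lemma DfT_F t : DfT t -> DfT (fun e => F_ (t e)).
Proof. by apply: Dff1; rewrite /F_ seal_eq; df. Qed.
#[local] Hint Resolve DfT_S DfT_F : df.


Lemma valE a : Ord a -> val a = step a (lam a val).
Proof.
move=> Ha; have -> : val = rec step by rewrite /val seal_eq.
by rewrite recE //; apply: DfT_step.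
Qed.

Lemma S_val a : S_ a = fst (val a). Proof. by rewrite /S_ seal_eq. Qed.
Lemma F_val a : F_ a = snd (val a). Proof. by rewrite /F_ seal_eq. Qed.

Lemma args_lt a : Ord a -> opn a <> empty M -> arg1 a ∈ a /\ arg2 a ∈ a.
Proof.
move=> Ha Hop; suff Hd2 : D2 (D2 a) ∈ a by split; [apply: D1_in | apply: D2_in].
apply: (D2_le Ha); have Ho : Ord (opn a) by apply/Ord_D1/Ord_D2.
have := pr_gt_r Ho (Ord_D2 (Ord_D2 Ha)) Hop.
by rewrite pr_D //; apply: Ord_D2.
Qed.

Lemma in_S a x : Ord a ->
  x ∈ S_ a <-> x ∈ lv a /\ name_op S_ F_ (opn a) (arg1 a) (arg2 a) x.
Proof.
move=> Ha; have Hv : DfT (fun e => val (e 0)) by df.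
rewrite {1}S_val valE //.
rewrite /step fst_op /step_S in_sep; last by rewrite /name_op; df.
have Hl : Ord (lv a) by apply: Ord_D1.
suff H : x ∈ lv a -> name_op (fun u => fst (app (lam a val) u)) (fun u => snd (app (lam a val) u))
    (opn a) (arg1 a) (arg2 a) x <-> name_op S_ F_ (opn a) (arg1 a) (arg2 a) x.
  by split=> -[H1 H2]; split=> //; apply/H.
move=> Hx; have Hxa : x ∈ a by apply: D1_le Hx.
have H1 := D1_in Ha Hxa; have H2 := D1_in Ha (D2_in Ha Hxa).
apply: name_op_ext => [Hop||]; [|by rewrite app_lam ?F_val|by rewrite app_lam ?F_val].
have [A1 A2] := args_lt Ha Hop; by rewrite !S_val !app_lam.
Qed.

Lemma in_F a z : Ord a -> z ∈ F_ a <-> exists x, x ∈ S_ a /\ z = F_ x.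
Proof.
move=> Ha; have Hv : DfT (fun e => val (e 0)) by df.
have ES : S_ a = step_S a (lam a val) by rewrite S_val valE // /step fst_op.
rewrite {1}F_val valE //.
rewrite /step snd_op in_repl; last by df.
rewrite -ES; split=> -[x [Hx ->]]; exists x; split=> //.
  by rewrite app_lam ?F_val //; move: Hx; rewrite in_S // => -[/(D1_le Ha)].
by rewrite app_lam ?F_val //; move: Hx; rewrite in_S // => -[/(D1_le Ha)].
Qed.

Lemma S_lt a x : Ord a -> x ∈ S_ a -> x ∈ a.
Proof. by move=> Ha /(in_S _ Ha)[/(D1_le Ha)]. Qed.

Lemma F_default a : ~ Ord a -> F_ a = F_ (empty M).
Proof.
move=> Ha; have E0 : F_ (empty M) = empty M.
  apply: zf_ext => z; rewrite (in_F _ Ord_empty); split=> [[x [/(S_lt Ord_empty)/in_empty]]|] //.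
  by move/in_empty.
rewrite E0; apply: zf_ext => z; split=> [|/in_empty //].
have Hv w : w ∉ val a by rewrite /val seal_eq; apply: rec_default.
rewrite F_val /snd seal_eq in_union => -[y [_]]; rewrite in_sep; last by df.
by rewrite in_union => -[[w [_ /Hv]]].
Qed.

Definition inL x := exists a, x = F_ a.

Lemma inLP x : inL x <-> exists a, Ord a /\ x = F_ a.
Proof.
split=> [[a ->]|[a [_ ->]]]; last by exists a.
have [Ha|Ha] := classic (Ord a); first by exists a.
by exists (empty M); rewrite F_default //; split.
Qed.

Lemma Df_inL t : DfT t -> Df (fun e => inL (t e)).
Proof. by apply: Df_sub1; rewrite /inL; df. Qed.
#[local] Hint Resolve Df_inL : df.

Lemma inL_trans x y : inL x -> y ∈ x -> inL y.
Proof. by move=> /inLP[a [Ha ->]] /(in_F _ Ha)[b [_ ->]]; exists b. Qed.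

(** * Representable classes of environments *)

Definition name d i b c := pr d (pr i (pr b c)).

Lemma in_S_name d i b c x : Ord d -> Ord i -> Ord b -> Ord c ->
  x ∈ S_ (name d i b c) <-> x ∈ d /\ name_op S_ F_ i b c x.
Proof.
move=> Hd Hi Hb Hc; have Hbc := Ord_pr Hb Hc; have Hibc := Ord_pr Hi Hbc.
rewrite in_S; last exact: Ord_pr.
by rewrite /lv /opn /arg1 /arg2 /name !D1_pr // !D2_pr // !D1_pr // !D2_pr // D1_pr // D2_pr.
Qed.

(** The classes concerned are proper, so only their traces on ordinals [d] are named. Closure of [d]
    under pairing keeps rearranged environments inside [d]. *)
Definition representable P := forall d, Ord d -> pr_closed d ->
  exists a, Ord a /\ forall x, x ∈ S_ a <-> x ∈ d /\ P x.

Lemma rep_iff P Q : (forall x, Ord x -> (P x <-> Q x)) -> representable Q -> representable P.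
Proof.
move=> H HQ d Hd Hcd; have [a [Ha Hx]] := HQ d Hd Hcd; exists a; split=> // x.
by rewrite Hx; split=> -[Hxd Hq]; split=> //; apply/(H x (Ord_mem Hd Hxd)).
Qed.

Lemma name_opE k F S b c x : name_op S F (N k) b c x <->
  match k with
  | 1 => ~ (x ∈ S b /\ x ∈ S c)
  | 2 => exists y, Ord y /\ pr y x ∈ S b
  | 3 => F (D1 x) ∈ F (D1 (D2 x))
  | 4 => F (D1 (D2 x)) ∈ F (D1 x)
  | 5 => F (D1 x) = F (D1 (D2 x))
  | 6 => D2 x ∈ S b
  | 7 => pr (D1 x) (D2 (D2 x)) ∈ S b
  | 8 => pr x c ∈ S b
  | _ => False
  end.
Proof.
split.
  rewrite /name_op.
  by case=> [|[|[|[|[|[|[|]]]]]]] [/(@num_inj M) ->].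
rewrite /name_op.
by case: k => [|[|[|[|[|[|[|[|[|k]]]]]]]]] //= H; auto 10.
Qed.

Lemma S_name d k b c x : Ord d -> Ord b -> Ord c ->
  x ∈ S_ (name d (N k) b c) <-> x ∈ d /\ name_op S_ F_ (N k) b c x.
Proof. by move=> *; apply: in_S_name. Qed.

Lemma Ord_name d k b c : Ord d -> Ord b -> Ord c -> Ord (name d (N k) b c).
Proof. by move=> *; rewrite /name; auto 7. Qed.

Lemma rep_nand P Q : representable P -> representable Q -> representable (fun x => ~ (P x /\ Q x)).
Proof.
move=> HP HQ d Hd Hcd; have [a [Ha HaP]] := HP d Hd Hcd; have [b [Hb HbQ]] := HQ d Hd Hcd.
exists (name d (N 1) a b); split=> [|x]; first exact: Ord_name.
by rewrite S_name // name_opE HaP HbQ; tauto.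
Qed.

Lemma rep_not P : representable P -> representable (fun x => ~ P x).
Proof. by move=> HP; apply: rep_iff (rep_nand HP HP) => x _; tauto. Qed.

Lemma rep_false : representable (fun=> False).
Proof.
move=> d Hd Hcd; exists (empty M); split=> // x.
by split=> [/(S_lt Ord_empty)/in_empty|[]].
Qed.

Lemma rep_imp P Q : representable P -> representable Q -> representable (fun x => P x -> Q x).
Proof. by move=> HP HQ; apply: rep_iff (rep_nand HP (rep_not HQ)) => x _; tauto. Qed.

Lemma rep_tail P : representable P -> representable (fun x => P (D2 x)).
Proof.
move=> HP d Hd Hcd; have [a [Ha HaP]] := HP d Hd Hcd.
exists (name d (N 6) a (empty M)); split=> [|x]; first exact: Ord_name.
rewrite S_name // name_opE HaP; split=> [[Hx [_ H]] //|[Hx H]].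
by do !split=> //; apply: D2_in.
Qed.

Lemma rep_drop P : representable P -> representable (fun x => P (pr (D1 x) (D2 (D2 x)))).
Proof.
move=> HP d Hd Hcd; have [a [Ha HaP]] := HP d Hd Hcd.
exists (name d (N 7) a (empty M)); split=> [|x]; first exact: Ord_name.
rewrite S_name // name_opE HaP; split=> [[Hx [_ H]] //|[Hx H]].
by do !split=> //; apply: Hcd; [exact: D1_in | exact: (D2_in Hd (D2_in Hd Hx))].
Qed.

(** A witness may lie above [d]. The least witnesses for all [x] in [d] are bounded, so the body is
    represented on a larger closed ordinal, and operation 2 projects back to [d]: a reflection
    argument for a single quantifier. *)
Lemma rep_ex P : Df (fun e => P (e 0)) -> representable P ->
  representable (fun x => exists y, Ord y /\ P (pr y x)).
Proof.
move=> HP HR d Hd Hcd; pose Q x y := Ord y /\ P (pr y x).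
have HP' t : DfT t -> Df (fun e => P (t e)) by apply: Df_sub1.
have HQ x : Df (fun e => P (pr (e 0) x)) by df.
have [d1 [Hd1 Hb]] : exists d1, Ord d1 /\ forall x, x ∈ d ->
    Ord (least (fun y => P (pr y x))) -> least (fun y => P (pr y x)) ∈ d1.
  by apply: Ord_bound; df.
have [d' [Hd' [Hdd' Hcd']]] := pr_closed_above (Ord_cup Hd Hd1).
have Hsub z : z ∈ cup d d1 -> z ∈ d' by apply: mem_sub.
have [a [Ha HaP]] := HR d' Hd' Hcd'.
exists (name d (N 2) a (empty M)); split=> [|x]; first exact: Ord_name.
rewrite S_name // name_opE; split=> [[Hx [y [Hy /HaP[_ H]]]]|[Hx Hex]].
  by split=> //; exists y.
split=> //; have [Hl1 [Hl2 _]] := leastP (HQ x) Hex.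
exists (least (fun y => P (pr y x))); split=> //; apply/HaP; split=> //.
by apply: Hcd'; apply: Hsub; apply/in_cup; auto.
Qed.

Definition coord (k : nat) x := F_ (D1 (iter k (@D2 M) x)).

(** The operations 6 and 7 reduce all pairs of indices to those below [(1, 1)]. *)
Lemma rep_atom (R : M -> M -> Prop) :
  representable (fun x => R (coord 0 x) (coord 0 x)) ->
  representable (fun x => R (coord 0 x) (coord 1 x)) ->
  representable (fun x => R (coord 1 x) (coord 0 x)) ->
  forall i j : nat, representable (fun x => R (coord i x) (coord j x)).
Proof.
move=> H00 H01 H10.
have Hdrop P : representable P -> representable (fun x => P (pr (D1 x) (D2 (D2 x)))) by exact: rep_drop.
have Hc0 x : Ord x -> coord 0 (pr (D1 x) (D2 (D2 x))) = coord 0 x.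
  by move=> Hx; rewrite /coord /= D1_pr; auto.
have Hc1 k x : Ord x -> coord k.+1 (pr (D1 x) (D2 (D2 x))) = coord k.+2 x.
  by move=> Hx; rewrite /coord !iterSr D2_pr; auto.
have H0j (j : nat) : representable (fun x => R (coord 0 x) (coord j.+1 x)).
  by elim: j => [//|j IH]; apply: rep_iff (rep_drop IH) => x Hx /=; rewrite Hc0 // Hc1.
have Hi0 (i : nat) : representable (fun x => R (coord i.+1 x) (coord 0 x)).
  by elim: i => [//|j IH]; apply: rep_iff (rep_drop IH) => x Hx /=; rewrite Hc0 // Hc1.
elim=> [|i IH] [|j] //.
by apply: rep_iff (rep_tail (IH j)) => x Hx; rewrite /coord !iterSr.
Qed.

(** Satisfaction in L with quantifiers relativised to [inL] and environments taken in [M]. Unlike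
    satisfaction over the type [Lcar], it can be certified definable in [M], one external formula at
    a time. *)
Fixpoint rsat (e : nat -> M) (A : form) : Prop :=
  match A with
  | fBot => False
  | fMem x y => e x ∈ e y
  | fEq x y => e x = e y
  | fImp B C => rsat e B -> rsat e C
  | fAll B => forall x, inL x -> rsat (x .: e) B
  end.

Lemma rsat_bound A e e' : (forall k, k < bound A -> e k = e' k) -> rsat e A <-> rsat e' A.
Proof.
elim: A e e' => [|x y|x y|A IHA B IHB|A IHA] e e' //= H.
- by rewrite !H // leq_max leqnn ?orbT.
- by rewrite !H // leq_max leqnn ?orbT.
- by rewrite (IHA e e') ?(IHB e e') // => k Hk; apply: H; rewrite leq_max Hk ?orbT.
split=> HA x /HA; apply IHA => -[|k] //= Hk; rewrite H //; by move: Hk; case: (bound A).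
Qed.

Lemma Df_rsat A (t : nat -> (nat -> M) -> M) :
  (forall k, DfT (t k)) -> Df (fun e => rsat (fun k => t k e) A).
Proof.
elim: A t => [|x y|x y|A IHA B IHB|A IHA] t Ht /=.
- by df.
- exact: Df_mem.
- exact: Df_eq.
- by apply: Df_imp; auto.
apply: Df_all; apply: Df_imp; first by df.
apply: (@Df_iff _ _ (fun e => rsat (fun k =>
  (if k is k'.+1 then fun e => t k' (fun n => e n.+1) else fun e => e 0) e) A)).
  move=> e; suff -> : (e 0 .: (fun k => t k (fun n => e n.+1))) = fun k =>
    (if k is k'.+1 then fun e => t k' (fun n => e n.+1) else fun e => e 0) e by [].
  by apply: functional_extensionality; case.
by apply: IHA => -[|k]; [df | exact: DfT_ren].
Qed.

Lemma DfT_coord k t : DfT t -> DfT (fun e => coord k (t e)).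
Proof.
move=> Ht; rewrite /coord; apply: DfT_F; apply: DfT_D1.
by elim: k => [|k IH] //=; apply: DfT_D2.
Qed.

Lemma coord_cons y x : Ord x -> Ord y ->
  (fun k => coord k (pr y x)) = F_ y .: (fun k => coord k x).
Proof.
move=> Hx Hy; apply: functional_extensionality => -[|k] /=; first by rewrite /coord /= D1_pr.
by rewrite /coord iterSr D2_pr.
Qed.

Lemma rep_rsat A : representable (fun x => rsat (fun k => coord k x) A).
Proof.
elim: A => [|i j|i j|A IHA B IHB|A IHA] /=.
- exact: rep_false.
- apply: (rep_atom (R := fun x y => x ∈ y)).
  + by apply: rep_iff rep_false => x _; split=> // /mem_irr.
  + move=> d Hd _; exists (name d (N 3) (empty M) (empty M)).
    by split=> [|x]; [exact: Ord_name | rewrite S_name // name_opE].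
  + move=> d Hd _; exists (name d (N 4) (empty M) (empty M)).
    by split=> [|x]; [exact: Ord_name | rewrite S_name // name_opE].
- have H01 : representable (fun x => coord 0 x = coord 1 x).
    move=> d Hd _; exists (name d (N 5) (empty M) (empty M)).
    by split=> [|x]; [exact: Ord_name | rewrite S_name // name_opE].
  apply: (rep_atom (R := fun x y => x = y)) => //.
  + by apply: rep_iff (rep_not rep_false) => x _; split=> // _ [].
  + by apply: rep_iff H01 => x _; split.
- exact: rep_imp.
have HD : Df (fun e => ~ rsat (fun k => coord k (e 0)) A).
  by apply/Df_not/Df_rsat => k; apply: DfT_coord; df.
(* Pairing [y] onto the code [x] prepends [F_ y] to the environment, so the quantifier becomes the
   projection of operation 2, between two negations. *)
apply: rep_iff (rep_not (rep_ex HD (rep_not IHA))) => x Hx; split=> [H [y [Hy]]|H y].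
  by rewrite coord_cons //; apply; apply: H; exists y.
move=> /inLP[a [Ha ->]]; apply: NNPP => HA; apply: H; exists a; split=> //.
by rewrite coord_cons.
Qed.

(** Only finitely many coordinates can be prescribed, which suffices because a formula does not look
    beyond its [bound]. *)
Lemma env_code n (e : nat -> M) : (forall k, inL (e k)) ->
  exists x, Ord x /\ forall k, k < n -> coord k x = e k.
Proof.
elim: n e => [|n IH] e He; first by exists (empty M); split.
have [x [Hx Hc]] := IH (fun k => e k.+1) (fun k => He k.+1).
have /inLP[a [Ha E]] := He 0.
exists (pr a x); split=> [|k Hk]; first exact: Ord_pr.
have := congr1 (fun g => g k) (coord_cons Hx Ha) => /= ->.
by case: k Hk => [|k] //= /Hc.
Qed.

(** The parameters are packed into one ordinal [r]. At a closed level above [d] and [r], operation 8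
    selects those [x] in [d] for which the environment coded by [pr x r] satisfies [A]. *)
Lemma L_comprehension A (e : nat -> M) d : (forall k, inL (e k)) -> Ord d ->
  exists z, inL z /\ forall y, y ∈ z <-> exists x, x ∈ d /\ y = F_ x /\ rsat (y .: e) A.
Proof.
move=> He Hd; have [r [Hr Hre]] := env_code (bound A) He.
have [d' [Hd' [Hdd' Hcd']]] := pr_closed_above (Ord_cup Hd Hr).
have Hsub z : z ∈ cup d r -> z ∈ d' by apply: mem_sub.
have [a [Ha HaP]] := @rep_rsat A d' Hd' Hcd'.
have Hr' : r ∈ d'.
  by apply: sub_mem_trans Hdd' => // z Hz; apply/in_cup; auto.
have Hn : Ord (name d (N 8) a r) by apply: Ord_name.
exists (F_ (name d (N 8) a r)); split=> [|y]; first by exists (name d (N 8) a r).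
rewrite in_F //; have E x : x ∈ d -> rsat (F_ x .: e) A <-> rsat (fun k => coord k (pr x r)) A.
  move=> Hx; rewrite coord_cons //; last exact: Ord_mem Hx.
  by apply: rsat_bound => -[|k] //= Hk; rewrite Hre // ltnW.
split=> -[x].
  by rewrite S_name // name_opE HaP => -[[Hx [_ Hs]] ->]; exists x; split=> //; split=> //; apply/E.
move=> [Hx [-> Hs]]; exists x; rewrite S_name // name_opE HaP; do !split=> //; last exact/E.
by apply: Hcd' => //; apply: Hsub; apply/in_cup; auto.
Qed.

Lemma L_bound s : exists d, Ord d /\ forall y, y ∈ s -> inL y -> exists x, x ∈ d /\ y = F_ x.
Proof.
have [d [Hd Hb]] : exists d, Ord d /\ forall y, y ∈ s ->
    Ord (least (fun x => y = F_ x)) -> least (fun x => y = F_ x) ∈ d.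
  by apply: Ord_bound; df.
exists d; split=> // y Hy /inLP Hl; have [|H1 [H2 _]] := @leastP M (fun x => y = F_ x) _ Hl.
  by df.
by exists (least (fun x => y = F_ x)); split=> //; apply: Hb.
Qed.

(** Let [d] bound names of the elements of [a]. The ordinals named below [d] form a constructible
    set [z], which is an ordinal including [a]; so [a] is [z] or a member of it. *)
Lemma inL_Ord a : Ord a -> inL a.
Proof.
move: a; apply: Ord_ind; first by df.
move=> a Ha IH; have [d [Hd Hb]] := L_bound a.
(* This formula expresses [Ord]. Its quantifiers are bounded, so relativising them to the transitive
   class L changes nothing. *)
pose A := fAnd (fAll (fImp (fMem 0 1) (fAll (fImp (fMem 0 1) (fMem 0 2)))))
  (fAll (fImp (fMem 0 1) (fAll (fImp (fMem 0 1) (fAll (fImp (fMem 0 1) (fMem 0 2))))))).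
have HA y : inL y -> rsat (y .: fun=> F_ (empty M)) A <-> Ord y.
  move=> Hy; have Ht := inL_trans.
  have -> : rsat (y .: fun=> F_ (empty M)) A <->
     (forall x, inL x -> x ∈ y -> forall z, inL z -> z ∈ x -> z ∈ y) /\
     (forall x, inL x -> x ∈ y -> forall u, inL u -> u ∈ x -> forall v, inL v -> v ∈ u -> v ∈ x).
    by rewrite /=; tauto.
  split=> -[H1 H2]; split.
  - by move=> x Hx z Hz; have Lx := Ht _ _ Hy Hx; apply: (H1 x Lx Hx z (Ht _ _ Lx Hz) Hz).
  - move=> x Hx u Hu v Hv; have Lx := Ht _ _ Hy Hx; have Lu := Ht _ _ Lx Hu.
    exact: (H2 x Lx Hx u Lu Hu v (Ht _ _ Lu Hv) Hv).
  - by move=> x _ Hx u _ Hu; apply: (H1 x Hx).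
  - by move=> x _ Hx u _ Hu v _ Hv; apply: (H2 x Hx u Hu).
have [|z [Lz Hz]] := @L_comprehension A (fun=> F_ (empty M)) d _ Hd; first by move=> _; exists (empty M).
have Hzo y : y ∈ z -> Ord y.
  by move=> /Hz[x [_ [E H]]]; apply/HA => //; exists x.
have Oz : Ord z.
  split=> y Hy; last exact: (proj1 (Hzo y Hy)).
  move=> w Hw; have Hoy := Hzo _ Hy; move/Hz: Hy => [x [Hx [E _]]]; apply/Hz.
  move: Hw; rewrite E in_F; last exact: Ord_mem Hx.
  move=> [x' [Hx' Ew]]; exists x'; do !split=> //.
    exact: (Ord_trans Hd (S_lt (Ord_mem Hd Hx) Hx') Hx).
  apply/HA; first by exists x'.
  by apply: (Ord_mem Hoy); rewrite E in_F; [exists x' | exact: Ord_mem Hx].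
have Haz : sub a z.
  move=> b Hb'; have [x [Hx E]] := Hb b Hb' (IH b Hb').
  apply/Hz; exists x; do !split=> //; apply/HA; first exact: IH.
  exact: Ord_mem Hb'.
by case: (Ord_sub Ha Oz Haz) => [/(inL_trans Lz)|->].
Qed.

(** * L as a model of ZF *)

Definition Lcar := {x : M | inL x}.
Definition Lmem (x y : Lcar) := sval x ∈ sval y.

Lemma Lcar_inj (x y : Lcar) : sval x = sval y -> x = y.
Proof.
case: x y => [x Hx] [y Hy] /= E; rewrite -{}E in Hy *.
by rewrite (proof_irrelevance _ Hx Hy).
Qed.

Lemma Lsat (e : nat -> Lcar) A : sat Lmem e A <-> rsat (fun k => sval (e k)) A.
Proof.
elim: A e => [|x y|x y|A IHA B IHB|A IHA] e //=.
- by split=> [-> //|/Lcar_inj].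
- by rewrite IHA IHB.
have E (x : Lcar) : (fun k => sval ((x .: e) k)) = sval x .: (fun k => sval (e k)).
  by apply: functional_extensionality; case.
split=> H x; last by rewrite IHA E; apply: H; apply: svalP.
by move=> Hx; have := H (exist _ x Hx); rewrite IHA E.
Qed.

(** Pairing, union, power set and the two schemata all reduce to this: a class definable over L is a
    set of L as soon as some set of [M] covers it. *)
Lemma L_compr A (e : nat -> Lcar) s :
  (forall y : Lcar, sat Lmem (y .: e) A -> sval y ∈ s) ->
  exists z : Lcar, forall y : Lcar, Lmem y z <-> sat Lmem (y .: e) A.
Proof.
move=> Hs; have [d [Hd Hb]] := L_bound s.
have [z [Lz Hz]] := L_comprehension A (fun k => svalP (e k)) Hd.
have E (x : Lcar) : (fun k => sval ((x .: e) k)) = sval x .: (fun k => sval (e k)).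
  by apply: functional_extensionality; case.
exists (exist _ z Lz) => y; rewrite /Lmem /= Hz Lsat E; split=> [[x [_ [_ H]]] //|H].
have [|x [Hx Ey]] := Hb (sval y) _ (svalP y); first by apply: Hs; rewrite Lsat E.
by exists x.
Qed.

Lemma Lmem_lift (x : Lcar) y : y ∈ sval x -> exists z : Lcar, sval z = y /\ Lmem z x.
Proof. by move=> Hy; exists (exist _ y (inL_trans (svalP x) Hy)). Qed.

Definition L0 : Lcar := exist _ _ (inL_Ord Ord_empty).

Program Definition L : zf := @ZFModel Lcar Lmem _ _ _ _ _ _ _ _.
Next Obligation.
apply: Lcar_inj; apply: zf_ext => z; split=> Hz.
  by have [w [<- Hw]] := Lmem_lift Hz; apply/H.
by have [w [<- Hw]] := Lmem_lift Hz; apply/H.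
Qed.
Next Obligation.
have [z [Hz Hmin]] := zf_foundation H; have [w [E Hw]] := Lmem_lift Hz.
by exists w; split=> // u Hu; apply: Hmin; rewrite -E.
Qed.
Next Obligation.
have [|z Hz] := @L_compr (fOr (fEq 0 1) (fEq 0 2)) (x .: fun=> y) (upair (sval x) (sval y)).
  by move=> w; rewrite sat_or in_upair => -[] /= ->; auto.
by exists z => w; rewrite Hz sat_or.
Qed.
Next Obligation.
have [|z Hz] := @L_compr (fEx (fAnd (fMem 1 0) (fMem 0 2))) (fun=> x) (union (sval x)).
  move=> w; rewrite sat_ex => -[y]; rewrite sat_and in_union => -[/= H1 H2].
  by exists (sval y).
by exists z => w; rewrite Hz sat_ex; split=> -[y H]; exists y; [move/sat_and: H | apply/sat_and].
Qed.
Next Obligation.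
have [|z Hz] := @L_compr (fAll (fImp (fMem 0 1) (fMem 0 2))) (fun=> x) (power (sval x)).
  move=> w H; apply/in_power => u Hu; have [v [E Hv]] := Lmem_lift Hu.
  by rewrite -E; apply: H.
by exists z => w; rewrite Hz.
Qed.
Next Obligation.
exists (exist _ _ (inL_Ord Ord_omega)); split.
  exists L0; split; first exact: empty_omega.
  by move=> u /in_empty.
move=> x Hx; have Hs : succ (sval x) ∈ omega M by apply: succ_omega.
exists (exist _ _ (inL_Ord (Ord_mem Ord_omega Hs))); split=> // u.
by rewrite /Lmem /= in_succ; split=> -[H|H]; auto; right; [apply: Lcar_inj | rewrite H].
Qed.
Next Obligation.
have [|z Hz] := @L_compr (fAnd (fMem 0 1) (ren (fun n => if n is m.+1 then m.+2 else 0) A))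
   (a .: e) (sval a).
  by move=> w /sat_and[].
exists z => x; rewrite Hz sat_and sat_ren /=.
suff -> : (fun n => (x .: a .: e) (if n is m.+1 then m.+2 else 0)) = x .: e by [].
by apply: functional_extensionality; case.
Qed.
Next Obligation.
(* Replacement in [M] is applied to a total function. Where the relation has no value, the default
   of [iota] only enlarges the covering set. *)
pose g (x : M) := iota (fun y => inL y /\ rsat (y .: x .: fun k => sval (e k)) A).
have E (x y : Lcar) : sat Lmem (y .: x .: e) A <-> rsat (sval y .: sval x .: fun k => sval (e k)) A.
  rewrite Lsat; suff -> : (fun k => sval ((y .: x .: e) k)) = sval y .: sval x .: fun k => sval (e k) by [].
  by apply: functional_extensionality => -[|[]].
have Hg : DfT (fun e => g (e 0)).
  rewrite /g; apply: DfT_iota; apply: Df_and; first by df.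
  pose t k := match k with 0 => fun e' : nat -> M => e' 0 | 1 => fun e' => e' 1
    | k.+2 => fun=> sval (e k) end.
  apply: (@Df_iff _ _ (fun e' => rsat (fun k => t k e') A)) => [e'|]; last first.
    by apply: Df_rsat => -[|[|k]]; rewrite /t; df.
  suff -> : (fun k => t k e') = e' 0 .: e' 1 .: (fun k => sval (e k)) by [].
  by apply: functional_extensionality => -[|[]].
have Hgx (x y : Lcar) : sat Lmem (y .: x .: e) A -> g (sval x) = sval y.
  move=> Hxy; apply: iotaP; first by split; [exact: svalP | exact/E].
  move=> z [Lz Hz]; have <- // : exist _ z Lz = y.
  by apply: (H x) => //; apply/E.
have E1 (x y : Lcar) : (fun n => (x .: y .: a .: e) match n with 0 => 1 | 1 => 0 | m.+2 => m.+3 end) = y .: x .: e.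
  by apply: functional_extensionality => -[|[]].
have [|z Hz] := @L_compr (fEx (fAnd (fMem 0 2)
   (ren (fun n => match n with 0 => 1 | 1 => 0 | m.+2 => m.+3 end) A))) (a .: e) (repl (sval a) g).
  move=> y /sat_ex[x /sat_and[/= Hx]]; rewrite sat_ren => Hy.
  rewrite in_repl //; exists (sval x); split=> //; symmetry; apply: Hgx.
  by rewrite -E1.
exists z => y; rewrite Hz sat_ex.
by split=> -[x Hx]; exists x; move: Hx; rewrite sat_and sat_ren E1.
Qed.

End Constructible.
#[export] Hint Resolve DfT_S DfT_F Df_inL : df.

(** * Absoluteness *)

(** Determines [dec a] by minimality alone, so that moving it into L or along a collapse requires
    only a comparison of orders. *)
Lemma dec_unique (M : zf) (a c d : M) : Ord a -> Ord c -> Ord d ->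
  (forall b, b ∈ a -> dec b <> op c d) ->
  (forall x y, Ord x -> Ord y -> (forall b, b ∈ a -> dec b <> op x y) -> ~ lt2 x y c d) ->
  dec a = op c d.
Proof.
move=> Ha Hc Hd Hu Hm; have [E [H1 [H2 [Hu' Hm']]]] := dec_spec Ha.
have [H|[[E1 E2]|H]] := lt2_total H1 H2 Hc Hd; last by case: (Hm' _ _ Hc Hd Hu H).
  by case: (Hm _ _ H1 H2 _ H) => b Hb; rewrite -E; apply: Hu'.
by rewrite E E1 E2.
Qed.

Section Absoluteness.
Variable M : zf.
Local Notation N := (L M).
Definition incl (x : N) : M := sval x.
Implicit Types (a b c d x y : N).

Lemma incl_inj x y : incl x = incl y -> x = y.
Proof. exact: Lcar_inj. Qed.

Lemma incl_eq x y : x = y <-> incl x = incl y.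
Proof. by split=> [->|/incl_inj]. Qed.

Lemma incl_mem x y : x ∈ y <-> incl x ∈ incl y.
Proof. by []. Qed.

Lemma incl_inL x : inL (incl x).
Proof. exact: svalP. Qed.

Lemma lift_inL (u : M) : inL u -> exists x, incl x = u.
Proof. by move=> H; exists (exist _ u H). Qed.

Lemma lift_mem x (u : M) : u ∈ incl x -> exists y, incl y = u /\ y ∈ x.
Proof. exact: Lmem_lift. Qed.

Lemma incl_ext x (u : M) : (forall y, y ∈ x <-> incl y ∈ u) -> sub u (incl x) -> incl x = u.
Proof.
move=> H Hs; apply: zf_ext => z; split=> [Hz|]; last exact: Hs.
by have [y [<- Hy]] := lift_mem Hz; apply/H.
Qed.

(** Inductions about L run along the ordinals of [M] and need definability there; relativising the
    defining formula provides it. *)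
Lemma Df_lift (Q : N -> N -> Prop) : Df (fun e => Q (e 0) (e 1)) ->
  forall t u, DfT t -> DfT u ->
  Df (fun e => exists x y, incl x = t e /\ incl y = u e /\ Q x y).
Proof.
move=> [A [r HA]] t1 t2 Ht1 Ht2.
apply: (Df_sub2' (Q := fun u v => exists x y, incl x = u /\ incl y = v /\ Q x y)) => //.
pose t n : (nat -> M) -> M :=
  if odd n then fun=> incl (r n./2) else if n is 2 then fun e => e 1 else fun e => e 0.
apply: (@Df_iff _ _ (fun e => inL (e 0) /\ inL (e 1) /\ rsat (fun k => t k e) A)) => [e|]; last first.
  do 2!(apply: Df_and; first by df).
  by apply: Df_rsat => k; rewrite /t; case: (odd k); [df|case: k => [|[|[|k]]]; df].
have E x y : incl x = e 0 -> incl y = e 1 -> Q x y <-> rsat (fun k => t k e) A.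
  move=> Ex Ey; have := HA (fun n => if n is 1 then y else x); rewrite /= => <-.
  rewrite (Lsat (M := M)); set e1 := fun k => _; suff -> : e1 = fun k => t k e by [].
  apply: functional_extensionality => k; rewrite /e1 /mix /t; case: (boolP (odd k)) => //= Hk.
  by case: k Hk => [|[|[|[|k]]]].
split=> [[x [y [Ex [Ey /(E _ _ Ex Ey) HQ]]]]|[/lift_inL[x Ex] [/lift_inL[y Ey] HQ]]].
  by rewrite -Ex -Ey; do !split=> //; apply: incl_inL.
by exists x, y; do !split=> //; apply/(E _ _ Ex Ey).
Qed.

Lemma incl_empty : incl (empty N) = empty M.
Proof. by apply: incl_ext => [y|z /in_empty //]; split=> [/in_empty|/in_empty]. Qed.

Lemma incl_upair x y : incl (upair x y) = upair (incl x) (incl y).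
Proof.
apply: incl_ext => [z|z /in_upair[->|->]].
- by rewrite !in_upair; split=> -[H|H]; [left|right|left|right]; rewrite ?H //; apply: incl_inj.
- by apply: (proj2 (in_upair x y x)); left.
- by apply: (proj2 (in_upair x y y)); right.
Qed.

Lemma incl_union x : incl (union x) = union (incl x).
Proof.
apply: incl_ext => [z|z].
  rewrite !in_union; split=> -[y [H1 H2]]; first by exists (incl y).
  by have [y' [E H3]] := lift_mem H2; exists y'; rewrite -E in H1.
rewrite in_union => -[y [H1 H2]]; have [y' [E H3]] := lift_mem H2; rewrite -E in H1.
by have [z' [<- H4]] := lift_mem H1; apply: (proj2 (in_union x z')); exists y'.
Qed.

Lemma incl_sing x : incl (sing x) = sing (incl x).
Proof. by rewrite /sing !seal_eq incl_upair. Qed.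

Lemma incl_cup x y : incl (cup x y) = cup (incl x) (incl y).
Proof. by rewrite /cup !seal_eq incl_union incl_upair. Qed.

Lemma incl_succ x : incl (succ x) = succ (incl x).
Proof. by rewrite /succ !seal_eq incl_cup incl_sing. Qed.

Lemma incl_op x y : incl (op x y) = op (incl x) (incl y).
Proof. by rewrite /op !seal_eq !incl_upair incl_sing. Qed.

Lemma incl_num k : incl (num N k) = num M k.
Proof. by elim: k => [|k IH] /=; rewrite ?incl_empty // incl_succ IH. Qed.

Lemma incl_trans x : trans x <-> trans (incl x).
Proof.
split=> H; last by move=> y Hy z Hz; apply: (H (incl y) Hy (incl z) Hz).
move=> y Hy z Hz; have [y' [E Hy']] := lift_mem Hy; rewrite -E in Hz.
by have [z' [E' Hz']] := lift_mem Hz; rewrite -E'; apply: (H y' Hy' z' Hz').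
Qed.

Lemma incl_Ord x : Ord x <-> Ord (incl x).
Proof.
rewrite /Ord incl_trans; split=> -[H1 H2]; split=> // y Hy.
  by have [y' [<- Hy']] := lift_mem Hy; apply/incl_trans/H2.
exact/incl_trans/H2.
Qed.

Lemma lift_Ord (u : M) : Ord u -> exists x, incl x = u /\ Ord x.
Proof. by move=> Hu; have [x E] := lift_inL (inL_Ord Hu); exists x; rewrite incl_Ord E. Qed.

Lemma incl_lt2 a b c d : lt2 a b c d <-> lt2 (incl a) (incl b) (incl c) (incl d).
Proof.
rewrite /lt2 -!incl_cup -!incl_mem.
by rewrite -!incl_eq.
Qed.

Lemma incl_dec a : Ord a -> incl (dec a) = dec (incl a).
Proof.
(* The claim is recast as a relation between elements of [M], the form in which [Ord_ind] of [M]
   applies. *)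
pose R (u v : M) := exists x y, incl x = u /\ incl y = v /\ (y = dec x).
have HR t u : DfT t -> DfT u -> Df (fun e => R (t e) (u e)).
  by move=> Ht Hu; apply: (Df_lift (Q := fun x y => y = dec x)) => //; df.
suff H u : Ord u -> forall v, R u v -> v = dec u.
  by move=> Ha; apply: H; [exact/incl_Ord | exists a, (dec a)].
move: u; apply: Ord_ind; first by df.
move=> u Hu IH v [x [y [Ex [Ey E]]]]; subst y u v.
have Hx : Ord x by apply/incl_Ord.
have [Ed [H1 [H2 [Hun Hm]]]] := dec_spec Hx.
have IHd b : b ∈ x -> incl (dec b) = dec (incl b).
  by move=> Hb; apply: (IH (incl b) Hb); exists b, (dec b).
symmetry; rewrite Ed incl_op; apply: dec_unique => //; try exact/incl_Ord.
  move=> b Hb; have [b' [<- Hb']] := lift_mem Hb.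
  by rewrite -IHd // -incl_op => /incl_inj; rewrite -Ed; apply: Hun.
move=> c d Hc Hd Hcd; have [c' [Ec Hc']] := lift_Ord Hc; have [d' [Ed' Hd']] := lift_Ord Hd.
rewrite -Ec -Ed' -incl_lt2; apply: Hm => // b Hb E; apply: (Hcd (incl b) Hb).
by rewrite -IHd // E incl_op Ec Ed'.
Qed.

Lemma incl_D a : Ord a -> incl (D1 a) = D1 (incl a) /\ incl (D2 a) = D2 (incl a).
Proof.
move=> Ha; have := incl_dec Ha; have Ha' : Ord (incl a) by apply/incl_Ord.
have [-> _] := dec_spec Ha; have [-> _] := dec_spec Ha'.
by rewrite incl_op => /op_inj.
Qed.

Lemma incl_D1 a : Ord a -> incl (D1 a) = D1 (incl a).
Proof. by case/incl_D. Qed.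

Lemma incl_D2 a : Ord a -> incl (D2 a) = D2 (incl a).
Proof. by case/incl_D. Qed.

Lemma incl_pr a b : Ord a -> Ord b -> incl (pr a b) = pr (incl a) (incl b).
Proof.
move=> Ha Hb; have Hp := Ord_pr Ha Hb; have Hp' : Ord (incl (pr a b)) by apply/incl_Ord.
by rewrite -(pr_D Hp') -incl_D1 // -incl_D2 // D1_pr // D2_pr.
Qed.

Lemma incl_name_op a x : Ord a -> x ∈ a ->
  (forall b, b ∈ a -> incl (S_ b) = S_ (incl b) /\ incl (F_ b) = F_ (incl b)) ->
  name_op (@S_ N) (@F_ N) (opn a) (arg1 a) (arg2 a) x <->
  name_op (@S_ M) (@F_ M) (opn (incl a)) (arg1 (incl a)) (arg2 (incl a)) (incl x).
Proof.
move=> Ha Hx IH; have Hox := Ord_mem Ha Hx.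
have Ei : incl (opn a) = opn (incl a) by rewrite /opn incl_D1 ?incl_D2 //; auto.
have E1 : incl (arg1 a) = arg1 (incl a) by rewrite /arg1 incl_D1 ?incl_D2 ?incl_D2 //; auto.
have E2 : incl (arg2 a) = arg2 (incl a) by rewrite /arg2 !incl_D2 //; auto.
have Hn k : opn a = num N k <-> opn (incl a) = num M k.
  by rewrite -Ei -incl_num; split=> [->|/incl_inj].
rewrite /name_op -!Hn -E1 -E2.
have [E|Hne] := classic (opn a = empty N).
  have Hno k : opn a = num N k.+1 -> False by rewrite E => /(@num_inj N 0 k.+1).
  have F k (P : Prop) : (opn a = num N k.+1 /\ P) <-> False by split=> // -[/Hno].
  by rewrite !F.
have [A1 A2] := args_lt Ha Hne.
have [S1 _] := IH _ A1; have [S2 _] := IH _ A2.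
have Hd1 := D1_in Ha Hx; have Hd2 := D1_in Ha (D2_in Ha Hx).
have [_ F1] := IH _ Hd1; have [_ F2] := IH _ Hd2.
rewrite incl_D1 // in F1; rewrite incl_D1 ?incl_D2 // in F2; last by auto.
have O1 : Ord (arg1 a) by apply: Ord_mem A1.
have O2 : Ord (arg2 a) by apply: Ord_mem A2.
have P1 : pr (D1 (incl x)) (D2 (D2 (incl x))) = incl (pr (D1 x) (D2 (D2 x))).
  by rewrite incl_pr ?incl_D1 ?incl_D2 ?incl_D2 //; auto.
rewrite -S1 -S2 -F1 -F2 -!incl_mem P1 -incl_mem -incl_D2 // -incl_mem -incl_pr // -incl_mem.
have -> : (F_ (D1 x) = F_ (D1 (D2 x))) <-> incl (F_ (D1 x)) = incl (F_ (D1 (D2 x))).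
  by split=> [->|/incl_inj].
(* Operation 2 quantifies over all ordinals, and L has the same ordinals as [M]. *)
suff -> : (exists y, Ord y /\ pr y x ∈ S_ (arg1 a)) <->
  (exists y : M, Ord y /\ pr y (incl x) ∈ incl (S_ (arg1 a))) by [].
split=> -[y [Hy H]].
  by exists (incl y); rewrite -incl_pr //; split=> //; apply/incl_Ord.
have [y' [E Hy']] := lift_Ord Hy; exists y'; split=> //.
by apply/incl_mem; rewrite incl_pr // E.
Qed.

Lemma incl_SF a : Ord a -> incl (S_ a) = S_ (incl a) /\ incl (F_ a) = F_ (incl a).
Proof.
pose RS (u v : M) := exists x y, incl x = u /\ incl y = v /\ (y = S_ x).
pose RF (u v : M) := exists x y, incl x = u /\ incl y = v /\ (y = F_ x).
have HS t u : DfT t -> DfT u -> Df (fun e => RS (t e) (u e)).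
  by move=> Ht Hu; apply: (Df_lift (Q := fun x y => y = S_ x)) => //; df.
have HF t u : DfT t -> DfT u -> Df (fun e => RF (t e) (u e)).
  by move=> Ht Hu; apply: (Df_lift (Q := fun x y => y = F_ x)) => //; df.
suff H u : Ord u -> (forall v, RS u v -> v = S_ u) /\ (forall v, RF u v -> v = F_ u).
  move=> Ha; have Ha' : Ord (incl a) by apply/incl_Ord.
  by have [H1 H2] := H _ Ha'; split; [apply: H1; exists a, (S_ a) | apply: H2; exists a, (F_ a)].
move: u; apply: Ord_ind; first by df.
move=> u Hu IH.
suff H x : incl x = u -> incl (S_ x) = S_ u /\ incl (F_ x) = F_ u.
  by split=> v [x [y [Ex [Ey E]]]]; have [H1 H2] := H x Ex; rewrite -Ey E.
move=> Ex; subst u; have Hx : Ord x by apply/incl_Ord.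
have IH' b : b ∈ x -> incl (S_ b) = S_ (incl b) /\ incl (F_ b) = F_ (incl b).
  move=> Hb; have [H1 H2] := IH (incl b) Hb.
  by split; [apply: H1; exists b, (S_ b) | apply: H2; exists b, (F_ b)].
have El : incl (lv x) = lv (incl x) by rewrite /lv incl_D1.
have ES : incl (S_ x) = S_ (incl x).
  have H y : y ∈ S_ x <-> incl y ∈ S_ (incl x).
    rewrite !in_S // -El -incl_mem; split=> -[H1 H2]; split=> //;
      apply/incl_name_op => //; exact: (D1_le Hx).
  apply: incl_ext => // z Hz; have Hzx := S_lt Hu Hz.
  by have [y [E _]] := lift_mem Hzx; rewrite -E in Hz *; apply/H.
split=> //; apply: incl_ext => [y|z].
  rewrite !in_F // -ES; split=> -[w [Hw E]].
    by exists (incl w); split=> //; rewrite E; case: (IH' w (S_lt Hx Hw)).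
  have [w' [Ew Hw']] := lift_mem Hw; exists w'; split=> //.
  by apply: incl_inj; rewrite E -Ew; case: (IH' w' (S_lt Hx Hw')).
rewrite in_F // -ES => -[w [Hw E]]; have [w' [Ew Hw']] := lift_mem Hw.
rewrite E -Ew; have [_ <-] := IH' w' (S_lt Hx Hw').
by apply: (proj2 (in_F (F_ w') Hx)); exists w'.
Qed.

(** V = L inside L: names are ordinals, which L shares with [M], and denotation is absolute. *)
Theorem L_constructible x : exists a, Ord a /\ x = F_ a.
Proof.
have /inLP[u [Hu E]] := incl_inL x; have [a [Ea Ha]] := lift_Ord Hu.
exists a; split=> //; apply: incl_inj; rewrite E -Ea.
by case: (incl_SF Ha).
Qed.

End Absoluteness.

(** * Maps and order types *)

Section Maps.
Variable M : zf.
Implicit Types (x y z a b c d f p : M) (P : M -> Prop) (g : M -> M).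

Definition functional f := (forall p, p ∈ f -> exists x y, p = op x y) /\
  forall x y z, op x y ∈ f -> op x z ∈ f -> y = z.
Definition dom f a := forall x, x ∈ a <-> exists y, op x y ∈ f.
Definition maps f a b := functional f /\ dom f a /\ forall x y, op x y ∈ f -> y ∈ b.
Definition inj f := forall x y z, op x z ∈ f -> op y z ∈ f -> x = y.
Definition onto f b := forall y, y ∈ b -> exists x, op x y ∈ f.
Definition equip a b := exists f, maps f a b /\ inj f /\ onto f b.
Definition surj a b := exists f, maps f a b /\ onto f b.

Lemma Df_maps t u v : DfT t -> DfT u -> DfT v -> Df (fun e => maps (t e) (u e) (v e)).
Proof.
move=> Ht Hu Hv; apply: (Df_sub2 (Q := fun x y e => maps x y (v e))) => //.
apply: (Df_sub (Q := fun z e => maps (e 0) (e 1) z) (t := fun e => v (fun n => e n.+2))).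
  exact: DfT_ren.
by rewrite /maps /functional /dom; df.
Qed.

Lemma Df_inj t : DfT t -> Df (fun e => inj (t e)).
Proof. by apply: Df_sub1; rewrite /inj; df. Qed.

Lemma Df_onto t u : DfT t -> DfT u -> Df (fun e => onto (t e) (u e)).
Proof. by apply: Df_sub2'; rewrite /onto; df. Qed.

Lemma lam_functional a g : DfT (fun e => g (e 0)) -> functional (lam a g).
Proof.
move=> Hg; split=> [p|x y z]; first by rewrite in_lam // => -[x [_ ->]]; exists x, (g x).
by rewrite !op_lam // => -[_ ->] [_ ->].
Qed.

Lemma lam_dom a g : DfT (fun e => g (e 0)) -> dom (lam a g) a.
Proof.
move=> Hg x; split=> [Hx|[y]]; last by rewrite op_lam // => -[].
by exists (g x); rewrite op_lam.
Qed.

Lemma lam_maps a b g : DfT (fun e => g (e 0)) -> (forall x, x ∈ a -> g x ∈ b) -> maps (lam a g) a b.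
Proof.
move=> Hg H; split; first exact: lam_functional.
split; first exact: lam_dom.
by move=> x y; rewrite op_lam // => -[Hx ->]; apply: H.
Qed.

Lemma lam_inj a g : DfT (fun e => g (e 0)) ->
  (forall x y, x ∈ a -> y ∈ a -> g x = g y -> x = y) -> inj (lam a g).
Proof. by move=> Hg H x y z; rewrite !op_lam // => -[Hx ->] [Hy E]; apply: H. Qed.

Lemma lam_onto a b g : DfT (fun e => g (e 0)) ->
  (forall y, y ∈ b -> exists x, x ∈ a /\ y = g x) -> onto (lam a g) b.
Proof. by move=> Hg H y /H[x [Hx ->]]; exists x; rewrite op_lam. Qed.

Lemma functional_app f x y : functional f -> op x y ∈ f -> app f x = y.
Proof. by move=> [_ Hf] Hxy; apply: app_unique => // z Hz; apply: Hf Hz Hxy. Qed.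

Lemma maps_app f a b x : maps f a b -> x ∈ a -> op x (app f x) ∈ f /\ app f x ∈ b.
Proof.
move=> [Hf [Hd Hb]] /Hd[y Hy]; rewrite (functional_app Hf Hy); split=> //.
exact: Hb Hy.
Qed.

Lemma surjI a b g : DfT (fun e => g (e 0)) -> (forall x, x ∈ a -> g x ∈ b) ->
  (forall y, y ∈ b -> exists x, x ∈ a /\ y = g x) -> surj a b.
Proof. by move=> Hg H1 H2; exists (lam a g); split; [apply: lam_maps | apply: lam_onto]. Qed.

Lemma equipI a b g : DfT (fun e => g (e 0)) -> (forall x, x ∈ a -> g x ∈ b) ->
  (forall x y, x ∈ a -> y ∈ a -> g x = g y -> x = y) ->
  (forall y, y ∈ b -> exists x, x ∈ a /\ y = g x) -> equip a b.
Proof.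
move=> Hg H1 H2 H3; exists (lam a g); split; first exact: lam_maps.
by split; [apply: lam_inj | apply: lam_onto].
Qed.

Lemma surjE a b : surj a b -> exists g, DfT (fun e => g (e 0)) /\
  (forall x, x ∈ a -> g x ∈ b) /\ forall y, y ∈ b -> exists x, x ∈ a /\ y = g x.
Proof.
move=> [f [Hf Ho]]; exists (app f); split; first by df.
split=> [x Hx|y Hy]; first by case: (maps_app Hf Hx).
have [x Hx] := Ho y Hy; exists x; split; last by rewrite (functional_app (proj1 Hf) Hx).
by case: Hf => _ [Hd _]; apply/Hd; exists y.
Qed.

Lemma equipE a b : equip a b -> exists g, DfT (fun e => g (e 0)) /\
  (forall x, x ∈ a -> g x ∈ b) /\ (forall x y, x ∈ a -> y ∈ a -> g x = g y -> x = y) /\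
  forall y, y ∈ b -> exists x, x ∈ a /\ y = g x.
Proof.
move=> [f [Hf [Hi Ho]]]; exists (app f); split; first by df.
split=> [x Hx|]; first by case: (maps_app Hf Hx).
split=> [x y Hx Hy E|y Hy].
  have [H1 _] := maps_app Hf Hx; have [H2 _] := maps_app Hf Hy.
  by rewrite E in H1; apply: Hi H1 H2.
have [x Hx] := Ho y Hy; exists x; split; last by rewrite (functional_app (proj1 Hf) Hx).
by case: Hf => _ [Hd _]; apply/Hd; exists y.
Qed.

Lemma equip_surj a b : equip a b -> surj a b.
Proof. by move=> [f [H1 [_ H2]]]; exists f. Qed.

Lemma equip_sym a b : equip a b -> equip b a.
Proof.
move=> /equipE[g [Hg [H1 [H2 H3]]]]; have Hg' := Dff1 Hg.
pose k y := iota (fun x => x ∈ a /\ y = g x).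
have Hk x : x ∈ a -> k (g x) = x.
  move=> Hx; apply: iotaP => // z [Hz E]; symmetry; exact: H2.
apply: (@equipI b a k); first by rewrite /k; df.
- by move=> y /H3[x [Hx ->]]; rewrite Hk.
- by move=> y y' /H3[x [Hx ->]] /H3[x' [Hx' ->]]; rewrite !Hk // => ->.
- by move=> x Hx; exists (g x); rewrite Hk //; split=> //; apply: H1.
Qed.

Lemma equip_trans a b c : equip a b -> equip b c -> equip a c.
Proof.
move=> /equipE[g [Hg [H1 [H2 H3]]]] /equipE[k [Hk [K1 [K2 K3]]]].
have Hg' := Dff1 Hg; have Hk' := Dff1 Hk.
apply: (@equipI a c (fun x => k (g x))); first by df.
- by move=> x Hx; apply/K1/H1.
- by move=> x y Hx Hy /K2 E; apply: H2 => //; apply: E; apply: H1.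
- by move=> y /K3[z [/H3[x [Hx ->]] ->]]; exists x.
Qed.

Lemma surj_sub a b c : surj a b -> sub c b -> (exists x, x ∈ c) -> surj a c.
Proof.
move=> /surjE[g [Hg [H1 H2]]] Hs [x0 Hx0]; have Hg' := Dff1 Hg.
pose k x := iota (fun y => (g x ∈ c /\ y = g x) \/ (g x ∉ c /\ y = x0)).
have Hk x : g x ∈ c -> k x = g x.
  by move=> Hx; apply: iotaP; [left | move=> z [[]//|[]//]].
apply: (@surjI a c k); first by rewrite /k; df.
  move=> x Hx; have [Hc|Hc] := classic (g x ∈ c); first by rewrite Hk.
  suff -> : k x = x0 by [].
  by apply: iotaP; [right | move=> z [[]//|[]//]].
move=> y Hy; have [x [Hx E]] := H2 y (Hs y Hy); exists x; split=> //.
by rewrite Hk -E.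
Qed.

End Maps.
#[export] Hint Resolve Df_maps Df_inj Df_onto : df.

(** * Collapse of a set of ordinals *)

Section OrderType.
Variable M : zf.
Variable I : M.
Hypothesis HI : forall x, x ∈ I -> Ord x.
Implicit Types (x y z a b c d f p : M).

(** The resulting [col a] is the order type of the part of [I] below [a]. It is defined at every
    ordinal, and on [I] it is the Mostowski collapse. *)
Definition col_step (a f : M) := repl (sep a (fun x => x ∈ I)) (app f).
Fact col_seal : seal (rec col_step).
Proof. by eexists. Qed.
Definition col := unseal col_seal.

Lemma DfT_col_step t u : DfT t -> DfT u -> DfT (fun e => col_step (t e) (u e)).
Proof. by apply: Dff2; rewrite /col_step; df. Qed.

Lemma DfT_col t : DfT t -> DfT (fun e => col (t e)).
Proof. by rewrite /col seal_eq; apply: DfT_rec; apply: DfT_col_step. Qed.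
#[local] Hint Resolve DfT_col : df.

Lemma in_col a y : Ord a -> y ∈ col a <-> exists x, x ∈ I /\ x ∈ a /\ y = col x.
Proof.
move=> Ha; have Hc : DfT (fun e => col (e 0)) by df.
have -> : col a = col_step a (lam a col).
  by rewrite /col seal_eq recE //; apply: DfT_col_step.
rewrite /col_step in_repl; last by df.
split=> -[x]; first rewrite in_sep; try by df.
  by move=> [[Hx Hxi] ->]; exists x; rewrite app_lam.
by move=> [Hxi [Hx ->]]; exists x; rewrite in_sep; [rewrite app_lam | df].
Qed.

Lemma col_mem x a : Ord a -> x ∈ I -> x ∈ a -> col x ∈ col a.
Proof. by move=> Ha Hx Hxa; apply/in_col => //; exists x. Qed.

Lemma Ord_col a : Ord a -> Ord (col a).
Proof.
have Htr a' : Ord a' -> trans (col a').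
  move=> Ha' y /(in_col _ Ha')[x [Hx [Hxa ->]]] z /(in_col _ (HI Hx))[w [Hw [Hwx ->]]].
  by apply: col_mem => //; apply: Ord_trans Hwx Hxa.
move=> Ha; split; first exact: Htr.
by move=> y /(in_col _ Ha)[x [Hx [_ ->]]]; apply/Htr/HI.
Qed.

Lemma col_le a : Ord a -> sub (col a) a.
Proof.
move: a; apply: Ord_ind; first by df.
move=> a Ha IH y /(in_col _ Ha)[x [Hx [Hxa ->]]].
by apply: (sub_mem_trans (Ord_col (HI Hx)) Ha (IH _ Hxa) Hxa).
Qed.

Lemma col_lt x y : x ∈ I -> y ∈ I -> x ∈ y <-> col x ∈ col y.
Proof.
move=> Hx Hy; have Ox := HI Hx; have Oy := HI Hy; split=> H; first exact: col_mem.
have [//|[E|H']] := Ord_tri Ox Oy; first by move: H; rewrite E => /mem_irr.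
by case: (mem_asym H (col_mem Ox Hy H')).
Qed.

Lemma col_inj x y : x ∈ I -> y ∈ I -> col x = col y -> x = y.
Proof.
move=> Hx Hy E; have [/(col_lt Hx Hy)|[//|/(col_lt Hy Hx)]] := Ord_tri (HI Hx) (HI Hy);
  by rewrite E => /mem_irr.
Qed.

Definition otp := repl I col.

Lemma in_otp y : y ∈ otp <-> exists x, x ∈ I /\ y = col x.
Proof. by apply: in_repl; df. Qed.

Lemma Ord_otp : Ord otp.
Proof.
split=> [y /in_otp[x [Hx ->]] z /(in_col _ (HI Hx))[w [Hw [_ ->]]]|y /in_otp[x [Hx ->]]].
  by apply/in_otp; exists w.
by have [] := Ord_col (HI Hx).
Qed.

Lemma otp_le b : Ord b -> sub I b -> sub otp b.
Proof.
move=> Hb Hs y /in_otp[x [Hx ->]]; apply: (sub_mem_trans (Ord_col (HI Hx)) Hb _ (Hs _ Hx)).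
exact/col_le/HI.
Qed.

Lemma col_id l x : Ord l -> sub l I -> x ∈ l -> col x = x.
Proof.
move=> Hl Hs Hx; have Ox := Ord_mem Hl Hx; move: x Ox Hx.
apply: (@Ord_ind M (fun x => x ∈ l -> col x = x)); first by df.
move=> x Ox IH Hx; apply: zf_ext => z; rewrite in_col //; split=> [[w [_ [Hw ->]]]|Hz].
  by rewrite IH //; apply: Ord_trans Hw Hx.
have Hzl : z ∈ l by apply: Ord_trans Hz Hx.
by exists z; rewrite IH //; split=> //; apply: Hs.
Qed.

Lemma equip_otp : equip I otp.
Proof.
apply: (@equipI M I otp col); first by df.
- by move=> x Hx; apply/in_otp; exists x.
- exact: col_inj.
- by move=> y /in_otp.
Qed.

End OrderType.
#[export] Hint Resolve DfT_col : df.

(** * Condensation *)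

Section Condensation.
Variable M : zf.
Variable I : M.
Hypothesis HI : forall x, x ∈ I -> Ord x.
Implicit Types (x y z a b c d f p : M) (P : M -> Prop).
Local Notation N k := (num M k).

(** Skolem functions for the hull: [witness] serves operation 2, [copy] membership between values,
    [differ] inequality of values, and [index] provides names for the ordinals below [l]. *)
Definition witness x b := least (fun y => pr y x ∈ S_ b).
Definition copy x a := least (fun y => y ∈ S_ a /\ F_ y = F_ x).
Definition differ a b := least (fun y => y ∈ S_ a /\ F_ y ∉ F_ b).
Definition index x := least (fun y => x = F_ y).

Hypothesis I_num : forall k, N k ∈ I.
Hypothesis I_D1 : forall x, x ∈ I -> D1 x ∈ I.
Hypothesis I_D2 : forall x, x ∈ I -> D2 x ∈ I.
Hypothesis I_pr : forall x y, x ∈ I -> y ∈ I -> pr x y ∈ I.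
Hypothesis I_witness : forall x y, x ∈ I -> y ∈ I -> witness x y ∈ I.
Hypothesis I_copy : forall x y, x ∈ I -> y ∈ I -> copy x y ∈ I.
Hypothesis I_differ : forall x y, x ∈ I -> y ∈ I -> differ x y ∈ I.
Hypothesis col_num : forall k, col I (N k) = N k.

Local Notation c := (col I).
Local Notation th := (otp I).

Lemma cup_eq_r a b : sub a b -> cup a b = b.
Proof. by move=> H; apply: zf_ext => z; rewrite in_cup; split=> [[/H|]|] //; auto. Qed.

Lemma cup_eq_l a b : sub b a -> cup a b = a.
Proof. by move=> H; apply: zf_ext => z; rewrite in_cup; split=> [[|/H]|] //; auto. Qed.

Lemma col_sub a b : Ord b -> sub a b -> Ord a -> sub (c a) (c b).
Proof.
move=> Hb Hs Ha y /(in_col _ _ Ha)[x [Hx [Hxa ->]]]; apply: col_mem => //.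
exact: Hs.
Qed.

Lemma col_cup a b : a ∈ I -> b ∈ I -> cup a b ∈ I /\ c (cup a b) = cup (c a) (c b).
Proof.
move=> Ha Hb; have Oa := HI Ha; have Ob := HI Hb.
have [H|H] : sub a b \/ sub b a.
  by have [H|H] := Ord_total Oa Ob; [left; apply: mem_sub | right].
- by rewrite (cup_eq_r H) (cup_eq_r (col_sub Ob H Oa)).
by rewrite (cup_eq_l H) (cup_eq_l (col_sub Oa H Ob)).
Qed.

Lemma col_eq x y : x ∈ I -> y ∈ I -> x = y <-> c x = c y.
Proof. by move=> Hx Hy; split=> [->|/(col_inj HI Hx Hy)]. Qed.

Lemma col_lt2 x y z w : x ∈ I -> y ∈ I -> z ∈ I -> w ∈ I ->
  lt2 x y z w <-> lt2 (c x) (c y) (c z) (c w).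
Proof.
move=> Hx Hy Hz Hw; have [H1 E1] := col_cup Hx Hy; have [H2 E2] := col_cup Hz Hw.
by rewrite /lt2 -E1 -E2 -!(col_lt HI) // -!col_eq.
Qed.

(** Gödel's order only compares components, [I] is closed under pairing and projections, and its
    collapse is an initial segment; so the collapsed pair satisfies the minimality required by
    [dec_unique]. *)
Lemma col_dec x : x ∈ I -> dec (c x) = op (c (D1 x)) (c (D2 x)).
Proof.
move=> Hx; have Ox := HI Hx; move: x Ox Hx.
apply: (@Ord_ind M (fun x => x ∈ I -> dec (c x) = op (c (D1 x)) (c (D2 x)))); first by df.
move=> x Ox IH Hx; have O1 := HI (I_D1 Hx); have O2 := HI (I_D2 Hx).
apply: dec_unique; try exact: Ord_col.
  move=> b /(in_col _ _ Ox)[y [Hy [Hyx ->]]]; rewrite IH // => /op_inj[E1 E2].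
  have {}E1 := col_inj HI (I_D1 Hy) (I_D1 Hx) E1; have {}E2 := col_inj HI (I_D2 Hy) (I_D2 Hx) E2.
  by move: Hyx; rewrite -(pr_D (HI Hy)) -(pr_D Ox) E1 E2 => /mem_irr.
move=> u v Hu Hv Hun Hlt.
(* The components of an earlier pair are at most this maximum. As [th] is an ordinal, they belong to
   it and are collapses of elements of [I]. *)
have Hm : cup (c (D1 x)) (c (D2 x)) ∈ th.
  have [H <-] := col_cup (I_D1 Hx) (I_D2 Hx); apply/in_otp => //.
  by exists (cup (D1 x) (D2 x)).
have Hth := Ord_otp HI; have Hm' := succ_sub Hth Hm.
have [/Hm'/in_otp[x' [Hx' Eu]] /Hm'/in_otp[y' [Hy' Ev]]] :=
  lt2_max Hu Hv (Ord_col HI O1) (Ord_col HI O2) Hlt.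
have Ox' := HI Hx'; have Oy' := HI Hy'.
have Hp : pr x' y' ∈ x.
  rewrite -{1}(pr_D Ox); apply/pr_lt => //; apply/col_lt2; auto.
  by rewrite -Eu -Ev.
apply: (Hun (c (pr x' y'))); first by apply: col_mem => //; apply: I_pr.
by rewrite IH ?D1_pr ?D2_pr // ?Eu ?Ev //; apply: I_pr.
Qed.

Lemma col_D1 x : x ∈ I -> c (D1 x) = D1 (c x).
Proof. by move=> Hx; rewrite (D1E (c x)) col_dec // fst_op. Qed.

Lemma col_D2 x : x ∈ I -> c (D2 x) = D2 (c x).
Proof. by move=> Hx; rewrite (D2E (c x)) col_dec // snd_op. Qed.

Lemma col_pr x y : x ∈ I -> y ∈ I -> c (pr x y) = pr (c x) (c y).
Proof.
move=> Hx Hy; have Hp := I_pr Hx Hy.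
by rewrite -(pr_D (Ord_col HI (HI Hp))) -col_D1 // -col_D2 // D1_pr ?D2_pr //; apply: HI.
Qed.

Definition same_F x y :=
  (F_ x ∈ F_ y <-> F_ (c x) ∈ F_ (c y)) /\ (F_ x = F_ y <-> F_ (c x) = F_ (c y)).

Definition same_S y := forall x, x ∈ I -> x ∈ S_ y <-> c x ∈ S_ (c y).

Lemma below_col x z : x ∈ I -> z ∈ c x -> exists y, y ∈ I /\ y ∈ x /\ z = c y.
Proof. by move=> Hx /(in_col _ _ (HI Hx)). Qed.

Section Step.
Variable z : M.
Hypothesis Hz : z ∈ I.
Hypothesis IH_S : forall y, y ∈ I -> y ∈ z -> same_S y.
Hypothesis IH_F : forall x y, x ∈ I -> y ∈ I -> x ∈ z -> y ∈ z -> same_F x y.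

Lemma step_same_S : same_S z.
Proof.
move=> x Hx; have Oz := HI Hz; have Ox := HI Hx.
have L1 : lv z ∈ I by apply: I_D1.
have L2 : opn z ∈ I by apply/I_D1/I_D2.
have L3 : arg1 z ∈ I by apply/I_D1/I_D2/I_D2.
have L4 : arg2 z ∈ I by do 3!apply: I_D2.
have E1 : lv (c z) = c (lv z) by rewrite /lv col_D1.
have E2 : opn (c z) = c (opn z) by rewrite /opn -col_D2 // -col_D1 //; apply: I_D2.
have E3 : arg1 (c z) = c (arg1 z).
  by rewrite /arg1 -col_D2 // -col_D2 -?col_D1 //; [do 2!apply: I_D2 | apply: I_D2].
have E4 : arg2 (c z) = c (arg2 z).
  by rewrite /arg2 -!col_D2 //; [do 2!apply: I_D2 | apply: I_D2].
rewrite in_S // in_S; last exact: Ord_col.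
rewrite E1 -(col_lt HI) //.
suff H : x ∈ lv z -> name_op (@S_ M) (@F_ M) (opn z) (arg1 z) (arg2 z) x <->
    name_op (@S_ M) (@F_ M) (opn (c z)) (arg1 (c z)) (arg2 (c z)) (c x).
  by split=> -[H1 H2]; split=> //; apply/H.
move=> Hxl; have Hxz : x ∈ z by apply: (D1_le Oz).
(* Operations are labelled by numerals, which the collapse fixes. *)
have Hn k : opn z = N k <-> opn (c z) = N k.
  by rewrite E2 -{2}(col_num k) -col_eq.
rewrite /name_op -!Hn.
have [E|Hne] := classic (opn z = empty M).
  have Hno k : opn z = N k.+1 -> False by rewrite E => /(@num_inj M 0 k.+1).
  have F k (P : Prop) : (opn z = N k.+1 /\ P) <-> False by split=> // -[/Hno].
  by rewrite !F.
have [A1 A2] := args_lt Oz Hne; rewrite E3 E4.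
have S1 := IH_S L3 A1; have S2 := IH_S L4 A2.
have X1 := I_D1 Hx; have X2 := I_D2 Hx; have X12 := I_D1 X2; have X22 := I_D2 X2.
have Hd1 := D1_in Oz Hxz; have Hd2 := D1_in Oz (D2_in Oz Hxz).
have [F1 F2] := IH_F X1 X12 Hd1 Hd2; have [F3 _] := IH_F X12 X1 Hd2 Hd1.
rewrite -(col_D1 Hx) -(col_D2 Hx) -(col_D1 X2) -(col_D2 X2) -F1 -F2 -F3.
rewrite -(col_pr X1 X22) -(col_pr Hx L4).
rewrite -(S1 _ Hx) -(S2 _ Hx) -(S1 _ X2) -(S1 _ (I_pr X1 X22)) -(S1 _ (I_pr Hx L4)).
suff -> : (exists y, Ord y /\ pr y x ∈ S_ (arg1 z)) <->
  (exists y, Ord y /\ pr y (c x) ∈ S_ (c (arg1 z))) by [].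
split=> [Hex|[y [Oy Hy]]].
  have HD : Df (fun e => pr (e 0) x ∈ S_ (arg1 z)) by df.
  have Hw := I_witness Hx L3.
  have [Ow [Hpw _]] := @leastP M (fun y => pr y x ∈ S_ (arg1 z)) HD Hex.
  exists (c (witness x (arg1 z))); split; first exact: Ord_col.
  by rewrite -col_pr // -S1 //; apply: I_pr.
(* Conversely, [y] is at most the code of its pair and so below [c (arg1 z)]; hence it is itself the
   collapse of an element of [I]. *)
have Hpy := S_lt (Ord_col HI (HI L3)) Hy.
have Hyc : y ∈ c (arg1 z).
  apply: sub_mem_trans Hpy => //; first exact: Ord_col (HI L3).
  exact: pr_ge_l (Ord_col HI Ox).
have [w [Hw [_ Ew]]] := below_col L3 Hyc.
exists w; split; first exact: HI.
by rewrite S1; [rewrite col_pr // -Ew | apply: I_pr].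
Qed.

(** A name in [S_ z] with the value of [x] need not lie in [I]; [copy] supplies one that does. In
    the other direction every name below [c z] is a collapse. *)
Lemma F_in_step x : x ∈ I -> x ∈ z -> F_ x ∈ F_ z <-> F_ (c x) ∈ F_ (c z).
Proof.
move=> Hx Hxz; have Oz := HI Hz; have Ocz := Ord_col HI Oz.
rewrite !in_F //; split=> [[y [Hy Ey]]|[y [Hy Ey]]].
  have HD : Df (fun e => e 0 ∈ S_ z /\ F_ (e 0) = F_ x) by df.
  have [|_ [[Hs Es] _]] := @leastP M (fun y => y ∈ S_ z /\ F_ y = F_ x) HD.
    by exists y; split=> //; apply: Ord_mem (S_lt Oz Hy).
  have Hr := I_copy Hx Hz; exists (c (copy x z)); split; first by apply/step_same_S.
  by apply/(proj2 (IH_F Hx Hr Hxz (S_lt Oz Hs))).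
have [w [Hw [Hwz Ew]]] := below_col Hz (S_lt Ocz Hy).
exists w; split; first by apply/step_same_S => //; rewrite -Ew.
by apply/(proj2 (IH_F Hx Hw Hxz Hwz)); rewrite -Ew.
Qed.

Lemma F_differ a b y : a ∈ I -> b ∈ I -> F_ y ∈ F_ a -> F_ y ∉ F_ b ->
  exists w, w ∈ I /\ w ∈ S_ a /\ F_ w ∉ F_ b.
Proof.
move=> Ha Hb /(in_F _ (HI Ha))[u [Hu Eu]] Hn.
have HD : Df (fun e => e 0 ∈ S_ a /\ F_ (e 0) ∉ F_ b) by df.
have [|_ [[H1 H2] _]] := @leastP M (fun y => y ∈ S_ a /\ F_ y ∉ F_ b) HD.
  by exists u; rewrite -Eu; split=> //; apply: Ord_mem (S_lt (HI Ha) Hu); apply: HI.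
by exists (differ a b); split=> //; apply: I_differ.
Qed.

(** Elements of the collapsed values have collapsed names and can be pulled back. Conversely,
    unequal values are separated by an element for which [differ] finds a name in [I], and
    membership has already been transferred. *)
Lemma F_eq_step x : x ∈ I -> x ∈ z -> F_ x = F_ z <-> F_ (c x) = F_ (c z).
Proof.
move=> Hx Hxz; have Oz := HI Hz; have Ox := HI Hx.
have Ocz := Ord_col HI Oz; have Ocx := Ord_col HI Ox.
have Sx := IH_S Hx Hxz.
split=> E.
  apply: zf_ext => u; split=> /in_F => /(_ _)[//|y [Hy ->]].
    have [w [Hw [Hwx Ew]]] := below_col Hx (S_lt Ocx Hy); subst y.
    have Hwz : w ∈ z by apply: Ord_trans Hwx Hxz.
    apply/F_in_step => //; rewrite -E; apply/in_F => //; exists w; split=> //.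
    exact/Sx.
  have [w [Hw [Hwz Ew]]] := below_col Hz (S_lt Ocz Hy); subst y.
  apply/(proj1 (IH_F Hw Hx Hwz Hxz)); rewrite E; apply/in_F => //; exists w; split=> //.
  exact/step_same_S.
apply: NNPP => Hne.
have [[y [H1 H2]]|[y [H1 H2]]] : (exists y, y ∈ F_ x /\ y ∉ F_ z) \/ (exists y, y ∈ F_ z /\ y ∉ F_ x).
  apply: NNPP => H; apply: Hne; apply: zf_ext => y.
  by split=> Hy; apply: NNPP => Hy'; apply: H; [left | right]; exists y.
- have /(in_F _ Ox)[y' [Hy' Ey]] := H1; subst y.
  have [w [Hw [Hwx Hwz]]] := F_differ Hx Hz H1 H2.
  have Hwlz : w ∈ z by apply: Ord_trans (S_lt Ox Hwx) Hxz.
  apply: Hwz; apply/F_in_step => //; rewrite -E; apply/in_F => //.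
  by exists (c w); split=> //; apply/Sx.
have /(in_F _ Oz)[y' [Hy' Ey]] := H1; subst y.
have [w [Hw [Hwz Hwx]]] := F_differ Hz Hx H1 H2.
apply: Hwx; apply/(proj1 (IH_F Hw Hx (S_lt Oz Hwz) Hxz)); rewrite E; apply/in_F => //.
by exists (c w); split=> //; apply/step_same_S.
Qed.

Lemma F_mem_step x : x ∈ I -> x ∈ z -> F_ z ∈ F_ x <-> F_ (c z) ∈ F_ (c x).
Proof.
move=> Hx Hxz; have Oz := HI Hz; have Ox := HI Hx; have Ocx := Ord_col HI Ox.
have Sx := IH_S Hx Hxz.
rewrite !in_F //; split=> -[y [Hy Ey]].
  have HD : Df (fun e => e 0 ∈ S_ x /\ F_ (e 0) = F_ z) by df.
  have [|_ [[Hs Es] _]] := @leastP M (fun y => y ∈ S_ x /\ F_ y = F_ z) HD.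
    by exists y; split=> //; apply: Ord_mem (S_lt Ox Hy).
  have Hr := I_copy Hz Hx; exists (c (copy z x)); split; first by apply/Sx.
  symmetry; apply/F_eq_step => //; apply: Ord_trans (S_lt Ox Hs) Hxz.
  exact: HI.
have [w [Hw [Hwx Ew]]] := below_col Hx (S_lt Ocx Hy); subst y.
exists w; split; first exact/Sx.
by symmetry; apply/F_eq_step => //; apply: Ord_trans Hwx Hxz.
Qed.

End Step.

Lemma F_irr x : same_F x x.
Proof. by split; split=> // /mem_irr. Qed.

(** Both orders of the arguments are carried along, because a larger name may denote an element of
    the value of a smaller one. Such memberships are reduced to equalities by [F_mem_step]. *)
Lemma condensation z : z ∈ I ->
  same_S z /\ forall x, x ∈ I -> x ∈ succ z -> same_F x z /\ same_F z x.
Proof.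
move=> Hz; have Oz := HI Hz; move: z Oz Hz.
apply: (@Ord_ind M (fun z => z ∈ I ->
  same_S z /\ forall x, x ∈ I -> x ∈ succ z -> same_F x z /\ same_F z x)).
  by rewrite /same_S /same_F; df.
move=> z Oz IH Hz.
have IH_S y : y ∈ I -> y ∈ z -> same_S y by move=> Hy Hyz; case: (IH y Hyz Hy).
have IH_F x y : x ∈ I -> y ∈ I -> x ∈ z -> y ∈ z -> same_F x y.
  move=> Hx Hy Hxz Hyz; have [_ Fx] := IH x Hxz Hx; have [_ Fy] := IH y Hyz Hy.
  have [H|[->|H]] := Ord_tri (HI Hx) (HI Hy); last 2 first.
  - exact: F_irr.
  - by case: (Fx y Hy) => //; apply/in_succ; left.
  by case: (Fy x Hx) => //; apply/in_succ; left.
split; first exact: step_same_S.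
move=> x Hx /in_succ[Hxz|->]; last by split; apply: F_irr.
have H1 := F_in_step Hz IH_S IH_F Hx Hxz.
have H2 := F_eq_step Hz IH_S IH_F Hx Hxz.
have H3 := F_mem_step Hz IH_S IH_F Hx Hxz.
by split; split=> //; split=> E; symmetry; apply/H2.
Qed.

Lemma same_F_all x y : x ∈ I -> y ∈ I -> same_F x y.
Proof.
move=> Hx Hy; have [_ Fx] := condensation Hx; have [_ Fy] := condensation Hy.
have [H|[->|H]] := Ord_tri (HI Hx) (HI Hy); last 2 first.
- exact: F_irr.
- by case: (Fx y Hy) => //; apply/in_succ; left.
by case: (Fy x Hx) => //; apply/in_succ; left.
Qed.

Variable l : M.
Hypothesis Hl : Ord l.
Hypothesis I_index : forall x, x ∈ l -> index x ∈ I.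
Hypothesis VL : forall x, exists a, Ord a /\ x = F_ a.

Lemma indexP x : Ord (index x) /\ F_ (index x) = x.
Proof. by have [|H1 [H2 _]] := @leastP M (fun y => x = F_ y) _ (VL x); [df|]. Qed.

(** After the collapse, a value still depends only on the value before it, so each name in [I] may
    be exchanged for the least name of its value. This reduces the claim for [x] to its elements:
    first for ordinals below [l] by induction, then for subsets of [l]. *)
Lemma F_col_fixed x : x ∈ I -> sub (F_ x) l ->
  (forall a, a ∈ F_ x -> F_ (c (index a)) = a) -> F_ (c x) = F_ x.
Proof.
move=> Hx Hs H; have Ox := HI Hx; have Ocx := Ord_col HI Ox.
have [Sx _] := condensation Hx.
apply: zf_ext => u; split=> [/(in_F _ Ocx)[y [Hy ->]]|Hu].
  have [w [Hw [Hwx Ew]]] := below_col Hx (S_lt Ocx Hy); subst y.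
  have Hwf : F_ w ∈ F_ x by apply/in_F => //; exists w; split=> //; apply/Sx.
  have Hi := I_index (Hs _ Hwf); have [_ Ei] := indexP (F_ w).
  have := H _ Hwf; have [_ [HE _]] := same_F_all Hi Hw; rewrite (HE Ei) => ->.
  exact: Hwf.
have Hi := I_index (Hs _ Hu); have [_ Ei] := indexP u.
rewrite -(H _ Hu); apply/(proj1 (same_F_all Hi Hx)); by rewrite Ei.
Qed.

Lemma F_col_ordinal a : a ∈ l -> F_ (c (index a)) = a.
Proof.
move=> Ha; have Oa := Ord_mem Hl Ha; move: a Oa Ha.
apply: (@Ord_ind M (fun a => a ∈ l -> F_ (c (index a)) = a)).
  by rewrite /index; df.
move=> a Oa IH Ha; have [_ Ei] := indexP a; rewrite -{2}Ei.
apply: F_col_fixed; first exact: I_index.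
  by rewrite Ei; apply: mem_sub.
by rewrite Ei => b Hb; apply: IH => //; apply: Ord_trans Hb Ha.
Qed.

Lemma F_col_subset x : x ∈ I -> sub (F_ x) l -> F_ (c x) = F_ x.
Proof. by move=> Hx Hs; apply: F_col_fixed => // a /Hs; apply: F_col_ordinal. Qed.

End Condensation.

(** * Skolem hulls as images of an ordinal *)

Section Hull.
Variable M : zf.
Implicit Types (x y z a b c d f p : M) (P : M -> Prop).
Local Notation N k := (num M k).

Lemma Ord_least P : Df (fun e => P (e 0)) -> Ord (least P).
Proof.
move=> HP; have [H|H] := classic (exists a, Ord a /\ P a); first by case: (leastP HP H).
suff -> : least P = empty M by [].
apply: zf_ext => z; split=> [|/in_empty //]; rewrite /least seal_eq.
set Q := fun _ => _; have [[[Ho [HPo _]] _]|[_ Hn]] := iota_orP Q; last by move/Hn.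
by case: H; exists (iota Q).
Qed.

(** Tags 0 and 1 remain free for the generators in [hull_rel], the elements of [l] and [x0]. Unary
    functions ignore the second argument. *)
Definition skolem (k : nat) a b :=
  match k with
  | 2 => D1 a | 3 => D2 a | 4 => pr a b | 5 => witness a b
  | 6 => copy a b | 7 => differ a b | _ => index a
  end.

Lemma DfT_skolem k t u : DfT t -> DfT u -> DfT (fun e => skolem k (t e) (u e)).
Proof.
apply: Dff2; case: k => [|[|[|[|[|[|[|[|k]]]]]]]]; rewrite /= /witness /copy /differ /index; df.
Qed.
#[local] Hint Resolve DfT_skolem : df.

Lemma Ord_skolem k a b : Ord a -> Ord b -> Ord (skolem k a b).
Proof.
move=> Ha Hb; case: k => [|[|[|[|[|[|[|[|k]]]]]]]] /=; auto; rewrite /witness /copy /differ /index;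
  apply: Ord_least; df.
Qed.

Variables (l x0 : M).
Hypothesis Hl : Ord l.
Hypothesis Hcl : pr_closed l.
Hypothesis Hol : sub (omega M) l.
Hypothesis Hx0 : Ord x0.

(** The ordinals below [l] are read as Skolem terms over [l] and [x0]. Since [l]
    is closed under pairing, the values of these terms form a Skolem hull, which
    comes with a map from [l] onto it. *)
Definition skolem_case k (t f y : M) :=
  D1 t = N k /\ y = skolem k (app f (D1 (D2 t))) (app f (D2 (D2 t))).

Definition hull_rel (t f y : M) :=
  (D1 t = N 0 /\ y = D2 t) \/ (D1 t = N 1 /\ y = x0) \/
  skolem_case 2 t f y \/ skolem_case 3 t f y \/ skolem_case 4 t f y \/ skolem_case 5 t f y \/
  skolem_case 6 t f y \/ skolem_case 7 t f y \/ skolem_case 8 t f y.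

Definition hull_step (t f : M) := iota (hull_rel t f).
Fact hull_seal : seal (rec hull_step).
Proof. by eexists. Qed.
Definition hull := unseal hull_seal.

Lemma DfT_hull_step t u : DfT t -> DfT u -> DfT (fun e => hull_step (t e) (u e)).
Proof. by apply: Dff2; rewrite /hull_step /hull_rel /skolem_case; df. Qed.

Lemma DfT_hull t : DfT t -> DfT (fun e => hull (t e)).
Proof. by rewrite /hull seal_eq; apply: DfT_rec; apply: DfT_hull_step. Qed.
#[local] Hint Resolve DfT_hull : df.

Lemma hull_rel_num k t f y : D1 t = N k -> hull_rel t f y <->
  match k with
  | 0 => y = D2 t | 1 => y = x0
  | 2 | 3 | 4 | 5 | 6 | 7 | 8 => y = skolem k (app f (D1 (D2 t))) (app f (D2 (D2 t)))
  | _ => False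
  end.
Proof.
move=> E; rewrite /hull_rel /skolem_case E; split.
  by case=> [|[|[|[|[|[|[|[|]]]]]]]] [/(@num_inj M) ->].
by case: k E => [|[|[|[|[|[|[|[|[|k]]]]]]]]] //= _ H; auto 12.
Qed.

Lemma hullE t : Ord t -> hull t = hull_step t (lam t hull).
Proof. by move=> Ht; rewrite /hull seal_eq recE //; apply: DfT_hull_step. Qed.

Lemma hull_num k t y : Ord t -> D1 t = N k -> hull_rel t (lam t hull) y -> hull t = y.
Proof.
move=> Ht E; rewrite hullE // => H; apply: iotaP => // z; move: H.
by rewrite !(hull_rel_num _ _ E); case: k E => [|[|[|[|[|[|[|[|[|k]]]]]]]]] _ // -> ->.
Qed.

Lemma hull_base x : x ∈ l -> hull (pr (N 0) x) = x.
Proof.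
move=> Hx; have Ox := Ord_mem Hl Hx; have E := D1_pr (Ord_num 0) Ox.
by apply: (hull_num (Ord_pr (Ord_num 0) Ox) E); rewrite (hull_rel_num _ _ E) D2_pr.
Qed.

Lemma hull_extra : hull (pr (N 1) (N 0)) = x0.
Proof.
have E := D1_pr (Ord_num 1 : Ord (N 1)) (Ord_num 0).
by apply: (hull_num (Ord_pr (Ord_num 1) (Ord_num 0)) E); rewrite (hull_rel_num _ _ E).
Qed.

Lemma args_below t : Ord t -> D1 t <> empty M -> D1 (D2 t) ∈ t /\ D2 (D2 t) ∈ t.
Proof.
move=> Ht Hne; suff H : D2 t ∈ t by split; [apply: D1_in | apply: D2_in].
by rewrite -{2}(pr_D Ht); apply: pr_gt_r; auto.
Qed.

Lemma Ord_hull t : Ord t -> Ord (hull t).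
Proof.
move: t; apply: Ord_ind; first by df.
move=> t Ht IH; rewrite hullE // /hull_step.
have [[H _]|[_ H]] := iota_orP (hull_rel t (lam t hull)); last first.
  suff -> : iota (hull_rel t (lam t hull)) = empty M by [].
  by apply: zf_ext => z; split=> [/H|/in_empty].
move: H; set y := iota _; have O2 := Ord_D2 Ht.
have Hs k : skolem_case k.+1 t (lam t hull) y -> Ord y.
  case=> E ->; have [|A1 A2] := args_below Ht.
    by rewrite E => /(@num_inj M k.+1 0).
  by apply: Ord_skolem; (rewrite app_lam //; [exact: IH | df]).
case=> [[_ ->] //|[[_ ->] //|]].
by case=> [|[|[|[|[|[|]]]]]] /Hs.
Qed.

Definition hull_set := repl l hull.
Local Notation I := hull_set.

Lemma in_hull_set x : x ∈ I <-> exists t, t ∈ l /\ x = hull t.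
Proof. by apply: in_repl; df. Qed.

Lemma hull_set_Ord x : x ∈ I -> Ord x.
Proof. by move=> /in_hull_set[t [Ht ->]]; apply/Ord_hull/(Ord_mem Hl). Qed.

Lemma num_in_l k : N k ∈ l.
Proof. exact/Hol/num_omega. Qed.

Lemma base_in_hull_set : sub l I.
Proof.
move=> x Hx; apply/in_hull_set; exists (pr (N 0) x); rewrite hull_base //; split=> //.
by apply: Hcl => //; apply: num_in_l.
Qed.

Lemma extra_in_hull_set : x0 ∈ I.
Proof.
apply/in_hull_set; exists (pr (N 1) (N 0)); rewrite hull_extra; split=> //.
by apply: Hcl; apply: num_in_l.
Qed.

Lemma skolem_in_hull_set k x y : 1 < k <= 8 -> x ∈ I -> y ∈ I -> skolem k x y ∈ I.
Proof.
move=> Hk /in_hull_set[s [Hs ->]] /in_hull_set[t [Ht ->]].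
have Os := Ord_mem Hl Hs; have Ot := Ord_mem Hl Ht; have Op := Ord_pr Os Ot.
have On : Ord (N k) by []; have Oq := Ord_pr On Op.
have E := D1_pr On Op; have E2 := D2_pr On Op.
apply/in_hull_set; exists (pr (N k) (pr s t)); split.
  by do 2?apply: Hcl => //; apply: num_in_l.
symmetry; apply: (hull_num Oq E); rewrite (hull_rel_num _ _ E) E2 D1_pr // D2_pr //.
have [|A1 A2] := args_below Oq.
  by rewrite E => /(@num_inj M k 0) Hk0; move: Hk; rewrite Hk0.
move: A1 A2; rewrite E2 D1_pr // D2_pr // => A1 A2.
rewrite !app_lam //; try by df.
by case: k Hk {On Oq E E2 A1 A2} => [|[|[|[|[|[|[|[|[|k]]]]]]]]].
Qed.

Hypothesis VL : forall x, exists a, Ord a /\ x = F_ a.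

Lemma hull_condensation : sub (F_ x0) l ->
  exists g, DfT (fun e => g (e 0)) /\ exists a, a ∈ l /\ F_ (g a) = F_ x0 /\
  Ord (repl l g) /\ g a ∈ repl l g.
Proof.
move=> Hs; have Hcn k : col I (N k) = N k.
  exact: col_id Hl base_in_hull_set (num_in_l k).
have Hsk k x y (Hk : 1 < k <= 8) : x ∈ I -> y ∈ I -> skolem k x y ∈ I.
  exact: skolem_in_hull_set.
have Hg : DfT (fun e => col I (hull (e 0))) by df.
(* Evaluation of terms followed by the collapse maps [l] onto the order type of the hull. *)
exists (fun t => col I (hull t)); split=> //.
(* The term with tag 1, whose value is [x0]. *)
exists (pr (N 1) (N 0)); rewrite hull_extra.
have Hp : pr (N 1) (N 0) ∈ l by apply: Hcl; apply: num_in_l.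
split=> //; split; last first.
  suff -> : repl l (fun t => col I (hull t)) = otp I.
    by split; [apply: Ord_otp; exact: hull_set_Ord|
      apply/in_otp; exists x0; split=> //; exact: extra_in_hull_set].
  apply: zf_ext => z; rewrite in_repl // in_otp.
  split=> -[t [Ht ->]]; first by exists (hull t); split=> //; apply/in_hull_set; exists t.
  by move/in_hull_set: Ht => [s [Hs' ->]]; exists s.
apply: (@F_col_subset M I hull_set_Ord _ _ _ _ _ _ _ _ l) => //.
- by move=> k; apply/base_in_hull_set/num_in_l.
- by move=> x Hx; apply: (Hsk 2 x x).
- by move=> x Hx; apply: (Hsk 3 x x).
- by move=> x y Hx Hy; apply: (Hsk 4 x y).
- by move=> x y Hx Hy; apply: (Hsk 5 x y).
- by move=> x y Hx Hy; apply: (Hsk 6 x y).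
- by move=> x y Hx Hy; apply: (Hsk 7 x y).
- by move=> x Hx; have Hx' := base_in_hull_set Hx; apply: (Hsk 8 x x).
exact: extra_in_hull_set.
Qed.

End Hull.

(** A name of [x] is collapsed along the hull of [l] to a name below the order
    type of the hull, which is an ordinal and an image of [l]. *)
Theorem subset_index_bound (M : zf) (l b x : M) :
  (forall x : M, exists a, Ord a /\ x = F_ a) ->
  Ord l -> pr_closed l -> sub (omega M) l ->
  Ord b -> empty M ∈ b -> ~ surj l b -> sub x l -> exists a, a ∈ b /\ x = F_ a.
Proof.
move=> VL Hl Hcl Hol Hb Hb0 Hns Hx; have [x0 [Hx0 E]] := VL x; rewrite E in Hx.
have [g [Hg [a [Ha [EF [Ho Hga]]]]]] := hull_condensation Hl Hcl Hol Hx0 VL Hx.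
exists (g a); split; last by rewrite EF.
(* If the order type is not below [b], it includes [b], and the surjection of [l] onto it can be cut
   down to one onto [b]. *)
have [H|H] := Ord_total Ho Hb; first exact: Ord_trans Hga H.
case: Hns; apply: (@surj_sub M l (repl l g) b) => //; last by exists (empty M).
apply: (surjI Hg) => y; first by move=> Hy; rewrite in_repl //; exists y.
by rewrite in_repl.
Qed.

(** * Inaccessibility of the first uncountable ordinal in L *)

Section Cardinals.
Variable M : zf.
Implicit Types (x y z a b c d f p l m : M) (P : M -> Prop).

Definition cofinal f b a := maps f b a /\
  forall x, x ∈ a -> exists y, y ∈ b /\ exists z, op y z ∈ f /\ (x = z \/ x ∈ z).

Definition cardinal a := Ord a /\ forall b, b ∈ a -> ~ equip b a.

Definition has_cof a b := Ord b /\ (exists f, cofinal f b a) /\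
  forall c, c ∈ b -> ~ exists f, cofinal f c a.

Definition inaccessible a := cardinal a /\ (exists w, w ∈ a /\ is_lim w /\ forall n, n ∈ w -> ~ is_lim n) /\
  has_cof a a /\
  forall l, l ∈ a -> cardinal l -> exists m, m ∈ a /\ cardinal m /\
    exists p, (forall z, z ∈ p <-> sub z l) /\ equip m p.

Lemma Df_equip (t u : (nat -> M) -> M) : DfT t -> DfT u -> Df (fun e => equip (t e) (u e)).
Proof. by apply: Df_sub2'; rewrite /equip; df. Qed.
#[local] Hint Resolve Df_equip : df.

Lemma cofinal_id a : cofinal (lam a (fun x => x)) a a.
Proof.
have Hid : DfT (fun e : nat -> M => e 0) by df.
split; first exact: lam_maps.
by move=> x Hx; exists x; split=> //; exists x; rewrite op_lam; auto.
Qed.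

(** * Regular limit ordinals under V = L *)

Section Regular.
Variable k : M.
Hypothesis Hk : Ord k.
Hypothesis Hok : omega M ∈ k.
Hypothesis Hreg : forall b, b ∈ k -> ~ exists f, cofinal f b k.

Lemma regular_bound (g : M -> M) b : DfT (fun e => g (e 0)) -> b ∈ k ->
  (forall x, x ∈ b -> g x ∈ k) -> exists s, s ∈ k /\ forall x, x ∈ b -> g x ∈ s.
Proof.
move=> Hg Hb H; apply: NNPP => Hno; apply: (Hreg Hb); exists (lam b g).
split; first exact: lam_maps.
move=> x Hx; apply: NNPP => Hn; apply: Hno; exists x; split=> // y Hy.
have [//|Hs] := Ord_total (Ord_mem Hk (H y Hy)) (Ord_mem Hk Hx).
case: Hn; exists y; split=> //; exists (g y); rewrite op_lam //; split=> //.
by have [|] := Ord_sub (Ord_mem Hk Hx) (Ord_mem Hk (H y Hy)) Hs; auto.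
Qed.

Lemma regular_succ a : a ∈ k -> succ a ∈ k.
Proof.
move=> Ha; have [//|E] := Ord_sub (Ord_succ (Ord_mem Hk Ha)) Hk (succ_sub Hk Ha).
have H1 : num M 1 ∈ k by apply: Ord_trans (num_omega 1) Hok.
(* If [k] were the successor of [a], the constant map on 1 with value [a] would be unbounded in
   it. *)
have [||s [Hs H]] := @regular_bound (fun=> a) (num M 1) _ H1.
- by df.
- by [].
have Has : a ∈ s by apply: (H (empty M)); apply: mem_succ.
by move: Hs; rewrite -E => /in_succ[/(mem_asym Has)|E'] //; move: Has; rewrite E' => /mem_irr.
Qed.

(** If the pairs below [(a, b)] had order type at least [k], then [k] would be a
    union of fewer than [k] bounded subsets. *)
Lemma regular_pr : pr_closed k.
Proof.
move=> a b Ha Hb; have Oa := Ord_mem Hk Ha; have Ob := Ord_mem Hk Hb.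
have [//|Hs] := Ord_total (Ord_pr Oa Ob) Hk; exfalso.
set m := succ (cup a b).
have Hm : m ∈ k by apply/regular_succ/lt2_cup.
have Hd x : x ∈ k -> D1 x ∈ m /\ D2 x ∈ m.
  move=> Hx; have Ox := Ord_mem Hk Hx.
  by apply: lt2_max; auto; apply/pr_lt; auto; rewrite pr_D //; apply: Hs.
(* Codes outside [k] are replaced by 0, so that all values lie in [k] and regularity applies. *)
pose v c d := iota (fun y => (pr c d ∈ k /\ y = pr c d) \/ (pr c d ∉ k /\ y = empty M)).
have Hvk c d : v c d ∈ k.
  rewrite /v; have [H|H] := classic (pr c d ∈ k).
    by rewrite (@iotaP _ _ (pr c d)); [| by left | by move=> z [[]|[]]].
  rewrite (@iotaP _ _ (empty M)); [|by right|by move=> z [[]|[]]].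
  exact: Ord_trans empty_omega Hok.
have Hv c d : pr c d ∈ k -> v c d = pr c d.
  by move=> H; apply: iotaP; [by left | by move=> z [[]|[]]].
have Dv : forall t u, DfT t -> DfT u -> DfT (fun e => v (t e) (u e)).
  by apply: Dff2; rewrite /v; df.
pose sb c := least (fun s => s ∈ k /\ forall d, d ∈ m -> v c d ∈ s).
have Hsb c : sb c ∈ k /\ forall d, d ∈ m -> v c d ∈ sb c.
  have [||s [Hsk Hs']] := @regular_bound (fun d => v c d) m _ Hm.
  - by df.
  - by [].
  have [||_ [H _]] := @leastP M (fun s => s ∈ k /\ forall d, d ∈ m -> v c d ∈ s).
  - by df.
  - by exists s; split=> //; apply: Ord_mem Hsk.
  exact: H.
have [||s [Hsk H]] := @regular_bound sb m _ Hm.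
- by rewrite /sb; df.
- by move=> c _; case: (Hsb c).
(* The bound [s] lies in [k], so it is itself the code of a pair with components below [m] and would
   have to lie below itself. *)
have [H1 H2] := Hd _ Hsk; have Os := Ord_mem Hk Hsk.
have := proj2 (Hsb (D1 s)) _ H2; rewrite Hv pr_D // => H3.
exact: (mem_asym H3 (H _ H1)).
Qed.

(** As ω is below the regular [k], induction up to and including ω keeps every stage of the closing
    process, and its limit, below [k]. *)
Lemma regular_closing l : l ∈ k -> exists l', l' ∈ k /\ pr_closed l' /\ sub (omega M) l' /\ sub l l'.
Proof.
move=> Hl; set a := cup l (omega M).
have Oa : Ord a by apply: Ord_cup => //; apply: Ord_mem Hl.
have Ha : a ∈ k by apply: lt2_cup => //; apply: Ord_mem Hl.
exists (closing a (omega M)); split; last first.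
  split; first exact: pr_closed_closing.
  by split=> z Hz; apply: closing_ge => //; apply/in_cup; auto.
suff H x : Ord x -> x ∈ succ (omega M) -> closing a x ∈ k.
  by apply: H => //; apply: mem_succ.
move: x; apply: (@Ord_ind M (fun x => x ∈ succ (omega M) -> closing a x ∈ k)).
  by have := DfT_closing a; df.
move=> x Ox IH Hx; have Hxk : x ∈ k.
  by case/in_succ: Hx => [Hx|-> //]; apply: Ord_trans Hx Hok.
have Dc := @DfT_closing M a.
have [||s [Hs H]] := @regular_bound (fun y => succ (pr (empty M) (closing a y))) x _ Hxk.
- by df.
- move=> y Hy; apply: regular_succ; apply: regular_pr.
    exact: Ord_trans empty_omega Hok.
  by apply: IH => //; apply: Ord_trans Hy Hx => //; apply: Ord_succ.
have Os := Ord_mem Hk Hs.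
apply: (sub_mem_trans _ Hk _ (lt2_cup Ha Hs Oa Os)); first exact: Ord_closing.
move=> z /(in_closing _ _ Ox)[Hz|[y [Hy Hz]]]; apply/in_cup; first by left.
by right; apply: Ord_trans Hz (H y Hy).
Qed.

Hypothesis Hlim : forall l, l ∈ k -> exists b, b ∈ k /\ empty M ∈ b /\ ~ surj l b.
Hypothesis VL : forall x, exists a, Ord a /\ x = F_ a.

Lemma limit_cardinal : cardinal k.
Proof.
split=> // b Hb /equip_surj Hs; have [c [Hc [H0 Hn]]] := Hlim Hb; apply: Hn.
by apply: (surj_sub Hs); [exact: mem_sub | exists (empty M)].
Qed.

(** Least names inject the power set of [l] into one [b] below [k]. The order type of the set of
    these names is below [k], and the least ordinal equipotent to the power set is a cardinal. *)
Lemma power_card l : l ∈ k -> exists m, m ∈ k /\ cardinal m /\ equip m (power l).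
Proof.
move=> Hl; have [l' [Hl' [Hcl [Hol Hll']]]] := regular_closing Hl.
have [b [Hb [H0 Hns]]] := Hlim Hl'; have Ob := Ord_mem Hk Hb.
have Dx : forall t : (nat -> M) -> M, DfT t -> DfT (fun e => index (t e)).
  by apply: Dff1; rewrite /index; df.
have Hix x : F_ (index x) = x by case: (indexP VL x).
(* The hull argument needs an ordinal closed under pairing and including ω, so subsets of [l] are
   treated as subsets of [l']. *)
have Hib x : sub x l -> index x ∈ b.
  move=> Hx; have [|a [Ha E]] := subset_index_bound VL (Ord_mem Hk Hl') Hcl Hol Ob H0 Hns (x := x).
    by move=> z /Hx /Hll'.
  have Oa := Ord_mem Ob Ha.
  have [Oi _] := indexP VL x; apply: (sub_mem_trans Oi Ob _ Ha).
  by have [||_ [_ H]] := @leastP M (fun y => x = F_ y); [df | exists a | exact: H].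
set J := repl (power l) (@index M).
have HJ y : y ∈ J <-> exists x, x ∈ power l /\ y = index x by apply: in_repl; df.
have HJb : sub J b by move=> y /HJ[x [/in_power Hx ->]]; apply: Hib.
have HJo y : y ∈ J -> Ord y by move=> /HJb; apply: Ord_mem.
have E1 : equip (power l) J.
  apply: (@equipI M _ _ (@index M)); first by df.
  - by move=> x Hx; apply/HJ; exists x.
  - by move=> x y _ _ E; rewrite -(Hix x) -(Hix y) E.
  - by move=> y /HJ.
have E2 : equip (otp J) (power l).
  exact: equip_sym (equip_trans E1 (equip_otp HJo)).
have Oo := Ord_otp HJo.
have Ho : otp J ∈ k by apply: (sub_mem_trans Oo Hk (otp_le HJo Ob HJb) Hb).
have HD : Df (fun e => equip (e 0) (power l)) by df.
have [|Om [Hm Hmin]] := @leastP M (fun a => equip a (power l)) HD; first by exists (otp J).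
exists (least (fun a => equip a (power l))); split.
  exact: (sub_mem_trans Om Hk (Hmin _ Oo E2) Ho).
split=> //; split=> // c Hc Hcm.
exact: (@least_min M (fun a => equip a (power l)) _ HD (Ord_mem Om Hc) (equip_trans Hcm Hm) Hc).
Qed.

Theorem regular_limit_inaccessible : inaccessible k.
Proof.
split; first exact: limit_cardinal.
split.
  exists (omega M); split=> //; split; first by case: (omega_least M) => _ [].
  by move=> n; apply: omega_lim.
split; first by split=> //; split=> //; exists (lam k (fun x => x)); apply: cofinal_id.
move=> l Hl _; have [m [Hm [Hc He]]] := power_card Hl; exists m; split=> //; split=> //.
by exists (power l); split=> // z; apply: in_power.
Qed.

End Regular.

(** From each set take the element whose name is least. *)
Lemma constructible_choice : (forall x, exists a, Ord a /\ x = F_ a) ->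
  forall x, (forall y, y ∈ x -> exists z, z ∈ y) ->
  exists f, functional f /\ dom f x /\ forall y, y ∈ x -> exists z, op y z ∈ f /\ z ∈ y.
Proof.
move=> VL x Hx; pose g y := F_ (least (fun a => F_ a ∈ y)).
have Hg : DfT (fun e => g (e 0)) by rewrite /g; df.
exists (lam x g); split; first exact: lam_functional.
split; first exact: lam_dom.
move=> y Hy; exists (g y); rewrite op_lam //; split=> //.
have [z Hz] := Hx y Hy; have [a [Ha E]] := VL z.
have [||_ [H _]] := @leastP M (fun a => F_ a ∈ y); [df | by exists a; rewrite -E | exact: H].
Qed.

End Cardinals.

(** * Passage between L and the ambient model *)

Section Transfer.
Variable M : zf.
Local Notation N := (L M).

Definition countable (x : M) := exists f, maps f x (omega M) /\ inj f.

Definition uniform_denumeration (f w : M) := functional f /\ dom f w /\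
  forall a, a ∈ w -> (exists z, z ∈ a) ->
  exists g, op a g ∈ f /\ maps g (omega M) a /\ onto g a.

Lemma incl_op_mem (f x y : N) : op x y ∈ f <-> op (incl x) (incl y) ∈ incl f.
Proof. by rewrite incl_mem incl_op. Qed.

Lemma lift_op (f : N) (a b : M) : op a b ∈ incl f ->
  exists x y : N, incl x = a /\ incl y = b /\ op x y ∈ f.
Proof.
move=> H; have Lp : inL (op a b) by apply: inL_trans (incl_inL f) H.
have Lu : inL (upair a b) by apply: inL_trans Lp _; apply/in_op; right.
have [x Ex] : exists x : N, incl x = a.
  by apply: lift_inL; apply: inL_trans Lu _; apply/in_upair; left.
have [y Ey] : exists y : N, incl y = b.
  by apply: lift_inL; apply: inL_trans Lu _; apply/in_upair; right.
by exists x, y; do !split=> //; apply/incl_op_mem; rewrite Ex Ey.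
Qed.

Lemma incl_maps (f a b : N) : maps f a b -> maps (incl f) (incl a) (incl b).
Proof.
move=> [[H1 H2] [H3 H4]]; split; first split.
- move=> p Hp; have [p' [<- Hp']] := lift_mem Hp; have [x [y ->]] := H1 _ Hp'.
  by exists (incl x), (incl y); rewrite incl_op.
- move=> x y z /lift_op[x' [y' [<- [<- Hxy]]]] /lift_op[x2 [z' [E [<- Hxz]]]].
  by rewrite (incl_inj E) in Hxz; rewrite (H2 _ _ _ Hxy Hxz).
split=> [x|x y /lift_op[x' [y' [_ [<- Hxy]]]]]; last exact: H4 Hxy.
split=> [Hx|[y /lift_op[x' [y' [<- [_ Hxy]]]]]]; last by apply/H3; exists y'.
have [x' [<- Hx']] := lift_mem Hx; have /H3[y Hy] := Hx'.
by exists (incl y); apply/incl_op_mem.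
Qed.

Lemma incl_onto (f b : N) : onto f b -> onto (incl f) (incl b).
Proof.
move=> H y Hy; have [y' [<- Hy']] := lift_mem Hy; have [x Hx] := H _ Hy'.
by exists (incl x); apply/incl_op_mem.
Qed.

(** Cofinality is upward absolute: a short cofinal map in L would be one in [M], so regularity
    descends to L. *)
Lemma incl_cofinal (f b a : N) : cofinal f b a -> cofinal (incl f) (incl b) (incl a).
Proof.
move=> [H1 H2]; split; first exact: incl_maps.
move=> x Hx; have [x' [<- Hx']] := lift_mem Hx; have [y [Hy [z [Hz H]]]] := H2 _ Hx'.
exists (incl y); split=> //; exists (incl z); split; first exact/incl_op_mem.
by case: H => [->|H]; auto.
Qed.

Lemma incl_is_lim (a : N) : is_lim a <-> is_lim (incl a).
Proof.
rewrite /is_lim incl_Ord; split=> -[H1 [[x Hx] H2]]; split=> //; split.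
- by exists (incl x).
- move=> [b Hb]; apply: H2; have [|b' [E _]] := @lift_mem M a b.
    by rewrite Hb; apply: mem_succ.
  by exists b'; apply: incl_inj; rewrite incl_succ E.
- by have [x' [_ Hx']] := lift_mem Hx; exists x'.
by move=> [b Hb]; apply: H2; exists (incl b); rewrite Hb incl_succ.
Qed.

Lemma incl_omega : incl (omega N) = omega M.
Proof.
have [O1 [L1 Hm]] := omega_least M; have [O2 [L2 Hm2]] := omega_least N.
apply: sub_anti; last by apply: Hm; [apply/incl_Ord | apply/incl_is_lim].
have [w [E Ow]] := lift_Ord O1; rewrite -E.
have Hs : sub (omega N) w by apply: Hm2 => //; apply/incl_is_lim; rewrite E.
by move=> z Hz; have [z' [<- Hz']] := lift_mem Hz; apply: Hs.
Qed.

Variable k : M.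
Hypothesis Hk : Ord k.
Hypothesis Huncount : ~ countable k.
Hypothesis Hcount : forall b, b ∈ k -> countable b.
Hypothesis Hreg : forall b, b ∈ k -> ~ exists f, cofinal f b k.
Hypothesis HnUD : ~ exists f, uniform_denumeration f k.

Lemma omega_in_omega1 : omega M ∈ k.
Proof.
have [//|H] := Ord_total (@Ord_omega M) Hk; case: Huncount.
have Hid : DfT (fun e : nat -> M => e 0) by df.
exists (lam k (fun x => x)); split; first exact: lam_maps.
exact: lam_inj.
Qed.

(** Otherwise the constructible surjections from [l] onto the ordinals below
    [k], chosen by least index, compose with one enumeration of [l] to a
    uniform denumeration. *)
Lemma omega1_limit l : l ∈ k -> exists b, b ∈ k /\ empty M ∈ b /\
  ~ exists f, inL f /\ maps f l b /\ onto f b.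
Proof.
move=> Hl; apply: NNPP => Hno; apply: HnUD.
have Hf b : b ∈ k -> empty M ∈ b -> exists f, inL f /\ maps f l b /\ onto f b.
  by move=> Hb H0; apply: NNPP => H; apply: Hno; exists b.
have [i [Hi Hinj]] := Hcount Hl.
pose s b := F_ (least (fun a => maps (F_ a) l b /\ onto (F_ a) b)).
have Ds : forall t, DfT t -> DfT (fun e => s (t e)) by apply: Dff1; rewrite /s; df.
have Hs b : b ∈ k -> empty M ∈ b -> maps (s b) l b /\ onto (s b) b.
  move=> Hb H0; have [f [/inLP[a [Ha E]] Hfb]] := Hf b Hb H0.
  have [||_ [H _]] := @leastP M (fun a => maps (F_ a) l b /\ onto (F_ a) b); [df| |exact: H].
  by exists a; rewrite -E.
(* The enumeration runs through the inverse of the injection [i] of [l] into ω. Numbers outside its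
   range are sent to 0, an element of [b] because [b] is not empty. *)
pose v b n := iota (fun y => (exists x, op x n ∈ i /\ y = app (s b) x) \/
  (~ (exists x, op x n ∈ i) /\ y = empty M)).
have Dv : forall t u, DfT t -> DfT u -> DfT (fun e => v (t e) (u e)).
  by apply: Dff2; rewrite /v; df.
have Hv b n x : op x n ∈ i -> v b n = app (s b) x.
  move=> Hx; apply: iotaP; first by left; exists x.
  move=> z [[x' [Hx' ->]]|[[]]]; last by exists x.
  by rewrite (Hinj _ _ _ Hx Hx').
have Hv0 b n : ~ (exists x, op x n ∈ i) -> v b n = empty M.
  move=> H; apply: iotaP; first by right.
  by move=> z [[x [Hx _]]|[_ //]]; case: H; exists x.
have Dl : DfT (fun e => lam (omega M) (v (e 0))) by apply: DfT_lam; df.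
exists (lam k (fun b => lam (omega M) (v b))); split; first exact: lam_functional.
split; first exact: lam_dom.
move=> b Hb [z Hz]; exists (lam (omega M) (v b)); rewrite op_lam //; split=> //.
have Ob := Ord_mem Hk Hb.
have H0 : empty M ∈ b by have [//|/(_ _ Hz)/in_empty] := Ord_total Ord_empty Ob.
have [Hm Ho] := Hs b Hb H0; have Dvb : DfT (fun e => v b (e 0)) by df.
split.
  apply: lam_maps => // n Hn; have [[x Hx]|H] := classic (exists x, op x n ∈ i).
    rewrite (Hv _ _ _ Hx); have Hxl : x ∈ l by case: Hi => _ [Hd _]; apply/Hd; exists n.
    by case: (maps_app Hm Hxl).
  by rewrite Hv0.
apply: lam_onto => // y Hy; have [x Hx] := Ho y Hy.
have Hxl : x ∈ l by case: Hm => _ [Hd _]; apply/Hd; exists y.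
have [H1 H2] := maps_app Hi Hxl; exists (app i x); split=> //.
by rewrite (Hv _ _ _ H1) (functional_app (proj1 Hm) Hx).
Qed.

Theorem omega1_inaccessible_in_L : exists k' : N, inaccessible k'.
Proof.
have [k' [E Hk']] := lift_Ord Hk; exists k'.
apply: regular_limit_inaccessible => //; last exact: L_constructible.
- by apply/incl_mem; rewrite incl_omega E; apply: omega_in_omega1.
- move=> b Hb [f /incl_cofinal Hf]; rewrite E in Hf.
  by apply: (@Hreg (incl b)); [rewrite -E; exact: Hb | exists (incl f)].
move=> l Hl; have [|b [Hb [H0 Hn]]] := @omega1_limit (incl l).
  by rewrite -E; exact: Hl.
have Hbk : b ∈ incl k' by rewrite E.
have [b' [Eb Hb']] := lift_mem Hbk; exists b'; split=> //; split.
  by apply/incl_mem; rewrite incl_empty Eb.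
move=> [f [Hf Ho]]; apply: Hn; exists (incl f); rewrite -Eb; split; first exact: incl_inL.
by split; [apply: incl_maps | apply: incl_onto].
Qed.

End Transfer.

(** * Translation of the formulas *)

Section Congruence.
Variables (M : Type) (E : M -> M -> Prop).
Implicit Types (e : nat -> M) (A B : form) (P Q : Prop).

(** The rules of this section let proof search read off the meaning of a formula connective by
    connective, without unfolding the classical encodings. *)
Lemma sat_not_iff e A P : (sat E e A <-> P) -> (sat E e (fNot A) <-> ~ P).
Proof. by rewrite sat_not => ->. Qed.

Lemma sat_imp_iff e A B P Q :
  (sat E e A <-> P) -> (sat E e B <-> Q) -> (sat E e (fImp A B) <-> (P -> Q)).
Proof. by move=> H1 H2 /=; rewrite H1 H2. Qed.

Lemma sat_and_iff e A B P Q :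
  (sat E e A <-> P) -> (sat E e B <-> Q) -> (sat E e (fAnd A B) <-> P /\ Q).
Proof. by rewrite sat_and => -> ->. Qed.

Lemma sat_or_iff e A B P Q :
  (sat E e A <-> P) -> (sat E e B <-> Q) -> (sat E e (fOr A B) <-> P \/ Q).
Proof. by rewrite sat_or => -> ->. Qed.

Lemma sat_iff_iff e A B P Q :
  (sat E e A <-> P) -> (sat E e B <-> Q) -> (sat E e (fIff A B) <-> (P <-> Q)).
Proof. by rewrite sat_iff => -> ->. Qed.

Lemma sat_all_iff e A (P : M -> Prop) :
  (forall x, sat E (x .: e) A <-> P x) -> (sat E e (fAll A) <-> forall x, P x).
Proof. by move=> H; split=> HA x; apply/H. Qed.

Lemma sat_ex_iff e A (P : M -> Prop) :
  (forall x, sat E (x .: e) A <-> P x) -> (sat E e (fEx A) <-> exists x, P x).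
Proof. by move=> H; rewrite sat_ex; split=> -[x /H Hx]; exists x. Qed.

Lemma sat_allIn_iff e i A (P : M -> Prop) :
  (forall x, sat E (x .: e) A <-> P x) -> (sat E e (fAllIn i A) <-> forall x, E x (e i) -> P x).
Proof. by move=> H; rewrite sat_allIn; split=> HA x Hx; apply/H/HA. Qed.

Lemma sat_exIn_iff e i A (P : M -> Prop) :
  (forall x, sat E (x .: e) A <-> P x) ->
  (sat E e (fExIn i A) <-> exists x, E x (e i) /\ P x).
Proof. by move=> H; rewrite sat_exIn; split=> -[x [Hx /H HA]]; exists x. Qed.

Lemma sat_mem_iff e i j : sat E e (fMem i j) <-> E (e i) (e j).
Proof. by []. Qed.

Lemma sat_eq_iff e i j : sat E e (fEq i j) <-> e i = e j.
Proof. by []. Qed.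

Lemma sat_is_empty e x : sat E e (is_empty x) <-> forall z, ~ E z (e x).
Proof. by []. Qed.

Lemma sat_is_subset e x y : sat E e (is_subset x y) <-> forall z, E z (e x) -> E z (e y).
Proof. by []. Qed.

End Congruence.

Create HintDb sat.
#[export] Hint Constants Opaque : sat.
#[export] Hint Resolve sat_not_iff sat_imp_iff sat_and_iff sat_or_iff sat_iff_iff sat_all_iff
  sat_ex_iff : sat.
#[export] Hint Extern 1 (sat _ _ (fAllIn _ _) <-> _) => refine (@sat_allIn_iff _ _ _ _ _ _ _) : sat.
#[export] Hint Extern 1 (sat _ _ (fExIn _ _) <-> _) => refine (@sat_exIn_iff _ _ _ _ _ _ _) : sat.
#[export] Hint Extern 1 (sat _ _ (fMem _ _) <-> _) => exact (sat_mem_iff _ _ _ _) : sat.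
#[export] Hint Extern 1 (sat _ _ (fEq _ _) <-> _) => exact (sat_eq_iff _ _ _ _) : sat.
#[export] Hint Extern 1 (sat _ _ (is_empty _) <-> _) => exact (sat_is_empty _ _ _) : sat.
#[export] Hint Extern 1 (sat _ _ (is_subset _ _) <-> _) => exact (sat_is_subset _ _ _ _) : sat.
Ltac sat_tac := solve [auto 40 with sat nocore].

Section Translation.
Variables (M : Type) (E : M -> M -> Prop).
Implicit Types (e : nat -> M).

Lemma sat_is_upair_raw e p x y :
  sat E e (is_upair p x y) <-> forall z, E z (e p) <-> z = e x \/ z = e y.
Proof. rewrite /is_upair; sat_tac. Qed.

Lemma sat_is_succ_raw e y x :
  sat E e (is_succ y x) <-> forall z, E z (e y) <-> E z (e x) \/ z = e x.
Proof. rewrite /is_succ; sat_tac. Qed.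

Lemma sat_is_power e p x :
  sat E e (is_power p x) <-> forall z, E z (e p) <-> forall w, E w z -> E w (e x).
Proof. rewrite /is_power; sat_tac. Qed.

End Translation.
#[export] Hint Extern 1 (sat _ _ (is_upair _ _ _) <-> _) => exact (sat_is_upair_raw _ _ _ _ _) : sat.
#[export] Hint Extern 1 (sat _ _ (is_succ _ _) <-> _) => exact (sat_is_succ_raw _ _ _ _) : sat.
#[export] Hint Extern 1 (sat _ _ (is_power _ _) <-> _) => exact (sat_is_power _ _ _ _) : sat.

Lemma closure_valid (M : Type) (E : M -> M -> Prop) A :
  (forall e, sat E e (closure A)) <-> (forall e, sat E e A).
Proof. exact: sat_iter_all. Qed.

Lemma sat_separation (M : Type) (E : M -> M -> Prop) A :
  (forall e, sat E e (ax_separation A)) <->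
  (forall e a, exists b, forall x, E x b <-> E x a /\ sat E (x .: e) A).
Proof.
rewrite closure_valid.
have H e : sat E e (fAll (fEx (fAll (fIff (fMem 0 1)
    (fAnd (fMem 0 2) (ren (fun n => if n is m.+1 then m.+3 else 0) A)))))) <->
    forall a, exists b, forall x, E x b <-> E x a /\ sat E (x .: e) A.
  apply: sat_all_iff => a; apply: sat_ex_iff => b; apply: sat_all_iff => x.
  apply: sat_iff_iff => //; apply: sat_and_iff => //; rewrite sat_ren.
  set e1 := fun n => _; suff -> : e1 = x .: e by [].
  by apply: functional_extensionality; case.
by split=> HA e; apply/H.
Qed.

Lemma sat_replacement (M : Type) (E : M -> M -> Prop) A :
  (forall e, sat E e (ax_replacement A)) <->
  (forall e, (forall x y z, sat E (y .: x .: e) A -> sat E (z .: x .: e) A -> y = z) ->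
    forall a, exists b, forall y, E y b <-> exists x, E x a /\ sat E (y .: x .: e) A).
Proof.
rewrite closure_valid; set B := fImp _ _.
suff H e : sat E e B <->
    ((forall x y z, sat E (y .: x .: e) A /\ sat E (z .: x .: e) A -> y = z) ->
    forall a, exists b, forall y, E y b <-> exists x, E x a /\ sat E (y .: x .: e) A).
  split=> HA e; last by apply/H => Hf; apply: HA => x y z H1 H2; apply: (Hf x).
  by move=> Hf; apply: (proj1 (H e) (HA e)) => x y z []; apply: Hf.
apply: sat_imp_iff.
  apply: sat_all_iff => x; apply: sat_all_iff => y; apply: sat_all_iff => z.
  apply: sat_imp_iff => //; apply: sat_and_iff; rewrite sat_ren //.
  set e1 := fun n => _; suff -> : e1 = z .: x .: e by [].
  by apply: functional_extensionality => -[|[]].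
apply: sat_all_iff => a; apply: sat_ex_iff => b; apply: sat_all_iff => y.
apply: sat_iff_iff => //; apply: sat_ex_iff => x; apply: sat_and_iff => //; rewrite sat_ren.
set e1 := fun n => _; suff -> : e1 = y .: x .: e by [].
by apply: functional_extensionality => -[|[]].
Qed.

Lemma sat_extensionality (M : Type) (E : M -> M -> Prop) e :
  sat E e ax_extensionality <-> forall x y, (forall z, E z x <-> E z y) -> x = y.
Proof. rewrite /ax_extensionality; sat_tac. Qed.

Lemma sat_foundation (M : Type) (E : M -> M -> Prop) e :
  sat E e ax_foundation <-> forall x, ~ (forall y, ~ E y x) ->
    exists y, E y x /\ ~ exists z, E z x /\ E z y.
Proof. rewrite /ax_foundation; sat_tac. Qed.

Lemma sat_pairing (M : Type) (E : M -> M -> Prop) e :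
  sat E e ax_pairing <-> forall x y, exists z, forall w, E w z <-> w = x \/ w = y.
Proof. rewrite /ax_pairing; sat_tac. Qed.

Lemma sat_union (M : Type) (E : M -> M -> Prop) e :
  sat E e ax_union <-> forall x, exists u, forall z, E z u <-> exists y, E z y /\ E y x.
Proof. rewrite /ax_union; sat_tac. Qed.

Lemma sat_power (M : Type) (E : M -> M -> Prop) e :
  sat E e ax_power <-> forall x, exists p, forall z, E z p <-> forall w, E w z -> E w x.
Proof. rewrite /ax_power; sat_tac. Qed.

Lemma sat_infinity (M : Type) (E : M -> M -> Prop) e :
  sat E e ax_infinity <-> exists w, (exists z, E z w /\ forall u, ~ E u z) /\
    forall x, E x w -> exists y, E y w /\ forall u, E u y <-> E u x \/ u = x.
Proof. rewrite /ax_infinity; sat_tac. Qed.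

(** Kept transparent, so that its carrier and membership reduce to those of the given model and
    satisfaction is literally the same. *)
Definition zf_of_model (M : Type) (E : M -> M -> Prop) (x0 : M)
  (H : forall A, ZF A -> forall e, sat E e A) : zf.
Proof.
apply: (@ZFModel M E).
- by apply/(sat_extensionality _ (fun=> x0))/H; constructor.
- move=> x y Hy.
  have /sat_foundation HF := H _ ZF_foundation (fun=> x0).
  have [|z [Hz Hn]] := HF x; first by move/(_ y).
  by exists z; split=> // w Hw Hx; apply: Hn; exists w.
- by apply/(sat_pairing _ (fun=> x0))/H; constructor.
- by apply/(sat_union _ (fun=> x0))/H; constructor.
- by apply/(sat_power _ (fun=> x0))/H; constructor.
- by apply/(sat_infinity _ (fun=> x0))/H; constructor.
- by move=> A; apply/sat_separation/H; constructor.
- by move=> A; apply/sat_replacement/H; constructor.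
Defined.

Lemma zf_sat_ZF (M : zf) A : ZF A -> forall e, sat (@mem M) e A.
Proof.
case=> [e|e|e|e|e|e|B|B].
- exact/sat_extensionality/zf_ext.
- apply/sat_foundation => x Hx; have [y Hy] : exists y, y ∈ x.
    by apply: NNPP => H; apply: Hx => y Hy; apply: H; exists y.
  have [z [Hz Hm]] := zf_foundation Hy; exists z; split=> // -[w [Hw Hwz]].
  exact: (Hm w).
- exact/sat_pairing/zf_pairing.
- exact/sat_union/zf_union.
- exact/sat_power/zf_power.
- exact/sat_infinity/zf_infinity.
- by apply/sat_separation => e a; apply: zf_separation.
- by apply/sat_replacement => e He a; apply: zf_replacement.
Qed.

Section SetTranslation.
Variable M : zf.
Implicit Types (e : nat -> M).
Local Notation sat := (sat (@mem M)).

Lemma sat_is_upair e p x y : sat e (is_upair p x y) <-> e p = upair (e x) (e y).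
Proof.
rewrite sat_is_upair_raw; split=> [H|-> z]; last exact: in_upair.
by apply: zf_ext => z; rewrite H in_upair.
Qed.

Lemma sat_is_opair e p x y : sat e (is_opair p x y) <-> e p = op (e x) (e y).
Proof.
have -> : sat e (is_opair p x y) <->
    forall z, z ∈ e p <-> z = upair (e x) (e x) \/ z = upair (e x) (e y).
  apply: sat_all_iff => z; apply: sat_iff_iff => //; apply: sat_or_iff; exact: sat_is_upair.
rewrite (_ : upair (e x) (e x) = sing (e x)); last by rewrite /sing seal_eq.
split=> [H|-> z]; last exact: in_op.
by apply: zf_ext => z; rewrite H in_op.
Qed.

Lemma sat_is_value e f x y : sat e (is_value f x y) <-> op (e x) (e y) ∈ e f.
Proof.
have -> : sat e (is_value f x y) <-> exists p, p = op (e x) (e y) /\ p ∈ e f.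
  by apply: sat_ex_iff => p; apply: sat_and_iff => //; apply: sat_is_opair.
by split=> [[p [-> //]]|H]; exists (op (e x) (e y)).
Qed.

#[local] Hint Extern 1 (sat _ (is_value _ _ _) <-> _) => exact (sat_is_value _ _ _ _) : sat.
#[local] Hint Extern 1 (sat _ (is_opair _ _ _) <-> _) => exact (sat_is_opair _ _ _ _) : sat.

Lemma sat_is_function e f : sat e (is_function f) <-> functional (e f).
Proof.
have -> : sat e (is_function f) <-> (forall p, p ∈ e f -> exists x y, p = op x y) /\
    (forall x y z, op x y ∈ e f /\ op x z ∈ e f -> y = z).
  rewrite /is_function; sat_tac.
by split=> -[H1 H2]; split=> // x y z; [move=> Hy Hz; apply: (H2 x) | case; apply: H2].
Qed.

Lemma sat_is_dom e f a : sat e (is_dom f a) <-> dom (e f) (e a).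
Proof. rewrite /is_dom /dom; sat_tac. Qed.
#[local] Hint Extern 1 (sat _ (is_function _) <-> _) => exact (sat_is_function _ _) : sat.
#[local] Hint Extern 1 (sat _ (is_dom _ _) <-> _) => exact (sat_is_dom _ _ _) : sat.

Lemma sat_is_map e f a b : sat e (is_map f a b) <-> maps (e f) (e a) (e b).
Proof. rewrite /is_map /maps; sat_tac. Qed.

Lemma sat_is_injective e f : sat e (is_injective f) <-> inj (e f).
Proof.
have -> : sat e (is_injective f) <-> forall x y z, op x z ∈ e f /\ op y z ∈ e f -> x = y.
  rewrite /is_injective; sat_tac.
by split=> H x y z; [move=> Hx Hy; apply: (H x y z) | case; apply: H].
Qed.

Lemma sat_is_onto e f b : sat e (is_onto f b) <-> onto (e f) (e b).
Proof. rewrite /is_onto /onto; sat_tac. Qed.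
#[local] Hint Extern 1 (sat _ (is_map _ _ _) <-> _) => exact (sat_is_map _ _ _ _) : sat.
#[local] Hint Extern 1 (sat _ (is_injective _) <-> _) => exact (sat_is_injective _ _) : sat.
#[local] Hint Extern 1 (sat _ (is_onto _ _) <-> _) => exact (sat_is_onto _ _ _) : sat.

Lemma sat_equipotent e a b : sat e (equipotent a b) <-> equip (e a) (e b).
Proof. rewrite /equipotent /equip; sat_tac. Qed.

(** On a transitive set, transitivity of membership as an order says that the elements are
    transitive sets. The remaining clauses follow from foundation and comparability of ordinals. *)
Lemma sat_is_ordinal e x : sat e (is_ordinal x) <-> Ord (e x).
Proof.
have -> : sat e (is_ordinal x) <-> trans (e x) /\
    (forall y, y ∈ e x -> y ∉ y) /\
    (forall y, y ∈ e x -> forall z, z ∈ e x -> forall w, w ∈ e x -> y ∈ z -> z ∈ w -> y ∈ w) /\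
    (forall y, y ∈ e x -> forall z, z ∈ e x -> y ∈ z \/ y = z \/ z ∈ y) /\
    (forall s, sub s (e x) /\ ~ (forall y, y ∉ s) ->
      exists y, y ∈ s /\ forall z, z ∈ s -> y = z \/ y ∈ z).
  rewrite /is_ordinal /well_ordered_by_mem /is_transitive /trans /sub; sat_tac.
split=> [[H1 [_ [H2 _]]]|H].
  split=> // y Hy z Hz w Hw; have Hzx := H1 _ Hy _ Hz; have Hwx := H1 _ Hzx _ Hw.
  exact: H2 Hw Hz.
split; first by case: H.
split; first by move=> y _; apply: mem_irr.
split; first by move=> y _ z _ w Hw Hyz Hzw; apply: Ord_trans Hyz Hzw; apply: Ord_mem Hw.
split; first by move=> y Hy z Hz; apply: Ord_tri; [exact: Ord_mem Hy | exact: Ord_mem Hz].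
move=> s [Hs Hne]; have [y Hy] : exists y, y ∈ s.
  by apply: NNPP => Hn; apply: Hne => y Hy; apply: Hn; exists y.
have [z [Hz Hm]] := zf_foundation Hy; exists z; split=> // w Hw.
have [|[|Hwz]] := Ord_tri (Ord_mem H (Hs _ Hz)) (Ord_mem H (Hs _ Hw)); auto.
by case: (Hm w).
Qed.
#[local] Hint Extern 1 (sat _ (equipotent _ _) <-> _) => exact (sat_equipotent _ _ _) : sat.
#[local] Hint Extern 1 (sat _ (is_ordinal _) <-> _) => exact (sat_is_ordinal _ _) : sat.

Lemma sat_is_succ e y x : sat e (is_succ y x) <-> e y = succ (e x).
Proof.
rewrite sat_is_succ_raw; split=> [H|-> z]; last exact: in_succ.
by apply: zf_ext => z; rewrite H in_succ.
Qed.

Lemma sat_is_limit e x : sat e (is_limit x) <-> is_lim (e x).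
Proof.
have -> : sat e (is_limit x) <-> Ord (e x) /\ ~ (forall y, y ∉ e x) /\
    ~ exists y, e x = succ y.
  apply: sat_and_iff; first exact: sat_is_ordinal.
  apply: sat_and_iff; first sat_tac.
  apply: sat_not_iff; apply: sat_ex_iff => y; exact: sat_is_succ.
split=> -[H1 [H2 H3]]; split=> //; split=> //.
  by apply: NNPP => Hn; apply: H2 => y Hy; apply: Hn; exists y.
by case: H2 => y Hy /(_ y).
Qed.
#[local] Hint Extern 1 (sat _ (is_limit _) <-> _) => exact (sat_is_limit _ _) : sat.

Lemma sat_is_omega_raw e w : sat e (is_omega w) <-> is_lim (e w) /\ forall n, n ∈ e w -> ~ is_lim n.
Proof. rewrite /is_omega; sat_tac. Qed.

Lemma sat_is_omega e w : sat e (is_omega w) <-> e w = omega M.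
Proof.
rewrite sat_is_omega_raw; have [Ho [Hl Hm]] := omega_least M.
split=> [[H1 H2]|->]; last by split=> // n; apply: omega_lim.
apply: sub_anti; last by apply: Hm => //; case: H1.
have [Hw _] := H1; have [H|//] := Ord_total Ho Hw.
by case: (H2 _ H).
Qed.

Lemma sat_is_countable e x : sat e (is_countable x) <-> countable (e x).
Proof.
have -> : sat e (is_countable x) <-> exists w, w = omega M /\ exists f, maps f (e x) w /\ inj f.
  apply: sat_ex_iff => w; apply: sat_and_iff; first exact: sat_is_omega.
  sat_tac.
by split=> [[w [-> H]] //|H]; exists (omega M).
Qed.
#[local] Hint Extern 1 (sat _ (is_countable _) <-> _) => exact (sat_is_countable _ _) : sat.

Lemma sat_is_omega1 e w : sat e (is_omega1 w) <->
  Ord (e w) /\ ~ countable (e w) /\ forall b, b ∈ e w -> countable b.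
Proof. rewrite /is_omega1; sat_tac. Qed.

Lemma sat_is_cofinal e f b a : sat e (is_cofinal f b a) <-> cofinal (e f) (e b) (e a).
Proof. rewrite /is_cofinal /cofinal; sat_tac. Qed.
#[local] Hint Extern 1 (sat _ (is_cofinal _ _ _) <-> _) => exact (sat_is_cofinal _ _ _ _) : sat.

Lemma sat_is_cf e b a : sat e (is_cf b a) <-> has_cof (e a) (e b).
Proof. rewrite /is_cf /has_cof; sat_tac. Qed.

Lemma sat_is_cardinal e k : sat e (is_cardinal k) <-> cardinal (e k).
Proof. rewrite /is_cardinal /cardinal; sat_tac. Qed.
#[local] Hint Extern 1 (sat _ (is_cf _ _) <-> _) => exact (sat_is_cf _ _ _) : sat.
#[local] Hint Extern 1 (sat _ (is_cardinal _) <-> _) => exact (sat_is_cardinal _ _) : sat.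
#[local] Hint Extern 1 (sat _ (is_omega _) <-> _) => exact (sat_is_omega_raw _ _) : sat.

Lemma sat_is_inaccessible e k : sat e (is_inaccessible k) <-> inaccessible (e k).
Proof. rewrite /is_inaccessible /inaccessible /sub; sat_tac. Qed.

Lemma sat_is_uniform_denumeration e f w :
  sat e (is_uniform_denumeration f w) <-> uniform_denumeration (e f) (e w).
Proof.
have -> : sat e (is_uniform_denumeration f w) <-> functional (e f) /\ dom (e f) (e w) /\
    forall a, a ∈ e w -> (exists z, z ∈ a) -> exists g, op a g ∈ e f /\
      exists o, o = omega M /\ maps g o a /\ onto g a.
  apply: sat_and_iff; first exact: sat_is_function.
  apply: sat_and_iff; first exact: sat_is_dom.
  apply: sat_allIn_iff => a; apply: sat_imp_iff; first sat_tac.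
  apply: sat_ex_iff => g; apply: sat_and_iff; first exact: sat_is_value.
  apply: sat_ex_iff => o; apply: sat_and_iff; first exact: sat_is_omega.
  sat_tac.
split=> -[H1 [H2 H3]]; split=> //; split=> // a Ha Hz; have [g [Hg H]] := H3 a Ha Hz.
  by exists g; case: H => o [-> []].
by exists g; split=> //; exists (omega M).
Qed.

Lemma sat_choice e : sat e ax_choice <->
  forall x : M, (forall y, y ∈ x -> exists z, z ∈ y) ->
  exists f, functional f /\ dom f x /\ forall y, y ∈ x -> exists z, op y z ∈ f /\ z ∈ y.
Proof.
have -> : sat e ax_choice <-> forall x : M, (forall y, y ∈ x -> ~ (forall z, z ∉ y)) ->
    exists f, functional f /\ dom f x /\ forall y, y ∈ x -> exists z, op y z ∈ f /\ z ∈ y.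
  rewrite /ax_choice; sat_tac.
split=> H x Hx; apply: H => y Hy; first by have [z Hz] := Hx y Hy; move/(_ z).
by apply: NNPP => Hn; apply: (Hx y Hy) => z Hz; apply: Hn; exists z.
Qed.

End SetTranslation.

Lemma L_model (M : zf) (k : L M) : inaccessible k -> consistent (adjoin ZFC exists_inaccessible).
Proof.
move=> Hk; apply: (model_consistent (E := @mem (L M)) k) => A [[HA|->]|->] e.
- exact: zf_sat_ZF.
- exact/sat_choice/constructible_choice/L_constructible.
by apply/sat_ex; exists k; apply/sat_is_inaccessible.
Qed.

Lemma bound_ZF A : ZF A -> bound A = 0.
Proof. by case=> // B; apply: bound_closure. Qed.

Theorem claim5p9p1 :
  consistent (adjoin (adjoin ZF omega1_regular) (fNot UD_omega1)) ->
  consistent (adjoin ZFC exists_inaccessible).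
Proof.
move=> /completeness[|M [E [[x0] HM]]].
  by move=> A [[/bound_ZF|->]|->].
pose Z := @zf_of_model M E x0 (fun A HA => HM A (or_introl (or_introl HA))).
have /sat_ex[k /sat_and[Hk1 Hk2]] : sat (@mem Z) (fun=> x0) omega1_regular.
  exact: (HM _ (or_introl (or_intror erefl))).
have HnUD : sat (@mem Z) (fun=> x0) (fNot UD_omega1) := HM _ (or_intror erefl) _.
have /(@sat_is_omega1 Z)[Ok [Hu Hc]] := Hk1.
have /(@sat_is_cf Z)[_ [_ Hreg]] := Hk2.
have [|k' Hk'] := omega1_inaccessible_in_L Ok Hu Hc Hreg; last exact: L_model Hk'.
move=> [f Hf]; apply: (proj1 (sat_not _ _ _) HnUD).
rewrite /UD_omega1; apply/sat_ex; exists k; apply/sat_and; split=> //.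
by apply/sat_ex; exists f; apply/(@sat_is_uniform_denumeration Z).
Qed.
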